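(* Let $n \geq 3$ and let $p$ be a prime number. Fix $b_1, b_2 \in \mathbb{Z}_p$ and let \[ V_n(\mathbb{Z}_p)_{a_1 = b_1, a_2 = b_2} = \{f(x) = x^n + a_1 x^{n - 1} + \ldots + a_n \in \mathbb{Z}_p[x] : a_1 = b_1, a_2 = b_2\}. \] If $p$ is odd, then \begin{align*} P^{\mathrm{sqf}}(V_n(\mathbb{Z}_p)_{a_1 = b_1, a_2 = b_2}) &= 1 - \frac{3p - 1}{p^2 (p + 1)} + O\left(\frac{\gcd(n, p)}{p^{\lfloor 3n/4 \rfloor - 1}}\right), \\ P^{\max}(V_n(\mathbb{Z}_p)_{a_1 = b_1, a_2 = b_2}) &= 1 - \frac{1}{p^2} + O\left(\frac{\gcd(n, p)}{p^{\lfloor 3n/4 \rfloor + \lfloor n/2 \rfloor - 1}}\right), \end{align*} where the implied constants are absolute, while for $p=2$, \[ P^{\mathrm{sqf}}(V_n(\mathbb{Z}_2)_{a_1 = b_1, a_2 = b_2}) = \frac{1}{2}, \qquad P^{\max}(V_n(\mathbb{Z}_2)_{a_1 = b_1, a_2 = b_2}) = \frac{3}{4}. \] These densities are positive if $n \geq 4$. If $b_1$ and $b_2$ are integers, then $P^{\max}(V_n(\mathbb{Z}_p)_{a_1 = b_1, a_2 = b_2}) = 1 - 1/p^2$ holds for all primes $p$ if and only if $n$ is a power of $2$ and $2 b_2 - (1 - 1/n) b_1^2 = 0$.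
   Context: $V_n(\mathbb{Z}_p)$ denotes the set of monic polynomials of degree $n$ over $\mathbb{Z}_p$, identified with $\mathbb{Z}_p^n$ via the coefficients $(a_1,\dots,a_n)$. A subset $\Sigma \subseteq V_n(\mathbb{Z}_p)$ defined by fixing exactly $k$ coefficients and imposing congruence conditions on the other $n-k$ coefficients is viewed as a subset of $\mathbb{Z}_p^{n-k}$ (of positive measure) equipped with the Haar measure. $P^{\mathrm{sqf}}(\Sigma)$ denotes the density (measure of the subset divided by measure of $\Sigma$) of $f \in \Sigma$ whose discriminant is not divisible by $p^2$. $P^{\max}(\Sigma)$ denotes the density of $f \in \Sigma$ such that $\mathbb{Z}_p[x]/(f(x))$ is the maximal order of $\mathbb{Q}_p[x]/(f(x))$. *)

(* Defs.v *)
From HB Require Import structures.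
From mathcomp Require Import all_boot all_order all_algebra.
From mathcomp Require Import all_classical all_reals all_analysis.

Set Implicit Arguments.
Unset Strict Implicit.
Unset Printing Implicit Defensive.

Import Order.TTheory GRing.Theory Num.Theory.

Local Open Scope ring_scope.
Local Open Scope classical_set_scope.

(* The ring of p-adic integers as the inverse limit of the rings Z/p^k: an
   element x is the coherent sequence of its residues x k in {0, .., p^k - 1}.
   The primality proof is a parameter of the type, so that every [padic_int p_pr] is
   an integral domain. *)
Record padic_int (p : nat) (p_pr : prime p) := PadicInt {
  zp_res :> nat -> nat;
  zp_coherent : forall k, (zp_res k.+1 %% p ^ k)%N = zp_res k }.

Section PadicIntegers.
Variables (p : nat) (p_pr : prime p).
Local Notation Zp := (padic_int p_pr).
Implicit Types x y z : Zp.

Lemma zp_inj x y : zp_res x =1 zp_res y -> x = y.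
Proof.
case: x y => [f hf] [g hg] /= /funext fg.
by move: hf; rewrite fg => hf; rewrite (Prop_irrelevance hf hg).
Qed.

HB.instance Definition _ := gen_eqMixin Zp.
HB.instance Definition _ := gen_choiceMixin Zp.

Lemma zp_mod x k : (x k %% p ^ k)%N = x k.
Proof. by rewrite -[in LHS]zp_coherent modn_mod zp_coherent. Qed.

Lemma zp_lt x k : (x k < p ^ k)%N.
Proof. by rewrite -zp_mod ltn_mod expn_gt0 prime_gt0. Qed.

Fact mk_zp_subproof (f : nat -> nat)
    (hf : forall k, f k.+1 = f k %[mod p ^ k]) k :
  ((f k.+1 %% p ^ k.+1) %% p ^ k)%N = (f k %% p ^ k)%N.
Proof. by rewrite modn_dvdm ?hf// dvdn_exp2l. Qed.

Definition mk_zp f hf : Zp := PadicInt p_pr (@mk_zp_subproof f hf).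

Fact zp_zero_subproof k : 0%N = 0%N %[mod p ^ k]. Proof. by []. Qed.
Fact zp_one_subproof k : 1%N = 1%N %[mod p ^ k]. Proof. by []. Qed.
Fact zp_opp_subproof x k :
  (p ^ k.+1 - x k.+1)%N = (p ^ k - x k)%N %[mod p ^ k].
Proof.
apply/eqP; rewrite -(eqn_modDr (x k.+1)) subnK ?(ltnW (zp_lt _ _))//.
rewrite -(modnDmr (p ^ k - x k)) zp_coherent.
by rewrite subnK ?(ltnW (zp_lt _ _))// expnS modnMl modnn.
Qed.
Fact zp_add_subproof x y k :
  (x k.+1 + y k.+1)%N = (x k + y k)%N %[mod p ^ k].
Proof. by rewrite -modnDm !zp_coherent. Qed.
Fact zp_mul_subproof x y k :
  (x k.+1 * y k.+1)%N = (x k * y k)%N %[mod p ^ k].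
Proof. by rewrite -modnMm !zp_coherent. Qed.

Definition zp_zero : Zp := mk_zp zp_zero_subproof.
Definition zp_one : Zp := mk_zp zp_one_subproof.
Definition zp_opp x : Zp := mk_zp (zp_opp_subproof x).
Definition zp_add x y : Zp := mk_zp (zp_add_subproof x y).
Definition zp_mul x y : Zp := mk_zp (zp_mul_subproof x y).

Fact zp_addA : associative zp_add.
Proof. by move=> x y z; apply: zp_inj => k /=; rewrite modnDml modnDmr addnA. Qed.
Fact zp_addC : commutative zp_add.
Proof. by move=> x y; apply: zp_inj => k /=; rewrite addnC. Qed.
Fact zp_add0 : left_id zp_zero zp_add.
Proof. by move=> x; apply: zp_inj => k /=; rewrite mod0n add0n zp_mod. Qed.
Fact zp_addN : left_inverse zp_zero zp_opp zp_add.
Proof.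
move=> x; apply: zp_inj => k /=.
by rewrite modnDml subnK ?(ltnW (zp_lt _ _))// modnn mod0n.
Qed.

HB.instance Definition _ :=
  GRing.isZmodule.Build Zp zp_addA zp_addC zp_add0 zp_addN.

Fact zp_mulA : associative zp_mul.
Proof. by move=> x y z; apply: zp_inj => k /=; rewrite modnMml modnMmr mulnA. Qed.
Fact zp_mulC : commutative zp_mul.
Proof. by move=> x y; apply: zp_inj => k /=; rewrite mulnC. Qed.
Fact zp_mul1 : left_id zp_one zp_mul.
Proof. by move=> x; apply: zp_inj => k /=; rewrite modnMml mul1n zp_mod. Qed.
Fact zp_mulDl : left_distributive zp_mul zp_add.
Proof.
by move=> x y z; apply: zp_inj => k /=; rewrite modnMml modnDm mulnDl.
Qed.
Fact zp_one_neq0 : zp_one != zp_zero.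
Proof.
apply/eqP => /(congr1 (fun x : Zp => x 1%N)) /=.
by rewrite expn1 mod0n modn_small ?prime_gt1.
Qed.

HB.instance Definition _ := GRing.Zmodule_isComNzRing.Build Zp
  zp_mulA zp_mulC zp_mul1 zp_mulDl zp_one_neq0.

Definition zp_unit : {pred Zp} := fun x => `[< exists y : Zp, y * x = 1 >].
Definition zp_inv x : Zp :=
  if pselect (exists y : Zp, y * x = 1) is left h then sval (cid h) else x.

Fact zp_mulVx : {in zp_unit, left_inverse 1 zp_inv *%R}.
Proof.
by move=> x /asboolP hx; rewrite /zp_inv; case: pselect => // h; case: cid.
Qed.
Fact zp_unitP x y : y * x = 1 -> zp_unit x.
Proof. by move=> yx; apply/asboolP; exists y. Qed.
Fact zp_inv_out : {in [predC zp_unit], zp_inv =1 id}.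
Proof.
by move=> x /negP hx; rewrite /zp_inv; case: pselect => // h; case: hx; apply/asboolP.
Qed.

HB.instance Definition _ := GRing.ComNzRing_hasMulInverse.Build Zp
  zp_mulVx zp_unitP zp_inv_out.

Fact zp_coherent_leq x k l : (k <= l)%N -> (x l %% p ^ k)%N = x k.
Proof.
move=> /subnK <-; elim: (l - k)%N => [|d IH]; first by rewrite add0n zp_mod.
by rewrite addSn -IH -(zp_coherent x (d + k)) modn_dvdm// dvdn_exp2l// leq_addl.
Qed.

Fact zp_integral x y : x * y = 0 -> (x == 0) || (y == 0).
Proof.
move=> xy; apply: contrapT => /negP; rewrite negb_or => /andP[x0 y0].
have neq0 z : z != 0 -> exists k, z k != 0%N.
  move=> z0; apply: contrapT => h; case/eqP: z0; apply: zp_inj => k /=.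
  by rewrite mod0n; apply/eqP/negPn/negP => zk; apply: h; exists k.
have [k xk] := neq0 _ x0; have [l yl] := neq0 _ y0.
have ndvd z i : z i != 0%N -> ~~ (p ^ i %| z (k + l))%N \/ (k + l < i)%N.
  move=> zi; case: (leqP i (k + l)) => hi; last by right.
  by left; rewrite /dvdn zp_coherent_leq.
have nx : ~~ (p ^ k %| x (k + l))%N.
  by case: (ndvd _ _ xk) => //; rewrite ltnNge leq_addr.
have ny : ~~ (p ^ l %| y (k + l))%N.
  by case: (ndvd _ _ yl) => //; rewrite ltnNge leq_addl.
have xp : (0 < x (k + l))%N by case: (x _) nx; rewrite ?dvdn0.
have yp : (0 < y (k + l))%N by case: (y _) ny; rewrite ?dvdn0.
have := congr1 (fun z : Zp => z (k + l)%N) xy.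
rewrite /= mod0n => /eqP; rewrite -/(dvdn _ _) pfactor_dvdn ?muln_gt0 ?xp//.
rewrite lognM//; move: nx ny; rewrite !pfactor_dvdn// -!ltnNge => nx ny.
by rewrite leqNgt -addSn leq_add// ltnW.
Qed.

HB.instance Definition _ := GRing.ComUnitRing_isIntegral.Build Zp zp_integral.

(* The p-adic topology: the classes x + p^k Zp form a neighbourhood basis of
   x. *)
Definition zp_ball x (k : nat) : set Zp := [set y | y k = x k].
Definition zp_nbhs x : set_system Zp := filter_from setT (zp_ball x).

HB.instance Definition _ := isPointed.Build Zp 0.
HB.instance Definition _ := hasNbhs.Build Zp zp_nbhs.

Fact zp_nbhs_filter x : ProperFilter (nbhs x).
Proof.
apply: filter_from_proper; last by move=> k _; exists x.
apply: filter_from_filter; first by exists 0%N.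
move=> k l _ _; exists (maxn k l) => // y yx.
split; rewrite /zp_ball/=.
  by rewrite -(zp_coherent_leq y (leq_maxl k l)) yx zp_coherent_leq// leq_maxl.
by rewrite -(zp_coherent_leq y (leq_maxr k l)) yx zp_coherent_leq// leq_maxr.
Qed.
Fact zp_nbhs_singleton x (A : set Zp) : nbhs x A -> A x.
Proof. by move=> [k _]; apply. Qed.
Fact zp_nbhs_nbhs x (A : set Zp) : nbhs x A -> nbhs x (nbhs^~ A).
Proof.
move=> [k _ kA]; exists k => // y yx; exists k => // z zy; apply: kA.
by move: yx zy; rewrite /zp_ball/= => <-.
Qed.

HB.instance Definition _ := Nbhs_isNbhsTopological.Build Zp
  zp_nbhs_filter zp_nbhs_singleton zp_nbhs_nbhs.

End PadicIntegers.

Local Notation "x %:F" := (@FracField.tofrac _ x) : ring_scope.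

(* The usual formula for f monic, provided that deg f' = deg f - 1, which always
   holds for f nonconstant in characteristic zero. *)
Definition discriminant (A : comNzRingType) (f : {poly A}) : A :=
  (- 1) ^+ 'C((size f).-1, 2) * resultant f f^`().

Section Orders.
Variables (A : idomainType) (K : algType {fraction A}).

(* A subring O of K which is the A-span of a finite family e spanning K over
   the fraction field of A. *)
Definition is_order (O : set K) : Prop :=
  [/\ O 1,
      forall x y, O x -> O y -> O (x - y),
      forall x y, O x -> O y -> O (x * y) &
      exists m (e : 'I_m -> K),
        (forall x, O x <-> exists c : 'I_m -> A, x = \sum_i (c i)%:F *: e i) /\
        (forall x, exists c : 'I_m -> {fraction A}, x = \sum_i c i *: e i)].

Definition is_maximal_order (O : set K) : Prop :=
  is_order O /\ forall O', is_order O' -> O `<=` O' -> O' = O.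

End Orders.

Section Densities.
Variables (p : nat) (p_pr : prime p).
Local Notation Zp := (padic_int p_pr).
Local Notation Qp := {fraction Zp}.

Definition to_Qp : {poly Zp} -> {poly Qp} := map_poly (@FracField.tofrac Zp).

(* [{poly %/ g}] is the quotient ring by g only when g is monic of positive
   degree; this is the case of all the polynomials in [Vn_fixed] below as soon
   as n > 0. *)
Definition quotient_algebra (f : {poly Zp}) : algType Qp :=
  {poly %/ to_Qp f}.

(* For f monic, Zp[x]/(f) embeds in Qp[x]/(f), with image the classes of the
   polynomials with coefficients in Zp. *)
Definition monogenic_order (f : {poly Zp}) : set (quotient_algebra f) :=
  [set in_qpoly (to_Qp f) (to_Qp g) | g in [set: {poly Zp}]].

Definition maximal_poly : set {poly Zp} :=
  [set f | is_maximal_order (@monogenic_order f)].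

Definition sqf_disc_poly : set {poly Zp} :=
  [set f | ~ exists c : Zp, discriminant f = p%:R ^+ 2 * c].

(* a_i is the coefficient of x^(n-i) *)
Definition Vn_fixed (n : nat) (b1 b2 : Zp) : set {poly Zp} :=
  [set f | [/\ f \is monic, size f = n.+1,
               f`_(n - 1) = b1 & f`_(n - 2) = b2]].

Definition borel_Zp (m : nat) := g_sigma_algebraType (@open 'rV[Zp]_m).

(* The Haar measure of Zp^m is the translation-invariant Borel probability
   measure. *)
Definition translation_invariant (R : realType) m
    (mu : {measure set (borel_Zp m) -> \bar R}) : Prop :=
  forall (v : 'rV[Zp]_m) (A : set (borel_Zp m)), measurable A ->
    mu ((fun a : 'rV[Zp]_m => a + v) @` A) = mu A.

(* The coordinates (a_3, .., a_n). *)
Definition free_coefs (n : nat) (f : {poly Zp}) : 'rV[Zp]_(n - 2) :=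
  \row_(i < n - 2) f`_(n - (i + 3)).

(* [Sigma] and [Q] are read in Zp^(n-2) through the coordinates a_3, .., a_n,
   so [Sigma] should have its first two coefficients fixed. *)
Definition density (R : realType) n
    (mu : {measure set (borel_Zp (n - 2)) -> \bar R})
    (Sigma Q : set {poly Zp}) : R :=
  fine (mu (free_coefs n @` (Sigma `&` Q))) / fine (mu (free_coefs n @` Sigma)).

Definition Psqf (R : realType) n
    (mu : {measure set (borel_Zp (n - 2)) -> \bar R}) Sigma : R :=
  density mu Sigma sqf_disc_poly.

Definition Pmax (R : realType) n
    (mu : {measure set (borel_Zp (n - 2)) -> \bar R}) Sigma : R :=
  density mu Sigma maximal_poly.

End Densities.

(* Main.v *)
(* Write f = d^2 g + p h with g squarefree mod p. Dedekind's criterion says that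
   Z_p[x]/(f) is maximal iff d and h are coprime mod p, and the Sylvester matrix
   shows that p^2 does not divide disc f iff either f is squarefree mod p, or p is
   odd, d = x - r with g(r) <> 0 mod p, and p^2 does not divide f(r). Both conditions
   only depend on f mod p^2, so the densities are counts of pairs of polynomials over
   F_p with prescribed coefficients of x^(n-1) and x^(n-2).

   Every pair (f, h) is uniquely (d^2 g, d k) with no nonconstant e such that e^2
   divides g and e divides k. For p odd, these two coefficients amount to the
   first two power sums of the roots, which are additive, so that inverting this
   decomposition expresses the counts through the number of points of the affine
   quadric sum w_i y_i = s, sum w_i y_i^2 = t, whose weights w_i are floor(n/2) times
   2, and 1 if n is odd. The trace form sum w_i y_i^2 restricted to the hyperplane is
   nondegenerate iff sum w_i = n is nonzero mod p, whence the gcd(n, p). For p = 2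
   the counts are computed directly.

   P^max - (1 - 1/p^2) is, up to sign and a power of p, the deviation of the number of points
   of the quadric from p^(N-2), where N is the number of weights. If p does not divide
   n, it vanishes iff N is even and n t = s^2; if p divides n and s and N is even, it
   does not vanish. So its vanishing for all p forces N to be even, n t = s^2 in Z and
   n to have no odd prime factor. *)

From HB Require Import structures.
Require Import Defs.
From mathcomp Require Import all_boot all_order all_algebra.
From mathcomp Require Import all_classical all_reals all_analysis.
From mathcomp Require cyclic finfield.
From mathcomp Require Import separable.
From mathcomp Require Import ring lra zify.

Set Implicit Arguments.
Unset Strict Implicit.
Unset Printing Implicit Defensive.

Import Order.TTheory GRing.Theory Num.Theory.
Local Open Scope ring_scope.

(** * Diagonal quadratic equations over finite fields *)

(** Power sums are additive, so multiplication by d^2 translates (s, t) by twice the power sums of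
    d. For deg d >= 2 these are equidistributed and such d contribute constants; only the d = x - c
    retain information. Each step of the recursion thus subtracts all translates by (2 c, 2 c^2),
    which creates one variable of weight 2 and one sign. In the squarefree density the double root
    must not be a root of g; dropping this condition replaces (x - r)^j g by (x - r)^(j+1) g' with
    g' of lower degree, so an alternating sum appears, with main term q^k (q - 1)/(q (q + 1)). A
    section with N = ceil(n/2) weights deviates by at most q^floor((N - 1)/2) = q^floor((n - 1)/4),
    times q if p | n, which accounts for the exponents with 3n/4. The constant 43 is 1 + 2 + 40,
    from the quadric itself, the two lowest degrees and a sum of powers of p. *)

Section QuadricCounting.
Variables (R : realFieldType) (F : finFieldType).
Hypothesis F2 : (2%:R : F) != 0.
Local Notation q := (#|F|%:R : R).

Fixpoint diag_count (ws : seq F) (t : F) : R :=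
  if ws is w :: ws' then \sum_y diag_count ws' (t - w * y ^+ 2)
  else (t == 0)%:R.

(** Points of the affine quadric sum w_i y_i = s, sum w_i y_i^2 = t. The counts live in [R] so that
    mean values and signs can be handled freely. *)
Fixpoint curve_count (ws : seq F) (s t : F) : R :=
  if ws is w :: ws' then \sum_y curve_count ws' (s - w * y) (t - w * y ^+ 2)
  else ((s == 0) && (t == 0))%:R.

Lemma sum_shift (f : F -> R) c : \sum_t f (t - c) = \sum_t f t.
Proof. by rewrite [RHS](reindex_inj (addIr (- c)))/=. Qed.

Lemma sum_const (c : R) : \sum_(t : F) c = q * c.
Proof. by rewrite sumr_const mulr_natl cardE. Qed.

Lemma sum_pred1 (f : F -> R) c : \sum_t (t == c)%:R * f t = f c.
Proof.
rewrite (bigD1 c)//= eqxx mul1r big1 ?addr0// => i /negPf ->.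
by rewrite mul0r.
Qed.

Lemma card_gt1 : 1 < q.
Proof. by rewrite ltr1n card_finNzRing_gt1. Qed.

Lemma card_neq0 : q != 0.
Proof. by have := card_gt1; lra. Qed.

Lemma sum_diag_count ws : \sum_t diag_count ws t = q ^+ size ws.
Proof.
elim: ws => [|w ws IH] /=.
  by rewrite -[RHS](sum_pred1 (fun=> 1) 0); apply: eq_bigr => t _; rewrite mulr1.
rewrite exchange_big/= -[in RHS]add1n exprD expr1 -IH -sum_const.
by apply: eq_bigr => y _; rewrite sum_shift.
Qed.

Lemma diag_count_cat us ws t :
  diag_count (us ++ ws) t = \sum_v diag_count us v * diag_count ws (t - v).
Proof.
elim: us t => [|u us IH] t /=.
  by rewrite (sum_pred1 (fun v => diag_count ws (t - v)) 0) subr0.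
under eq_bigr do rewrite IH.
under [in RHS]eq_bigr do rewrite mulr_suml.
rewrite [RHS]exchange_big/=; apply: eq_bigr => y _.
rewrite -[RHS](sum_shift _ (- (u * y ^+ 2))); apply: eq_bigr => v _.
by rewrite opprK addrK opprD [- v - _]addrC addrA.
Qed.

Lemma neq_opp (x : F) : x != 0 -> x != - x.
Proof.
by move=> x0; rewrite -subr_eq0 opprK -mulr2n -mulr_natl mulf_neq0.
Qed.

Definition nsqrt (u : F) : R := \sum_(x : F) (x ^+ 2 == u)%:R.

Lemma nsqrt0 : nsqrt 0 = 1.
Proof.
rewrite -[RHS](sum_pred1 (fun=> 1) 0); apply: eq_bigr => x _.
by rewrite sqrf_eq0 mulr1.
Qed.

Lemma nsqrt_sqr (x : F) : x != 0 -> nsqrt (x ^+ 2) = 2.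
Proof.
move=> x0; rewrite /nsqrt (bigD1 x)//= eqxx (bigD1 (- x)) /=; last first.
  by rewrite eq_sym neq_opp.
rewrite sqrrN eqxx big1 ?addr0// => y /andP[yx yNx].
by rewrite eqf_sqr (negPf yx) (negPf yNx).
Qed.

Lemma nsqrt_le2 u : nsqrt u <= 2.
Proof.
case: (pickP (fun x => x ^+ 2 == u)) => [x /eqP <-|no].
  have [->|/nsqrt_sqr->//] := eqVneq x 0.
  by rewrite expr0n/= nsqrt0 ler1n.
by rewrite /nsqrt big1 ?ler0n// => x _; rewrite no.
Qed.

Lemma nsqrtM u y : y != 0 -> nsqrt (u * y ^+ 2) = nsqrt u.
Proof.
move=> y0; rewrite /nsqrt (reindex_inj (mulIf y0)); apply: eq_bigr => x _.
by rewrite exprMn (inj_eq (mulIf _))// expf_neq0.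
Qed.

Lemma nsqrt_values u : u != 0 -> nsqrt u = 0 \/ nsqrt u = 2.
Proof.
move=> u0; case: (pickP (fun x => x ^+ 2 == u)) => [x /eqP xu|no]; [right|left].
  by rewrite -xu nsqrt_sqr//; apply: contraNneq u0 => x0; rewrite -xu x0 expr0n.
by rewrite /nsqrt big1// => x _; rewrite no.
Qed.

(** Squaring has fibres of size at most 2, and the fibre of 0 has size 1. *)
Lemma card_squares : (#|F| < 2 * #|[set x ^+ 2 | x : F]|)%N.
Proof.
rewrite -(ltr_nat R) natrM -[X in X < _]mulr1 -sum_const.
rewrite (partition_big_imset (fun x : F => x ^+ 2))/=.
rewrite (bigD1 0)/=; last by apply/imsetP; exists 0; rewrite ?expr0n.
have sumE u : \sum_(i : F | i ^+ 2 == u) (1 : R) = nsqrt u.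
  by rewrite /nsqrt [RHS]big_mkcond/= [LHS]big_mkcond; apply: eq_bigr => x _; case: eqP.
rewrite sumE nsqrt0.
rewrite (cardsD1 0) (_ : 0 \in _); last by apply/imsetP; exists 0; rewrite ?expr0n.
rewrite natrD mulrDr mulr1 ltr_leD//; first by rewrite ltr1n.
apply: (@le_trans _ _ (\sum_(i in [set x ^+ 2 | x : F] :\ 0) (2 : R))).
  under [leRHS]eq_bigl do rewrite in_setD1 andbC.
  by apply: ler_sum => u _; rewrite sumE nsqrt_le2.
by rewrite sumr_const -[leLHS]mulr_natr.
Qed.

(* The squares and the v - c u, u a square, are more than #|F| in total. *)
Lemma binary_represents (c v : F) : c != 0 ->
  exists x y, x ^+ 2 + c * y ^+ 2 = v.
Proof.
move=> c0; set A := [set x ^+ 2 | x : F]; pose B := [set v - c * u | u in A].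
have cardB : #|B| = #|A|.
  by apply: card_imset => x y /addrI/oppr_inj/(mulfI c0).
case: (set_0Vmem (A :&: B)) => [AB0|[u /setIP[/imsetP[x _ ux] /imsetP[w wA uw]]]].
  have /eqP := cardsUI A B; rewrite AB0 cards0 addn0 cardB.
  have leAB : (#|A :|: B| <= #|F|)%N := max_card _.
  by move: leAB card_squares; rewrite -/A => leAB ltA eqAB; lia.
have /imsetP[y _ wy] := wA; exists x, y; rewrite -ux -wy uw; ring.
Qed.

(** x^2 + (b/a) y^2 is the norm form of F[T]/(T^2 + b/a): multiplication by an element of norm v'/v
    maps one level set bijectively onto the other. *)
Lemma binary_count_const (a b v v' : F) : a != 0 -> b != 0 -> v != 0 -> v' != 0 ->
  diag_count [:: a; b] v = diag_count [:: a; b] v'.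
Proof.
move=> a0 b0 v0 v'0; have c0 : b / a != 0 by rewrite mulf_neq0 ?invr_neq0.
have [x0 [y0 Nxy]] := binary_represents (v' / v) c0.
pose h (z : F * F) := (z.1 * x0 - b / a * z.2 * y0, z.1 * y0 + z.2 * x0).
have N0 : v' / v != 0 by rewrite mulf_neq0 ?invr_neq0.
have hinj : injective h.
  (* The inverse of [h]: multiplication by the conjugate, divided by the norm. *)
  pose g (z : F * F) := ((z.1 * x0 + b / a * z.2 * y0) * (v / v'),
                         (- z.1 * y0 + z.2 * x0) * (v / v')).
  apply: (can_inj (g := g)) => -[z1 z2]; rewrite /g/h/=.
  have -> : v / v' = (x0 ^+ 2 + b / a * y0 ^+ 2)^-1 by rewrite Nxy invf_div.
  rewrite -Nxy in N0.
  by congr pair; apply: (mulIf N0); rewrite mulfVK//; ring.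
have cnt u : diag_count [:: a; b] u =
    \sum_(z : F * F) (a * z.1 ^+ 2 + b * z.2 ^+ 2 == u)%:R.
  rewrite /= pair_bigA; apply: eq_bigr => -[x y] _ /=; congr (_%:R); congr nat_of_bool.
  by rewrite -addrA -opprD subr_eq0 eq_sym.
rewrite !cnt [RHS](reindex_inj hinj); apply: eq_bigr => -[x y] _ /=.
have -> : a * (x * x0 - b / a * y * y0) ^+ 2 + b * (x * y0 + y * x0) ^+ 2 =
   (v' / v) * (a * x ^+ 2 + b * y ^+ 2).
  by rewrite -Nxy; field.
by rewrite -(inj_eq (mulfI N0) _ v) divfK.
Qed.

(** All nonzero levels have the same count and the counts add up to q^2, so the count at 0 decides.
    There each x <> 0 contributes the square roots of -(a/b) x^2, hence l is q or - q according as
    -a/b is a square or not. *)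
Lemma binary_count (a b : F) : a != 0 -> b != 0 ->
  exists2 l : R, l = q \/ l = - q &
    forall v, diag_count [:: a; b] v = q - l / q + l * (v == 0)%:R.
Proof.
move=> a0 b0; have q1 := card_gt1; have q0 := card_neq0.
have d0 : diag_count [:: a; b] 0 = 1 + (q - 1) * nsqrt (- (a / b)).
  rewrite /= (bigD1 0)//=; congr (_ + _).
    rewrite expr0n/= mulr0 subr0 -[RHS]nsqrt0; apply: eq_bigr => y _.
    by rewrite sub0r oppr_eq0 mulf_eq0 (negPf b0).
  rewrite -[q - 1](_ : \sum_(i : F | i != 0) 1 = _); last first.
    by rewrite -[q]mulr1 -sum_const [in RHS](bigD1 0)//= [RHS]addrC addKr.
  rewrite mulr_suml; apply: eq_bigr => x x0.
  rewrite mul1r -(nsqrtM _ x0); apply: eq_bigr => y _; congr (_%:R); congr nat_of_bool.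
  rewrite sub0r -opprD oppr_eq0 addrC addr_eq0 -(inj_eq (mulfI b0) (y ^+ 2)).
  by congr (_ == _); field.
have ab0 : - (a / b) != 0 by rewrite oppr_eq0 mulf_neq0// invr_neq0.
have sumd : diag_count [:: a; b] 0 + (q - 1) * diag_count [:: a; b] 1 = q ^+ 2.
  rewrite -(sum_diag_count [:: a; b]) [RHS](bigD1 0)//; congr (_ + _).
  rewrite (eq_bigr (fun=> diag_count [:: a; b] 1)) => [|v v0]; last first.
    by apply: binary_count_const => //; apply: oner_neq0.
  rewrite sumr_const -[RHS]mulr_natl; congr (_ * _).
  by rewrite cardC1 -subn1 natrB//; apply/card_gt0P; exists 0.
have d1 l : diag_count [:: a; b] 1 = q - l / q -> diag_count [:: a; b] 0 = q - l / q + l ->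
    forall v, diag_count [:: a; b] v = q - l / q + l * (v == 0)%:R.
  move=> h1 h0 v; have [->|v0] := eqVneq v 0; first by rewrite mulr1.
  by rewrite mulr0 addr0 -h1; apply: binary_count_const => //; apply: oner_neq0.
have q10 : q - 1 != 0 by lra.
case: (nsqrt_values ab0) => E; rewrite {}E in d0; [exists (- q); first by right|exists q; first by left];
  apply: d1; rewrite ?mulNr ?divff//.
- by apply: (mulfI q10); rewrite d0 in sumd; lra.
- by rewrite d0; lra.
- by apply: (mulfI q10); rewrite d0 in sumd; lra.
- by rewrite d0; lra.
Qed.

(** The deviation from the mean, written as a quotient because for the empty list the mean is
    1/q. *)
Definition diag_error ws t : R := diag_count ws t - q ^+ size ws / q.

(** Convolution with [binary_count]: its constant q gives the mean value, and the remaining part, l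
    times (delta at 0 minus 1/q), multiplies the error of [ws] by l. *)
Lemma diag_error_pair (a b : F) : a != 0 -> b != 0 ->
  exists2 l : R, l = q \/ l = - q &
    forall ws t, diag_error [:: a, b & ws] t = l * diag_error ws t.
Proof.
move=> a0 b0; have [l lq dE] := binary_count a0 b0; exists l => // ws t.
rewrite /diag_error -[[:: a, b & ws]]/([:: a; b] ++ ws) diag_count_cat.
under eq_bigr do rewrite dE mulrDl -(mulrA l).
rewrite big_split/= -!mulr_sumr (sum_pred1 (fun v => diag_count ws (t - v))) subr0.
have -> : \sum_v diag_count ws (t - v) = q ^+ size ws.
  rewrite -sum_diag_count [RHS](reindex_inj (inj_comp (addrI t) oppr_inj))/=.
  by apply: eq_bigr.
have q0 := card_neq0; rewrite !exprS; case: lq => ->; field; exact: q0.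
Qed.

Lemma diag_error1 (w t : F) : w != 0 -> diag_error [:: w] t = nsqrt (t / w) - 1.
Proof.
move=> w0; rewrite /diag_error/= expr1 divff ?card_neq0//; congr (_ - _).
apply: eq_bigr => y _; congr (_%:R); congr nat_of_bool.
by rewrite subr_eq0 -(inj_eq (mulIf w0) (y ^+ 2)) divfK// eq_sym mulrC.
Qed.

Lemma diag_error_ind (P : seq F -> Prop) : P [::] -> (forall w, w != 0 -> P [:: w]) ->
  (forall a b ws, a != 0 -> b != 0 -> P ws -> P [:: a, b & ws]) ->
  forall ws, all (fun w => w != 0) ws -> P ws.
Proof.
move=> P0 P1 P2 ws; have [n] := ubnP (size ws).
elim: n ws => // n IH [|a [|b ws]]//= size_ws; first by rewrite andbT => /P1.
by move=> /and3P[a0 b0 ws0]; apply: P2 => //; apply: IH => //; exact: ltnW.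
Qed.

Lemma diag_error_bound ws t : all (fun w => w != 0) ws ->
  `|diag_error ws t| <= q ^+ (size ws)./2.
Proof.
move=> ws0; move: ws ws0 t; have q1 := card_gt1.
apply: diag_error_ind => [t|w w0 t|a b ws a0 b0 IH t] /=.
- rewrite /diag_error/= expr0 div1r.
  have qi0 : 0 < q^-1 by rewrite invr_gt0; lra.
  have qi1 : q^-1 <= 1 by rewrite invf_le1; lra.
  by case: (t == 0) => /=; rewrite ?mulr0n ?mulr1n ler_norml; lra.
- rewrite diag_error1// expr0; have [->|t0] := eqVneq t 0.
    by rewrite mul0r nsqrt0 subrr normr0.
  have /nsqrt_values[->|->] : t / w != 0 by rewrite mulf_neq0// invr_neq0.
    by rewrite sub0r normrN normr1.
  by rewrite (_ : 2 - 1 = 1) ?normr1//; lra.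
- have [l lq ->] := diag_error_pair a0 b0.
  rewrite normrM exprS ler_pM//; case: lq => ->; rewrite ?normrN ger0_norm//; lra.
Qed.

(** Two weights at a time change the error by a factor q or - q, so a single weight decides: there
    the error is [nsqrt (t / w)] - 1, and only 0 has exactly one square root. *)
Lemma diag_error_odd ws t : all (fun w => w != 0) ws -> odd (size ws) ->
  (diag_error ws t == 0) = (t == 0).
Proof.
move=> ws0; move: ws ws0 t; apply: diag_error_ind => // [w w0 t _|a b ws a0 b0 IH t /=].
- rewrite diag_error1//; have [->|t0] := eqVneq t 0.
    by rewrite mul0r nsqrt0 subrr eqxx.
  have /nsqrt_values[->|->] : t / w != 0 by rewrite mulf_neq0// invr_neq0.
    by rewrite sub0r oppr_eq0 oner_eq0.
  by rewrite subr_eq0 (eqr_nat R 2 1).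
- rewrite negbK => /IH <-; have [l lq ->] := diag_error_pair a0 b0.
  by rewrite mulf_eq0; case: lq => ->; rewrite ?oppr_eq0 (negPf card_neq0).
Qed.

(** The same descent ends at the empty list, whose error is 1 - 1/q or - 1/q. *)
Lemma diag_error_even ws t : all (fun w => w != 0) ws -> ~~ odd (size ws) ->
  diag_error ws t != 0.
Proof.
move=> ws0; move: ws ws0 t; have q1 := card_gt1.
apply: diag_error_ind => // [t _|a b ws a0 b0 IH t /=].
- rewrite /diag_error/= expr0 div1r; case: (t == 0) => /=; last first.
    by rewrite sub0r oppr_eq0 invr_eq0 card_neq0.
  by rewrite subr_eq0 eq_sym invr_eq1; lra.
- rewrite negbK => /IH e0; have [l lq ->] := diag_error_pair a0 b0.
  by rewrite mulf_neq0//; case: lq => ->; rewrite ?oppr_eq0 card_neq0.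
Qed.

Definition weight (ws : seq F) : F := \sum_(w <- ws) w.

(** Translation of every coordinate by c. *)
Lemma curve_count_shift ws s t c :
  curve_count ws (s + c * weight ws) (t + 2 * c * s + c ^+ 2 * weight ws) =
  curve_count ws s t.
Proof.
rewrite /weight; elim: ws s t => [|w ws IH] s t /=.
  rewrite big_nil !mulr0 !addr0; have [->|//] := eqVneq s 0.
  by rewrite mulr0 addr0.
rewrite big_cons [LHS](reindex_inj (addIr c)); apply: eq_bigr => y _ /=.
by rewrite -[RHS]IH; congr curve_count; ring.
Qed.

Lemma sum_curve_count_fst ws t : \sum_s curve_count ws s t = diag_count ws t.
Proof.
elim: ws t => [|w ws IH] t /=.
  under eq_bigr do rewrite -mulnb natrM.
  by rewrite (sum_pred1 (fun=> (t == 0)%:R)).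
rewrite exchange_big/=; apply: eq_bigr => y _.
by rewrite (sum_shift (fun s => curve_count ws s _)) IH.
Qed.

Lemma sum_curve_count_snd (w : F) ws s : w != 0 ->
  \sum_t curve_count (w :: ws) s t = q ^+ size ws.
Proof.
move=> w0 /=; rewrite exchange_big/=.
under eq_bigr do rewrite (sum_shift (curve_count ws _)).
rewrite exchange_big/= -sum_diag_count; apply: eq_bigr => t _.
rewrite -sum_curve_count_fst.
have hinj : injective (fun y => s - w * y) by move=> x y /addrI/oppr_inj/(mulfI w0).
by rewrite [RHS](reindex_inj hinj).
Qed.

Lemma sum2_curve_count ws : \sum_s \sum_t curve_count ws s t = q ^+ size ws.
Proof.
rewrite exchange_big/= -sum_diag_count; apply: eq_bigr => t _.
exact: sum_curve_count_fst.
Qed.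

(* If W := weight ws is nonzero, completing the square turns the affine section
   sum w y = s of the quadric into the orthogonal complement of (1, .., 1), a
   vector of norm W, and adding the form - W z^2 makes the whole space split off
   a hyperbolic plane. *)
Lemma curve_count_nondeg (w : F) ws s t : w != 0 -> let ws' := w :: ws in
  weight ws' != 0 ->
  curve_count ws' s t - q ^+ size ws' / q ^+ 2 =
    diag_error (- weight ws' :: ws') (t - s ^+ 2 / weight ws') / q.
Proof.
move=> w0 ws' W0; set W := weight ws'; have q0 := card_neq0.
have sndE : \sum_u curve_count ws' 0 u = q ^+ size ws by exact: sum_curve_count_snd.
have sizeE : size ws' = (size ws).+1 by [].
clearbody ws'.
(* Completing the square: translation by s'/W reduces to the section through 0. *)
have cE s' t' : curve_count ws' s' t' = curve_count ws' 0 (t' - s' ^+ 2 / W).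
  rewrite -(curve_count_shift ws' 0 _ (s' / W)); congr curve_count.
    by rewrite add0r divfK.
  by rewrite mulr0 addr0 -/W; field.
set u := t - _.
have -> : diag_error (- W :: ws') u = q * curve_count ws' 0 u +
    (q - 1) * q ^+ size ws - q ^+ size ws'; last first.
  by rewrite [curve_count ws' s t]cE -/u sizeE !exprS; field.
rewrite /diag_error exprS mulrAC divff// mul1r; congr (_ - _).
have -> : diag_count (- W :: ws') u =
    \sum_a \sum_b curve_count ws' 0 (u + W * (a * b)).
  have -> : diag_count (- W :: ws') u =
    \sum_z diag_count ws' (u - - W * z ^+ 2) by [].
  under eq_bigr do rewrite -sum_curve_count_fst.
  under eq_bigr do rewrite (reindex_inj (mulfI W0)).
  rewrite pair_bigA [RHS]pair_bigA/=.
  (* The coordinates a = z - s and b = z + s turn z^2 - s^2 into a b; they are invertible since 2 <>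
     0. *)
  pose h (z : F * F) := (z.1 - z.2, z.1 + z.2).
  have hinj : injective h.
    apply: (can_inj (g := fun z => ((z.1 + z.2) / 2, (z.2 - z.1) / 2))) => -[x y].
    by rewrite /h/=; congr pair; field.
  rewrite [RHS](reindex_inj hinj); apply: eq_bigr => -[x y] _ /=.
  by rewrite cE; congr curve_count; rewrite -/W; field.
(* For a = 0 the variable b is free; for a <> 0 it makes the level run once over F. *)
rewrite (bigD1 0)//=; congr (_ + _).
  by under eq_bigr do rewrite mul0r mulr0 addr0; rewrite sum_const.
rewrite (eq_bigr (fun=> q ^+ size ws)) => [|a a0]; last first.
  rewrite -sndE.
  have hinj : injective (fun b => u + W * (a * b)).
    by move=> x y /addrI/(mulfI W0)/(mulfI a0).
  by rewrite [RHS](reindex_inj hinj).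
rewrite sumr_const -[LHS]mulr_natl; congr (_ * _).
by rewrite cardC1 -subn1 natrB//; apply/card_gt0P; exists 0.
Qed.

(** With zero total weight a translation fixes s and moves t by 2 c s, so the count does not depend
    on t. *)
Lemma curve_count_deg_neq0 (w : F) ws s t : w != 0 -> weight (w :: ws) = 0 -> s != 0 ->
  curve_count (w :: ws) s t = q ^+ size (w :: ws) / q ^+ 2.
Proof.
move=> w0 W0 s0; set ws' := w :: ws; have q0 := card_neq0.
have cst u : curve_count ws' s u = curve_count ws' s t.
  rewrite -(curve_count_shift ws' s t ((u - t) / (2 * s))) W0 !mulr0 !addr0.
  by congr curve_count; field; rewrite s0 F2.
have := sum_curve_count_snd ws s w0; rewrite -/ws'.
under eq_bigr do rewrite cst.
rewrite sum_const => /(canRL (mulKf q0)) ->; rewrite /ws'/= !exprS.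
by field.
Qed.

(** The sections with s <> 0 have exactly the mean number of points, so the whole deviation of the
    quadric sits at s = 0. *)
Lemma curve_count_deg0 (w : F) ws t : w != 0 -> weight (w :: ws) = 0 ->
  curve_count (w :: ws) 0 t - q ^+ size (w :: ws) / q ^+ 2 = diag_error (w :: ws) t.
Proof.
move=> w0 W0; rewrite /diag_error -sum_curve_count_fst (bigD1 0)//=.
rewrite -[RHS]addrA; congr (_ + _); have q0 := card_neq0.
rewrite (eq_bigr (fun=> q ^+ size (w :: ws) / q ^+ 2)) => [|s s0]; last first.
  exact: curve_count_deg_neq0.
rewrite sumr_const -[X in X + _]mulr_natl cardC1 -subn1 natrB ?/=; last first.
  by apply/card_gt0P; exists 0.
by rewrite !exprS; field.
Qed.

(** In the nondegenerate case the enlarged form has N + 1 weights, and the division by q lowers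
    floor((N + 1)/2) to floor((N - 1)/2). *)
Lemma curve_count_bound ws s t : ws != [::] -> all (fun w => w != 0) ws ->
  `|curve_count ws s t - q ^+ size ws / q ^+ 2| <=
    q ^+ ((size ws).-1./2 + (weight ws == 0)).
Proof.
case: ws => // w ws _ ws0; have /andP[w0 _] := ws0; have q1 := card_gt1.
have [W0|W0] := eqVneq (weight (w :: ws)) 0; last first.
  rewrite addn0 curve_count_nondeg// normrM normfV (ger0_norm (ler0n _ _)).
  rewrite ler_pdivrMr ?(lt_trans _ q1)// -exprSr.
  by apply: le_trans (diag_error_bound _ _) _ => //=; rewrite oppr_eq0 W0.
have [->|s0] := eqVneq s 0.
  rewrite curve_count_deg0//; apply: le_trans (diag_error_bound _ ws0) _.
  by rewrite ler_eXn2l//=; lia.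
by rewrite curve_count_deg_neq0// subrr normr0 exprn_ge0// ltW// (lt_trans _ q1).
Qed.

Lemma curve_count_cons0 ws s t : curve_count (0 :: ws) s t = q * curve_count ws s t.
Proof. by rewrite /=; under eq_bigr do rewrite !mul0r !subr0; rewrite sum_const. Qed.

End QuadricCounting.

(** * Counting squarefree polynomials *)

Section SquareDecomposition.
Variable F : fieldType.
Implicit Types f g h d k : {poly F}.

(* [square_reduced f 0] says that f is squarefree. *)
Definition square_reduced f h : Prop :=
  forall d, d ^+ 2 %| f -> d %| h -> (size d <= 1)%N.

Lemma monic_associate d : d != 0 -> exists2 e, e \is monic & e %= d.
Proof.
move=> d0; exists ((lead_coef d)^-1 *: d).
  by rewrite monicE lead_coefZ mulVf// lead_coef_eq0.
by rewrite eqp_scale// invr_eq0 lead_coef_eq0.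
Qed.

Lemma square_decomposition f h : f != 0 -> exists d g k,
  [/\ d \is monic, f = d ^+ 2 * g, h = d * k & square_reduced g k].
Proof.
have [n] := ubnP (size f); elim: n f h => // n IH f h fn f0.
have [red|] := pselect (square_reduced f h).
  by exists 1, f, h; rewrite monic1 expr1n !mul1r.
move=> /existsNP[d' /not_implyP[d'f /not_implyP[d'h /negP]]]; rewrite -ltnNge => d'1.
have d'0 : d' != 0 by rewrite -size_poly_gt0 (leq_trans _ d'1).
have [e e_mon ed] := monic_associate d'0.
have : e ^+ 2 %| f by rewrite (eqp_dvdl _ (eqp_exp 2 ed)).
have : e %| h by rewrite (eqp_dvdl _ ed).
move=> /dvdpP[h' hE] /dvdpP[f' fE].
have e1 : (1 < size e)%N by rewrite (eqp_size ed).
have f'0 : f' != 0 by apply: contraNneq f0 => f'0; rewrite fE f'0 mul0r.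
have f'n : (size f' < n)%N.
  have e0 := monic_neq0 e_mon.
  move: fn; rewrite fE expr2 mulrA !size_Mmonic ?mulf_neq0//.
  by move: (size f') (size e) e1 => a b; lia.
have [d [g [k [d_mon f'E h'E red]]]] := IH f' h' f'n f'0.
exists (e * d), g, k; split=> //; first by rewrite monicMl.
  by rewrite fE f'E; ring.
by rewrite hE h'E; ring.
Qed.

(** With e = gcd(d', d), the cofactor a = d'/e is coprime to d/e; hence a^2 divides g and a divides
    k, and a is constant because (g, k) is reduced. *)
Lemma square_decomposition_dvd f h d g k d' : f != 0 ->
  f = d ^+ 2 * g -> h = d * k -> square_reduced g k ->
  d' ^+ 2 %| f -> d' %| h -> d' %| d.
Proof.
move=> f0 fE hE red d'f d'h.
have d0 : d != 0 by apply: contraNneq f0 => d0; rewrite fE d0 expr0n mul0r.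
set e := gcdp d' d; have e0 : e != 0 by rewrite gcdp_eq0 (negPf d0) andbF.
have /dvdpP[a d'E] : e %| d' by exact: dvdp_gcdl.
have /dvdpP[b dE] : e %| d by exact: dvdp_gcdr.
have ab : coprimep a b.
  have : coprimep (d' %/ e) (d %/ e) by apply: coprimep_div_gcd; rewrite d0 orbT.
  by rewrite d'E dE !mulpK.
have a1 : (size a <= 1)%N.
  apply: red.
    move: d'f; rewrite fE d'E dE !exprMn [b ^+ 2 * _ * _]mulrAC.
    rewrite dvdp_mul2r ?expf_neq0// Gauss_dvdpr//.
    by rewrite coprimep_expl// coprimep_expr.
  move: d'h; rewrite hE d'E dE [b * _ * _]mulrAC.
  by rewrite dvdp_mul2r// Gauss_dvdpr.
have a0 : a != 0.
  apply: contraNneq f0 => a0; move: d'f.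
  by rewrite d'E a0 mul0r expr0n/= dvd0p.
have : a %= 1 by rewrite -size_poly_eq1 eqn_leq a1 size_poly_gt0.
by rewrite d'E dE dvdp_mul2r// => /eqp_dvdl->; exact: dvd1p.
Qed.

Lemma square_decomposition_unique f h d g k d' g' k' : f != 0 ->
  d \is monic -> f = d ^+ 2 * g -> h = d * k -> square_reduced g k ->
  d' \is monic -> f = d' ^+ 2 * g' -> h = d' * k' -> square_reduced g' k' ->
  d = d'.
Proof.
move=> f0 dm fE hE red d'm fE' hE' red'.
apply/eqP; rewrite -eqp_monic// /eqp.
by rewrite (square_decomposition_dvd f0 fE' hE' red') ?(square_decomposition_dvd f0 fE hE red)//
  ?fE ?hE ?dvdp_mulIl// -?fE -?hE ?fE' ?hE' dvdp_mulIl.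
Qed.
End SquareDecomposition.

Section MonicPolynomials.
Variable F : finFieldType.
Implicit Types f g h : {poly F}.

Definition mon n (a : {poly_n F}) : {poly F} := 'X^n + a.

Lemma size_mon n (a : {poly_n F}) : size (mon a) = n.+1.
Proof. by rewrite size_polyDl size_polyXn// ltnS size_npoly. Qed.

Lemma mon_monic n (a : {poly_n F}) : mon a \is monic.
Proof.
rewrite monicE lead_coefDl ?lead_coefXn// size_polyXn ltnS.
exact: size_npoly.
Qed.

Lemma mon_neq0 n (a : {poly_n F}) : mon a != 0.
Proof. exact: monic_neq0 (mon_monic a). Qed.

Lemma mon_inj n : injective (@mon n).
Proof. by move=> a b /addrI/val_inj. Qed.

Lemma monP n f : f \is monic -> size f = n.+1 -> exists a : {poly_n F}, f = mon a.
Proof.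
move=> fm fn; have sz : (size (f - 'X^n)%R <= n)%N.
  apply/leq_sizeP => j; rewrite leq_eqVlt => /predU1P[<-|nj].
    by rewrite coefB coefXn eqxx -[n]/(n.+1.-1) -fn -lead_coefE (monicP fm) subrr.
  by rewrite coefB coefXn gtn_eqF// subr0 nth_default// fn.
by exists (npolyp n (f - 'X^n)); rewrite /mon npolypK// addrC subrK.
Qed.
End MonicPolynomials.

Section ReducedCount.
Variables (R : realFieldType) (F : finFieldType) (tau : bool).
Local Notation q := (#|F|%:R : R).

(** Dedekind's condition only sees h modulo d, and d^2 | f bounds deg d by n/2, so n/2 coefficients
    suffice. Since floor((n - 2 i)/2) = floor(n/2) - i, this bound is compatible with passing from
    (d^2 g, d k) to (g, k). *)
Definition hdim n : nat := tau * n./2.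

(* For tau = false, h = 0 and this counts squarefree polynomials. For tau = true, the
   pairs stand for the polynomials modulo p^2 satisfying Dedekind's criterion. *)
Definition red_count n (K : {poly F} -> bool) : R :=
  \sum_(z : {poly_n F} * {poly_(hdim n) F})
    (K (mon z.1) && `[< square_reduced (mon z.1) z.2 >])%:R.

Lemma size_mul_hdim n i (d k : {poly F}) : d \is monic -> size d = i.+1 -> (i.*2 <= n)%N ->
  (size (d * k)%R <= hdim n)%N = (size k <= hdim (n - i.*2))%N.
Proof.
move=> dm di le_in; have [->|k0] := eqVneq k 0; first by rewrite mulr0 size_poly0.
have := size_poly_gt0 k; rewrite k0 size_monicM// di /hdim.
by case: tau; rewrite ?mul1n ?mul0n; move: (size k) => s; lia.
Qed.

Definition squared_by n i (z : {poly_n F} * {poly_(hdim n) F}) (d : {poly_i F}) : Prop :=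
  exists g k, [/\ mon z.1 = mon d ^+ 2 * g, z.2 = mon d * k :> {poly F} & square_reduced g k].

Lemma sum_squared_by n (z : {poly_n F} * {poly_(hdim n) F}) :
  \sum_(i < n./2.+1) \sum_(d : {poly_i F}) `[< squared_by z d >]%:R = 1 :> R.
Proof.
have [d [g [k [dm fE hE red]]]] := square_decomposition z.2 (mon_neq0 z.1).
have d0 := monic_neq0 dm.
have [i di] : exists i, size d = i.+1 by exists (size d).-1; rewrite prednK// size_poly_gt0.
have g0 : g != 0.
  by apply: contraNneq (mon_neq0 z.1) => g0; rewrite fE g0 mulr0.
have ile : (i < n./2.+1)%N.
  have := size_poly_gt0 g; rewrite g0.
  have := size_mon z.1; rewrite fE expr2 -mulrA !size_monicM ?mulf_neq0//.
  by rewrite di; move: (size g) => sg; lia.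
have [a dE] := monP dm di.
have byE j (b : {poly_j F}) : `[< squared_by z b >] = (mon b == d).
  apply/asboolP/eqP => [[g' [k' [fE' hE' red']]]|dE'].
    exact: square_decomposition_unique (mon_neq0 z.1) (mon_monic b) fE' hE' red' dm fE hE red.
  by exists g, k; rewrite dE'.
rewrite (bigD1 (Ordinal ile))//= (bigD1 a)//= byE dE eqxx !big1 ?addr0// => [j ji|b ba].
  apply: big1 => b _; rewrite byE; case: eqP => // dE'; case/negP: ji.
  by apply/eqP/val_inj/succn_inj; rewrite /= -(size_mon b) -di dE'.
by rewrite byE dE (inj_eq (@mon_inj _ _)) (negPf ba).
Qed.

(* Every pair (f, h) with f monic of degree n and deg h < hdim n is (d^2 g, d k)
   for a unique monic d and a unique reduced pair (g, k). *)
Lemma red_count_rec n (K : {poly F} -> bool) :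
  \sum_(i < n./2.+1) \sum_(d : {poly_i F})
     red_count (n - i.*2) (fun g => K (mon d ^+ 2 * g)) =
  (\sum_(a : {poly_n F}) (K (mon a))%:R) * q ^+ hdim n.
Proof.
have -> : (\sum_(a : {poly_n F}) (K (mon a))%:R) * q ^+ hdim n =
    \sum_(z : {poly_n F} * {poly_(hdim n) F}) (K (mon z.1))%:R * 1 :> R.
  rewrite mulr_suml -(pair_bigA _ (fun a b => (K (mon a))%:R * 1))/=.
  by apply: eq_bigr => a _; rewrite sumr_const card_npoly mulr1 -natrX mulr_natr.
transitivity (\sum_(z : {poly_n F} * {poly_(hdim n) F}) (K (mon z.1))%:R *
    \sum_(i < n./2.+1) \sum_(d : {poly_i F}) `[< squared_by z d >]%:R : R); last first.
  by apply: eq_bigr => z _; rewrite sum_squared_by.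
under [RHS]eq_bigr do rewrite mulr_sumr.
rewrite [RHS]exchange_big/=; apply: eq_bigr => i _.
under [RHS]eq_bigr do rewrite mulr_sumr.
rewrite [RHS]exchange_big/=; apply: eq_bigr => d _.
have le_in : (i.*2 <= n)%N by have := ltn_ord i; lia.
pose m := (n - i.*2)%N; rewrite -/m.
have szd : size (mon d ^+ 2) = i.*2.+1.
  by rewrite expr2 size_monicM ?mon_monic ?mon_neq0// size_mon; lia.
have dm2 : mon d ^+ 2 \is monic by rewrite monic_exp// mon_monic.
(* Multiplication by (d^2, d), a bijection from the reduced pairs of degree n - 2 i onto the pairs
   with square part d. *)
pose phi (z : {poly_m F} * {poly_(hdim m) F}) : {poly_n F} * {poly_(hdim n) F} :=
  (npolyp n (mon d ^+ 2 * mon z.1 - 'X^n), npolyp (hdim n) (mon d * z.2)).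
have phi1 z : mon (phi z).1 = mon d ^+ 2 * mon z.1.
  have [||a aE] := @monP F n (mon d ^+ 2 * mon z.1).
  - by rewrite monicMl ?mon_monic.
  - by rewrite size_monicM ?mon_neq0// szd size_mon /m; lia.
  by rewrite /phi/= aE /mon addrAC subrr add0r npolypK// size_npoly.
have phi2 z : (phi z).2 = mon d * z.2 :> {poly F}.
  by rewrite npolypK// (size_mul_hdim _ (mon_monic d) (size_mon d) le_in) size_npoly.
have phi_inj : injective phi.
  move=> z z' zz'; have := congr1 (fun z => mon z.1) zz'; rewrite !phi1.
  move=> /(mulfI (monic_neq0 dm2))/mon_inj.
  have := congr1 (fun z => val z.2) zz'; rewrite /= !phi2.
  by move=> /(mulfI (mon_neq0 d))/val_inj; case: z z' {zz'} => ? ? [? ?] /= -> ->.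
have phiS : [set z : {poly_n F} * {poly_(hdim n) F} | `[< squared_by z d >]] =
    [set phi z | z in [set z : {poly_m F} * {poly_(hdim m) F} | `[< square_reduced (mon z.1) z.2 >]]].
  apply/setP => z; rewrite inE; apply/asboolP/imsetP => [[g [k [fE hE red]]]|[z' + ->]].
    have gm : g \is monic by rewrite -(monicMl _ dm2) -fE mon_monic.
    have [|a aE] := @monP F m g gm.
      by have := size_mon z.1; rewrite fE size_monicM ?monic_neq0// szd /m; lia.
    have szk : (size k <= hdim m)%N.
      by rewrite -(size_mul_hdim _ (mon_monic d) (size_mon d) le_in) -hE size_npoly.
    exists (a, npolyp _ k); first by rewrite inE /= npolypK// -aE; apply/asboolP.
    case: z fE hE => f h /= fE hE.
    have -> : f = (phi (a, npolyp _ k)).1 by apply/mon_inj; rewrite phi1 /= -aE.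
    rewrite [LHS](_ : _ = ((phi (a, npolyp (hdim m) k)).1, (phi (a, npolyp (hdim m) k)).2)).
      by case: (phi _).
    by congr pair; apply/val_inj; rewrite [RHS]phi2/= npolypK.
  rewrite inE => /asboolP red; exists (mon z'.1), (z'.2 : {poly F}).
  by rewrite phi1 phi2.
transitivity (\sum_(z in [set z : {poly_n F} * {poly_(hdim n) F} | `[< squared_by z d >]])
    (K (mon z.1))%:R : R); last first.
  rewrite [LHS]big_mkcond; apply: eq_bigr => z _; rewrite inE.
  by case: asboolP => _; rewrite ?mulr1 ?mulr0.
rewrite phiS big_imset; last by move=> ? ? _ _; apply: phi_inj.
rewrite /red_count [RHS]big_mkcond; apply: eq_bigr => z _; rewrite inE phi1.
by case: asboolP; rewrite ?andbT ?andbF.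
Qed.

End ReducedCount.

(** * The two leading coefficients and the power sums of the roots *)

Section TopCoefficients.
Variable F : fieldType.
Implicit Types f g r : {poly F}.

(* The coefficients of x^(n-1) and x^(n-2), read as 0 when the exponent is negative. *)
Definition coef1 f : F := (f * 'X^2)`_(size f).
Definition coef2 f : F := (f * 'X^2)`_(size f).-1.

Lemma coef1E f n : size f = n.+1 -> (1 <= n)%N -> coef1 f = f`_(n - 1).
Proof. by move=> fn n1; rewrite /coef1 coefMXn fn; case: ltnP => [|_]; [lia|congr (f`_ _); lia]. Qed.

Lemma coef2E f n : size f = n.+1 -> (2 <= n)%N -> coef2 f = f`_(n - 2).
Proof. by move=> fn n1; rewrite /coef2 coefMXn fn; case: ltnP => [|_]; [lia|congr (f`_ _); lia]. Qed.

(** The factor ['X^2] makes this expansion uniform down to degree 0, and products can then be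
    computed modulo low-order terms. *)
Lemma top_coefs f n : f \is monic -> size f = n.+1 -> exists2 r : {poly F}, (size r <= n)%N &
  f * 'X^2 = ('X^2 + (coef1 f)%:P * 'X + (coef2 f)%:P) * 'X^n + r.
Proof.
move=> fm fn; exists (f * 'X^2 - ('X^2 + (coef1 f)%:P * 'X + (coef2 f)%:P) * 'X^n); last first.
  by rewrite addrC subrK.
apply/leq_sizeP => j nj; rewrite coefB [X in _ - X]coefMXn ltnNge nj/=.
rewrite !coefD coefXn coefMX coefC -(subnKC nj); move: (j - n)%N => i.
rewrite addKn; case: i => [|[|[|i]]]; rewrite ?addn0 ?addn1 ?coefC/=.
- by rewrite !add0r /coef2 fn subrr.
- by rewrite add0r addr0 /coef1 fn subrr.
- by rewrite coefMXn ltnNge addnC !addSn/= subSS subSS subn0 !addr0 -[n]/(n.+1.-1) -fn -lead_coefE (monicP fm) subrr.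
- by rewrite !addr0 subr0 coefMXn; case: ifP => // _; rewrite nth_default// fn; lia.
Qed.

Lemma coef12M f g : f \is monic -> g \is monic ->
  coef1 (f * g) = coef1 f + coef1 g /\
  coef2 (f * g) = coef2 f + coef2 g + coef1 f * coef1 g.
Proof.
move=> fm gm.
have [[n fn] [m gmn]] : (exists n, size f = n.+1) /\ exists m, size g = m.+1.
  by split; [exists (size f).-1|exists (size g).-1]; rewrite prednK// size_poly_gt0 monic_neq0.
have [r rn fE] := top_coefs fm fn; have [s sm gE] := top_coefs gm gmn.
have fgn : size (f * g)%R = (n + m).+1 by rewrite size_monicM ?monic_neq0// fn gmn addSn/= addnS.
have coefE i : (f * g * 'X^2)`_(n + m + i) =
  (('X^2 + (coef1 f)%:P * 'X + (coef2 f)%:P) * ('X^2 + (coef1 g)%:P * 'X + (coef2 g)%:P))`_(i + 2).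
  rewrite -[LHS](_ : (f * g * 'X^2 * 'X^2)`_(n + m + (i + 2)) = _); last first.
    by rewrite coefMXn addnA ltnNge leq_addl/= addnK.
  (* The remainder terms have size at most n + m + 2, so they do not reach the coefficient n + m +
     (i + 2). *)
  have -> : f * g * 'X^2 * 'X^2 = 
    (('X^2 + (coef1 f)%:P * 'X + (coef2 f)%:P) * ('X^2 + (coef1 g)%:P * 'X + (coef2 g)%:P)) * 'X^(n + m)
    + (r * (g * 'X^2) + ('X^2 + (coef1 f)%:P * 'X + (coef2 f)%:P) * 'X^n * s).
    have -> : f * g * 'X^2 * 'X^2 = (f * 'X^2) * (g * 'X^2) by ring.
    by rewrite fE mulrDl {1}gE exprD; ring.
  have sP (a b : F) : (size ('X^2 + a%:P * 'X + b%:P)%R <= 3)%N.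
    apply/leq_sizeP => -[|[|[|j]]]// _.
    by rewrite !coefD coefXn coefMX !coefC !addr0.
  rewrite coefD coefMXn ltnNge leq_addr/= addKn [X in _ + X]coefD.
  rewrite [X in _ + X](_ : _ = 0) ?addr0//.
  rewrite [X in X + _]nth_default ?add0r ?[LHS]nth_default//; last first.
    apply: leq_trans (size_polyMleq _ _) _.
    rewrite size_mulXn ?monic_neq0// gmn; move: (size r) rn => sr; lia.
  apply: leq_trans (size_polyMleq _ _) _.
  have := sP (coef1 f) (coef2 f).
  set P := (_ + _)%R; have := size_polyMleq P 'X^n; rewrite size_polyXn.
  move: (size (P * 'X^n)%R) (size P) (size s) sm => A1 A2 A3; lia.
have prodE : ('X^2 + (coef1 f)%:P * 'X + (coef2 f)%:P) * ('X^2 + (coef1 g)%:P * 'X + (coef2 g)%:P) =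
  'X^4 + (coef1 f + coef1 g)%:P * 'X^3 + (coef2 f + coef2 g + coef1 f * coef1 g)%:P * 'X^2
   + (coef1 f * coef2 g + coef2 f * coef1 g)%:P * 'X + (coef2 f * coef2 g)%:P.
  by rewrite !rmorphD/= !rmorphM/=; ring.
split.
  rewrite {1}/coef1 fgn -(addn1 (n + m)) coefE prodE !coefD !coefXn !coefMXn !coefMX !coefC/=.
  by rewrite !addr0 add0r.
have := coefE 0; rewrite addn0 [coef2 (f * g)]/coef2 fgn -pred_Sn => ->; rewrite prodE !coefD !coefXn !coefMXn !coefMX !coefC/=.
by rewrite !addr0 !add0r.
Qed.

(* The first two power sums of the roots: an additive pair of coordinates. *)
Definition psum1 f : F := - coef1 f.
Definition psum2 f : F := coef1 f ^+ 2 - 2 * coef2 f.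

Lemma psum1M f g : f \is monic -> g \is monic -> psum1 (f * g) = psum1 f + psum1 g.
Proof. by move=> fm gm; rewrite /psum1 (coef12M fm gm).1 opprD. Qed.

Lemma psum2M f g : f \is monic -> g \is monic -> psum2 (f * g) = psum2 f + psum2 g.
Proof.
by move=> fm gm; have [c1 c2] := coef12M fm gm; rewrite /psum2 c1 c2; ring.
Qed.

Lemma coef1_XsubC c : coef1 ('X - c%:P) = - c.
Proof. by rewrite (coef1E (size_XsubC c))// coefB coefX coefC add0r. Qed.

Lemma coef2_XsubC c : coef2 ('X - c%:P) = 0.
Proof. by rewrite /coef2 size_XsubC coefMXn. Qed.

Lemma coef1_1 : coef1 1 = 0. Proof. by rewrite /coef1 mul1r size_poly1 coefXn. Qed.
Lemma coef2_1 : coef2 1 = 0. Proof. by rewrite /coef2 mul1r size_poly1 coefXn. Qed.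

Lemma psum1_XsubC c : psum1 ('X - c%:P) = c.
Proof. by rewrite /psum1 coef1_XsubC opprK. Qed.

Lemma psum2_XsubC c : psum2 ('X - c%:P) = c ^+ 2.
Proof. by rewrite /psum2 coef1_XsubC coef2_XsubC sqrrN mulr0 subr0. Qed.

End TopCoefficients.

Section Distribution.
Variables (R : realFieldType) (F : finFieldType).
Local Notation q := (#|F|%:R : R).

Lemma card_npoly_top m n (c : {poly F}) : (m <= n)%N -> (size c <= n)%N ->
  #|[set a : {poly_n F} | [forall i : 'I_n, (m <= i)%N ==> (a`_i == c`_i)]]| = (#|F| ^ m)%N.
Proof.
move=> mn cn; pose phi (b : {poly_m F}) : {poly_n F} := npolyp n (c - take_poly m c + b).
have phiE b : phi b = c - take_poly m c + b :> {poly F}.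
  rewrite npolypK//; apply/leq_sizeP => j nj.
  rewrite coefD coefB coef_take_poly [in RHS](_ : 0 = 0 - 0 + 0); last by rewrite subr0 addr0.
  by congr (_ - _ + _); last (by rewrite nth_default// (leq_trans (size_npoly _))// (leq_trans mn));
    rewrite ?(nth_default _ (leq_trans cn nj))//; case: ifP.
rewrite -card_npoly -(card_imset predT (f := phi)); last first.
  move=> b b' /(congr1 val); rewrite /= !phiE => /addrI/val_inj//.
apply: eq_card => a; rewrite !inE; apply/forallP/imsetP => [ac|[b _ ->] i].
  exists (npolyp m a) => //; apply/val_inj; rewrite /= phiE; apply/polyP => j.
  rewrite coefD coefB coef_take_poly coef_npolyp.
  case: ltnP => jm; first by rewrite subrr add0r.
  rewrite subr0 addr0; have [jn|jn] := ltnP j n.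
    by have /implyP/(_ jm)/eqP := ac (Ordinal jn).
  by rewrite !nth_default// (leq_trans _ jn)// size_npoly.
apply/implyP => mi; rewrite phiE coefD coefB coef_take_poly ltnNge mi/= subr0.
by rewrite [b`_i]nth_default ?addr0// (leq_trans (size_npoly _)).
Qed.

Lemma coef1_mon n (a : {poly_n.+1 F}) : coef1 (mon a) = a`_n.
Proof. by rewrite (coef1E (size_mon a))// subn1 coefD coefXn ltn_eqF// add0r. Qed.

Lemma coef2_mon n (a : {poly_n.+2 F}) : coef2 (mon a) = a`_n.
Proof. by rewrite (coef2E (size_mon a))// subn2 coefD coefXn ltn_eqF// add0r. Qed.

Lemma sum_coef1 n (f : F -> R) :
  \sum_(d : {poly_n.+1 F}) f (coef1 (mon d)) = q ^+ n * \sum_u f u.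
Proof.
rewrite (partition_big (fun d : {poly_n.+1 F} => coef1 (mon d)) predT)//= mulr_sumr.
apply: eq_bigr => u _; rewrite (eq_bigr (fun=> f u)) => [|d /eqP->//].
rewrite sumr_const -natrX mulr_natl; congr (_ *+ _).
rewrite -(@card_npoly_top n n.+1 (u *: 'X^n) (leqnSn n)); last first.
  by rewrite (leq_trans (size_scale_leq _ _))// size_polyXn.
apply: eq_card => d; rewrite !inE unfold_in coef1_mon.
apply/eqP/forallP => [<- i|/(_ ord_max)/implyP/(_ (leqnn _))/eqP].
  apply/implyP => ni; have -> : i = n :> nat by have := ltn_ord i; lia.
  by rewrite coefZ coefXn eqxx mulr1.
by rewrite coefZ coefXn eqxx mulr1.
Qed.

Lemma sum_coef12 n (f : F -> F -> R) :
  \sum_(d : {poly_n.+2 F}) f (coef1 (mon d)) (coef2 (mon d)) =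
  q ^+ n * \sum_u \sum_v f u v.
Proof.
rewrite (partition_big (fun d : {poly_n.+2 F} => coef1 (mon d)) predT)//= mulr_sumr.
apply: eq_bigr => u _.
rewrite (partition_big (fun d : {poly_n.+2 F} => coef2 (mon d)) predT)//= mulr_sumr.
apply: eq_bigr => v _.
rewrite (eq_bigr (fun=> f u v)) => [|d /andP[/eqP-> /eqP->]//].
rewrite sumr_const -natrX mulr_natl; congr (_ *+ _).
pose c : {poly F} := u *: 'X^(n.+1) + v *: 'X^n.
have sz : (size c <= n.+2)%N.
  rewrite (leq_trans (size_polyD _ _))// geq_max !(leq_trans (size_scale_leq _ _))//.
    by rewrite size_polyXn.
  by rewrite size_polyXn.
have nn2 : (n <= n.+2)%N by lia.
rewrite -(card_npoly_top nn2 sz) {nn2}.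
apply: eq_card => d; rewrite !inE unfold_in coef1_mon coef2_mon {sz}/c.
apply/andP/forallP => [[/eqP<- /eqP<-] i|H].
  apply/implyP => ni; rewrite coefD !coefZ !coefXn.
  have : (i == n :> nat) || (i == n.+1 :> nat) by have := ltn_ord i; lia.
  by case/orP => /eqP->; rewrite eqxx ?(ltn_eqF (ltnSn n)) ?(gtn_eqF (ltnSn n))/= mulr1 mulr0 ?addr0 ?add0r.
split.
  have /implyP/(_ (leqnSn _))/eqP := H ord_max; rewrite /= => ->.
  by rewrite coefD !coefZ !coefXn eqxx gtn_eqF// mulr0 addr0 mulr1.
have nn2 : (n < n.+2)%N by lia.
have /implyP/(_ (leqnn _))/eqP := H (Ordinal nn2); rewrite /= => ->.
by rewrite coefD !coefZ !coefXn eqxx ltn_eqF// mulr0 add0r mulr1.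
Qed.

Lemma sum_mon1 (f : {poly F} -> R) :
  \sum_(d : {poly_1 F}) f (mon d) = \sum_c f ('X - c%:P).
Proof.
pose h (c : F) : {poly_1 F} := npolyp 1 (- c)%:P.
have hE c : h c = (- c)%:P :> {poly F} by rewrite npolypK// size_polyC_leq1.
rewrite (reindex h); last first.
  exists (fun d : {poly_1 F} => - d`_0) => [c _|d _]; first by rewrite hE coefC opprK.
  by apply/val_inj; rewrite /= hE opprK -size1_polyC// size_npoly.
by apply: eq_bigr => c _; rewrite /mon hE polyCN.
Qed.

Lemma mon0 (d : {poly_0 F}) : mon d = 1.
Proof.
have /eqP : size d = 0%N by apply/eqP; rewrite -leqn0 size_npoly.
by rewrite /mon expr0 size_poly_eq0 => /eqP->; rewrite addr0.
Qed.

Lemma sum_npoly0 (x : R) : \sum_(d : {poly_0 F}) x = x.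
Proof. by rewrite sumr_const card_npoly. Qed.

Lemma sum_npoly (n : nat) (x : R) : \sum_(d : {poly_n F}) x = q ^+ n * x.
Proof. by rewrite sumr_const card_npoly -natrX mulr_natl. Qed.

Lemma square_reduced_small (f h : {poly F}) : f != 0 -> (size f <= 2)%N -> square_reduced f h.
Proof.
move=> f0 f2 d /dvdpP[g fE] _; rewrite leqNgt; apply/negP => d1.
have d0 : d != 0 by rewrite -size_poly_gt0; lia.
have g0 : g != 0 by apply: contraNneq f0 => g0; rewrite fE g0 mul0r.
have := size_poly_gt0 g; rewrite g0.
move: f2; rewrite fE expr2 mulrA !size_mul ?mulf_neq0//.
by move: (size g) (size d) d1 => a b; lia.
Qed.

End Distribution.

Section ReducedTotals.
Variables (R : realFieldType) (F : finFieldType) (tau : bool).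
Local Notation q := (#|F|%:R : R).
Local Notation red_count := (@red_count R F tau).
Local Notation hdim := (hdim tau).

Lemma red_count0 K : red_count 0 K = (K 1)%:R.
Proof.
rewrite /red_count.
rewrite (eq_bigr (fun=> (K 1)%:R)) => [|z _]; last first.
  rewrite asboolT ?andbT ?mon0//.
  by apply: square_reduced_small; rewrite ?mon_neq0 ?mon0 ?oner_neq0 ?size_poly1.
by rewrite sumr_const card_prod !card_npoly /hdim /= muln0.
Qed.

Lemma red_count1 K : red_count 1 K = \sum_c (K ('X - c%:P))%:R.
Proof.
rewrite -(sum_mon1 (fun f => (K f)%:R)) /red_count.
rewrite -(pair_bigA _ (fun (a : {poly_1 F}) (b : {poly_(hdim 1) F}) => (K (mon a) && `[< square_reduced (mon a) b >])%:R))/=.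
apply: eq_bigr => a _; rewrite (eq_bigr (fun=> (K (mon a))%:R)) => [|h _]; last first.
  rewrite asboolT ?andbT//.
  by apply: square_reduced_small; rewrite ?mon_neq0 ?size_mon.
by rewrite sumr_const card_npoly /hdim /= muln0.
Qed.

(** The term d = 1 is isolated so that the identity can be solved for the count in degree n + 2. *)
Lemma red_count_recS n K :
  red_count n.+2 (fun g => K g) +
  \sum_(i < n./2.+1) \sum_(d : {poly_i.+1 F})
     red_count (n - i.*2) (fun g => K (mon d ^+ 2 * g)) =
  (\sum_(a : {poly_n.+2 F}) (K (mon a))%:R) * q ^+ hdim n.+2.
Proof.
rewrite -red_count_rec [RHS]big_ord_recl/=; congr (_ + _).
rewrite (eq_bigr (fun=> red_count n.+2 K)) => [|d _]; last first.
  by rewrite subn0; apply: eq_bigr => z _; rewrite mon0 expr1n mul1r.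
by rewrite sum_npoly0; apply: eq_bigr.
Qed.

(** Subtract q times the identity of degree n from that of degree n + 2: the factors d of degree i
    in the one match those of degree i + 1 in the other, and only d = 1 remains. *)
Lemma red_count_total n : red_count n.+2 xpredT =
  q ^+ (n.+2 + hdim n.+2) - q ^+ (n.+1 + hdim n).
Proof.
have tot m : \sum_(i < m./2.+1) \sum_(d : {poly_i F}) red_count (m - i.*2) xpredT =
    q ^+ (m + hdim m).
  by rewrite (red_count_rec R tau m xpredT) sum_npoly mulr1 exprD.
have := tot n.+2; rewrite big_ord_recl/= sum_npoly0 subn0 => <-.
rewrite addSn exprS -(tot n) mulr_sumr [X in _ - X](_ : _ = \sum_(i < n./2.+1) \sum_(d : {poly_(bump 0 i) F})
    red_count (n.+2 - (bump 0 i).*2) xpredT) ?addrK//.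
by apply: eq_bigr => i _; rewrite !sum_npoly /bump/= add1n exprS mulrA subSS subSS.
Qed.
End ReducedTotals.

(** * Counts in odd characteristic *)

Section Weights.
Variable F : fieldType.

(* d^2 (resp. d^2 (x - c)) has power sums the doubles of those of d (resp. plus
   those of x - c). *)
Definition weights n : seq F := nseq n./2 2 ++ nseq (odd n) 1.

Lemma weightsS2 n : weights n.+2 = 2 :: weights n.
Proof. by rewrite /weights/= negbK. Qed.

Lemma size_weights n : size (weights n) = uphalf n.
Proof. by rewrite size_cat !size_nseq uphalf_half addnC. Qed.

Lemma all_weights n : (2%:R : F) != 0 -> all (fun w => w != 0) (weights n).
Proof. by move=> F2; rewrite all_cat !all_nseq F2 oner_neq0 !orbT. Qed.

End Weights.

Lemma weight_weights (F : finFieldType) n : weight (weights F n) = n%:R.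
Proof.
rewrite /weight big_cat/= !big_nseq -[in RHS](odd_double_half n) addrC natrD.
rewrite -mul2n mulrnA !iter_addr !addr0; congr (_ + _).
Qed.

Section OddCharacteristic.
Variables (R : realFieldType) (F : finFieldType) (tau : bool).
Hypothesis F2 : (2%:R : F) != 0.
Local Notation q := (#|F|%:R : R).
Local Notation red_count := (@red_count R F tau).
Local Notation hdim := (hdim tau).
Local Notation weights := (@weights F).

Definition psum_count n (s t : F) : R :=
  red_count n (fun g => (psum1 g == s) && (psum2 g == t)).

(** As 2 is invertible, (c1, c2) -> (- c1, c1^2 - 2 c2) is a bijection of F^2. *)
Lemma sum_psum n (f : F -> F -> R) :
  \sum_(d : {poly_n.+2 F}) f (psum1 (mon d)) (psum2 (mon d)) =
  q ^+ n * \sum_u \sum_v f u v.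
Proof.
rewrite (sum_coef12 n (fun u v => f (- u) (u ^+ 2 - 2 * v))); congr (_ * _).
rewrite [RHS](reindex_inj oppr_inj); apply: eq_bigr => u _.
have hinj : injective (fun v => u ^+ 2 - 2 * v) by move=> v w /addrI/oppr_inj/(mulfI F2).
by rewrite [RHS](reindex_inj hinj).
Qed.

Lemma sum2_pred1 (s t : F) (f : F -> F -> R) :
  \sum_u \sum_v ((u == s) && (v == t))%:R * f u v = f s t.
Proof.
under eq_bigr do under eq_bigr do rewrite -mulnb natrM -mulrA.
under eq_bigr do rewrite -mulr_sumr (sum_pred1 (fun v => f _ v)).
by rewrite (sum_pred1 (fun u => f u t)).
Qed.

Lemma sum_psum_count n : \sum_u \sum_v psum_count n u v = red_count n xpredT.
Proof.
under eq_bigr do rewrite exchange_big/=.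
rewrite exchange_big/=; apply: eq_bigr => z _.
rewrite -[RHS](sum2_pred1 (psum1 (mon z.1)) (psum2 (mon z.1)) (fun _ _ => _)).
apply: eq_bigr => u _; apply: eq_bigr => v _.
by rewrite ![psum1 _ == _]eq_sym ![psum2 _ == _]eq_sym -natrM mulnb.
Qed.

(** The terms by degree of d: d = 1; d = x - c, which translates (s, t) by (2 c, 2 c^2); and degree
    i + 2, where equidistribution of the power sums of d leaves only a total count. *)
Lemma psum_count_rec n s t :
  psum_count n.+2 s t + \sum_c psum_count n (s - 2 * c) (t - 2 * c ^+ 2) +
  \sum_(i < n./2) q ^+ i * red_count (n - i.+1.*2) xpredT = q ^+ (n + hdim n.+2).
Proof.
rewrite exprD; have -> : q ^+ n = \sum_(a : {poly_n.+2 F})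
    ((psum1 (mon a) == s) && (psum2 (mon a) == t))%:R.
  rewrite (sum_psum n (fun u v => ((u == s) && (v == t))%:R)).
  rewrite -[LHS]mulr1; congr (_ * _).
  rewrite -[LHS](sum2_pred1 s t (fun _ _ => 1)).
  by apply: eq_bigr => u _; apply: eq_bigr => v _; rewrite mulr1.
rewrite -(red_count_recS _ _ _ (fun g => (psum1 g == s) && (psum2 g == t))) -addrA.
congr (_ + _).
have sqE m (f : {poly F}) : f \is monic ->
    red_count m (fun g => (psum1 (f ^+ 2 * g) == s) && (psum2 (f ^+ 2 * g) == t)) =
    psum_count m (s - 2 * psum1 f) (t - 2 * psum2 f).
  move=> fm; apply: eq_bigr => z _; congr (nat_of_bool (_ && _))%:R.
  have E (a b c : F) : (a + a + b == c) = (b == c - 2 * a).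
    by rewrite mulr_natl mulr2n eq_sym [RHS]eq_sym subr_eq addrC.
  by rewrite expr2 !psum1M ?psum2M ?monicMl ?mon_monic// !E.
rewrite big_ord_recl/=; congr (_ + _).
  rewrite subn0 (eq_bigr (fun d : {poly_1 F} => (fun f => psum_count n (s - 2 * psum1 f) (t - 2 * psum2 f)) (mon d))).
    rewrite (sum_mon1 (fun f => psum_count n (s - 2 * psum1 f) (t - 2 * psum2 f))).
    by apply: eq_bigr => c _; rewrite psum1_XsubC psum2_XsubC.
  by move=> d _; rewrite sqE// mon_monic.
apply: eq_bigr => i _; rewrite /bump/= add1n.
under [RHS]eq_bigr do rewrite sqE ?mon_monic//.
rewrite (sum_psum i (fun u v => psum_count (n - i.+1.*2) (s - 2 * u) (t - 2 * v))).
congr (_ * _); rewrite -sum_psum_count.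
have hinj (w : F) : injective (fun v => w - 2 * v) by move=> v v' /addrI/oppr_inj/(mulfI F2).
rewrite (reindex_inj (hinj s)); apply: eq_bigr => u _.
by rewrite (reindex_inj (hinj t)).
Qed.

(** Up to constants the recursion is that of [curve_count] for a new weight 2, with a change of
    sign; degrees 0 and 1 start it with the lists [[::]] and [[:: 1]]. *)
Lemma psum_count_curve n : exists k, forall s t,
  psum_count n s t = k + (-1) ^+ n./2 * curve_count R (weights n) s t.
Proof.
have [m] := ubnP n; elim: m n => // m IH [|[|n]] nm.
- exists 0 => s t; rewrite /psum_count red_count0 add0r mul1r /=.
  by rewrite /psum1 /psum2 coef1_1 coef2_1 mulr0 expr0n/= subr0 oppr0 ![0 == _]eq_sym.
- exists 0 => s t; rewrite /psum_count red_count1 add0r mul1r /=.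
  apply: eq_bigr => c _; rewrite psum1_XsubC psum2_XsubC !mul1r !subr_eq0.
  by rewrite ![c == _]eq_sym ![c ^+ 2 == _]eq_sym.
have [|k kE] := IH n; first by lia.
have nE s t := psum_count_rec n s t.
exists (q ^+ (n + hdim n.+2) - (\sum_(i < n./2) q ^+ i * red_count (n - i.+1.*2) xpredT) - q * k) => s t.
have sumE : \sum_c psum_count n (s - 2 * c) (t - 2 * c ^+ 2) =
    q * k + (-1) ^+ n./2 * curve_count R (weights n.+2) s t.
  by rewrite weightsS2; under eq_bigr do rewrite kE; rewrite big_split/= sum_const -mulr_sumr.
rewrite -(nE s t) sumE exprS; ring.
Qed.

(** The unknown constant is fixed by summing over all (s, t) and comparing with
    [red_count_total]. *)
Theorem psum_countE n s t : psum_count n.+2 s t =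
  (q ^+ (n.+2 + hdim n.+2) - q ^+ (n.+1 + hdim n)) / q ^+ 2 +
  (-1) ^+ n.+2./2 * (curve_count R (weights n.+2) s t - q ^+ uphalf n.+2 / q ^+ 2).
Proof.
have [k] := psum_count_curve n.+2.
move: (weights n.+2) (size_weights F n.+2) => ws szE kE; rewrite kE -red_count_total -sum_psum_count.
under eq_bigr do under eq_bigr do rewrite kE.
under eq_bigr do rewrite big_split/= sum_const -mulr_sumr.
rewrite big_split/= sum_const -mulr_sumr sum2_curve_count szE.
have q0 : q != 0 := card_neq0 R F.
by field.
Qed.
End OddCharacteristic.

(** * Counts in characteristic 2 *)

Section CharacteristicTwo.
Variables (R : realFieldType) (F : finFieldType) (tau : bool).
Hypothesis F2 : (2%:R : F) = 0.
Local Notation q := (#|F|%:R : R).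
Local Notation red_count := (@red_count R F tau).
Local Notation hdim := (hdim tau).

Lemma addrr_char2 (u : F) : u + u = 0.
Proof. by rewrite -mulr2n -mulr_natl F2 mul0r. Qed.

Lemma sqr_inj_char2 : injective (fun u : F => u ^+ 2).
Proof.
move=> u v uv; apply/eqP; rewrite -subr_eq0 -sqrf_eq0 sqrrB uv -mulr_natl F2 mul0r subr0.
by rewrite addrr_char2.
Qed.

Lemma coef1_square f g : f \is monic -> g \is monic ->
  coef1 (f ^+ 2 * g : {poly F}) = coef1 g.
Proof.
move=> fm gm; have [-> _] := coef12M (monic_exp 2 fm) gm.
by rewrite expr2 (coef12M fm fm).1 addrr_char2 add0r.
Qed.

Lemma coef2_square f g : f \is monic -> g \is monic ->
  coef2 (f ^+ 2 * g : {poly F}) = coef1 f ^+ 2 + coef2 g.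
Proof.
move=> fm gm; have [_ ->] := coef12M (monic_exp 2 fm) gm.
rewrite expr2 (coef12M fm fm).1 (coef12M fm fm).2.
by rewrite !addrr_char2 mul0r addr0 add0r.
Qed.

Lemma sum_coef2_count n b1 :
  \sum_v red_count n (fun g => (coef1 g == b1) && (coef2 g == v)) =
  red_count n (fun g => coef1 g == b1).
Proof.
rewrite exchange_big/=; apply: eq_bigr => z _.
rewrite -[RHS](sum_pred1 (fun=> _) (coef2 (mon z.1))); apply: eq_bigr => v _.
by rewrite -natrM mulnb [v == _]eq_sym andbA [(_ == v) && _]andbC.
Qed.

(** Multiplication by d^2 keeps [coef1] and adds the square of [coef1] of d to [coef2]. Squaring is
    a bijection of F, so for nonconstant d the condition on [coef2] averages out, and these terms
    add up to the full identity of degree n + 1 for [coef1] alone. *)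
Theorem red_count_char2 n b1 b2 :
  red_count n.+3 (fun g => (coef1 g == b1) && (coef2 g == b2)) =
  q ^+ (n.+1 + hdim n.+3) - q ^+ (n + hdim n.+1).
Proof.
have rec1 : \sum_(i < n.+1./2.+1) q ^+ i * red_count (n.+1 - i.*2) (fun g => coef1 g == b1) =
    q ^+ (n + hdim n.+1).
  rewrite exprD; have -> : q ^+ n = \sum_(a : {poly_n.+1 F}) (coef1 (mon a) == b1)%:R.
    rewrite (sum_coef1 n (fun u => (u == b1)%:R)) -[LHS]mulr1; congr (_ * _).
    by rewrite -[LHS](sum_pred1 (fun=> 1) b1); apply: eq_bigr => u _; rewrite mulr1.
  rewrite -(red_count_rec R tau n.+1 (fun g => coef1 g == b1)).
  apply: eq_bigr => i _; rewrite -sum_npoly; apply: eq_bigr => d _.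
  by apply: eq_bigr => z _; rewrite coef1_square ?mon_monic.
rewrite exprD; have -> : q ^+ n.+1 = \sum_(a : {poly_n.+3 F})
    ((coef1 (mon a) == b1) && (coef2 (mon a) == b2))%:R.
  rewrite (sum_coef12 n.+1 (fun u v => ((u == b1) && (v == b2))%:R)).
  rewrite -[LHS]mulr1; congr (_ * _).
  rewrite -[LHS](sum2_pred1 b1 b2 (fun _ _ => 1)).
  by apply: eq_bigr => u _; apply: eq_bigr => v _; rewrite mulr1.
rewrite -(red_count_recS R tau n.+1 (fun g => (coef1 g == b1) && (coef2 g == b2))).
rewrite -rec1 -[LHS]addr0 -addrA; congr (_ + _).
apply/eqP; rewrite eq_sym subr_eq0; apply/eqP; apply: eq_bigr => i _.
transitivity (\sum_(d : {poly_i.+1 F})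
    (fun u => red_count (n.+1 - i.*2) (fun g => (coef1 g == b1) && (coef2 g == b2 - u ^+ 2))) (coef1 (mon d))).
  apply: eq_bigr => d _; apply: eq_bigr => z _.
  rewrite coef1_square ?coef2_square ?mon_monic//.
  by rewrite [_ == b2 - _]eq_sym subr_eq [_ + coef2 _]addrC [b2 == _]eq_sym.
rewrite (sum_coef1 i (fun u => red_count (n.+1 - i.*2)
   (fun g => (coef1 g == b1) && (coef2 g == b2 - u ^+ 2)))).
rewrite -(sum_coef2_count _ b1); congr (_ * _).
have hinj : injective (fun u : F => b2 - u ^+ 2).
  by move=> u v /addrI/oppr_inj/sqr_inj_char2.
by rewrite [RHS](reindex_inj hinj).
Qed.
End CharacteristicTwo.

(** * Squarefree polynomials times a power of a linear factor *)

Section Squarefree.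
Variables (R : realFieldType) (F : finFieldType).
Implicit Types f g : {poly F}.

Local Notation squarefree f := (square_reduced f 0).

Lemma red_count_squarefree n (K : {poly F} -> bool) :
  red_count R false n K =
  \sum_(g : {poly_n F}) (K (mon g) && `[< squarefree (mon g) >])%:R.
Proof.
rewrite /red_count.
rewrite -(pair_bigA _ (fun (a : {poly_n F}) (b : {poly_(hdim false n) F}) => (K (mon a) && `[< square_reduced (mon a) b >])%:R))/=.
apply: eq_bigr => a _; rewrite -[RHS](@sum_npoly0 R F); apply: eq_bigr => h _.
suff -> : h = 0 :> {poly F} by [].
by apply/eqP; rewrite -size_poly_eq0 -leqn0 size_npoly.
Qed.

Lemma squarefree_mul_XsubC r g : squarefree (('X - r%:P) * g) <-> squarefree g /\ ~~ root g r.
Proof.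
split=> [red|[red gr] d dg _].
  split=> [d dg _|]; first by apply: red; rewrite ?dvdp0// dvdp_mull.
  apply/negP => /factor_theorem[g' gE]; have := red ('X - r%:P); rewrite dvdp0 size_XsubC.
  by rewrite gE expr2 dvdp_mul2l ?polyXsubC_eq0// dvdp_mulIr => /(_ isT isT).
apply: red; rewrite ?dvdp0//; have [rd|rd] := boolP (root d r).
  case/negP: gr; rewrite -dvdp_XsubCl; rewrite -dvdp_XsubCl in rd.
  have := dvdp_trans (dvdp_exp2r 2 rd) dg.
  by rewrite expr2 dvdp_mul2l ?polyXsubC_eq0.
by move: dg; rewrite Gauss_dvdpr// coprimep_expl// coprimep_XsubC.
Qed.

(* Counts the products (x - r)^j g, with g squarefree and g(r) <> 0, by their first
   two power sums. *)
Definition root_count k (j : F) s t : R :=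
  \sum_r \sum_(g : {poly_k F})
    [&& psum1 (mon g) + j * r == s, psum2 (mon g) + j * r ^+ 2 == t,
        ~~ root (mon g) r & `[< squarefree (mon g) >]]%:R.

Lemma root_count0 j s t : root_count 0 j s t = curve_count R [:: j] s t.
Proof.
rewrite /root_count/=; apply: eq_bigr => r _; rewrite -[RHS](@sum_npoly0 R F).
apply: eq_bigr => g _; rewrite mon0 root1 andTb asboolT ?andbT; last first.
  by apply: square_reduced_small; rewrite ?oner_neq0 ?size_poly1.
rewrite /psum1 /psum2 coef1_1 coef2_1 oppr0 expr0n mulr0 subr0 !add0r.
by rewrite !subr_eq0 eq_sym [t == _]eq_sym.
Qed.

(** A squarefree polynomial of degree k + 1 either does not vanish at r or is (x - r) g with g(r) <>
    0; the two cases together remove the condition at r. *)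
Lemma root_count_rec k (j : nat) s t :
  root_count k.+1 j%:R s t + root_count k j.+1%:R s t =
  \sum_r psum_count R false k.+1 (s - j%:R * r) (t - j%:R * r ^+ 2).
Proof.
have eq_sub (p u w : F) : (p == u - w) = (p + w == u) by rewrite eq_sym subr_eq eq_sym.
rewrite /root_count -big_split; apply: eq_bigr => r _ /=.
rewrite /psum_count red_count_squarefree.
rewrite [RHS](bigID (fun g : {poly_k.+1 F} => ~~ root (mon g) r))/=; congr (_ + _).
  rewrite [RHS]big_mkcond/=; apply: eq_bigr => g _.
  by rewrite !eq_sub; case: (root _ _); rewrite /= ?andbF ?andbA.
pose phi (g : {poly_k F}) : {poly_k.+1 F} := npolyp k.+1 (('X - r%:P) * mon g - 'X^(k.+1)).
have phiE (g : {poly_k F}) : mon (phi g) = ('X - r%:P) * mon g.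
  have [||a aE] := @monP F k.+1 (('X - r%:P) * mon g).
  - by rewrite monicMl ?mon_monic ?monicXsubC.
  - by rewrite size_monicM ?mon_neq0 ?monicXsubC// size_XsubC size_mon.
  by rewrite /phi aE /mon addrAC subrr add0r npolypK// size_npoly.
have phi_inj : injective phi.
  move=> g g' /(congr1 (@mon F k.+1)); rewrite !phiE.
  by move=> /(mulfI (monic_neq0 (monicXsubC r)))/mon_inj.
transitivity (\sum_(g in [set phi g | g : {poly_k F}])
    ((psum1 (mon g) == s - j%:R * r) && (psum2 (mon g) == t - j%:R * r ^+ 2) &&
      `[< squarefree (mon g) >])%:R : R); last first.
  apply: eq_bigl => g; rewrite negbK; apply/imsetP/idP => [[a _ ->]|].
    by rewrite phiE rootM root_XsubC eqxx.
  move=> /factor_theorem[g' gE]; have g'm : g' \is monic.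
    by rewrite -(monicMr _ (monicXsubC r)) -gE mon_monic.
  have [|a aE] := @monP F k g' g'm.
    have := size_mon g; rewrite gE mulrC size_monicM ?monicXsubC ?monic_neq0// size_XsubC.
    by rewrite add2n => -[].
  by exists a => //; apply: mon_inj; rewrite phiE gE aE mulrC.
rewrite big_imset/=; last by move=> ? ? _ _; apply: phi_inj.
apply: eq_bigr => g _; rewrite phiE psum1M ?psum2M ?monicXsubC ?mon_monic//.
have E (x y : F) : x + y + j%:R * x = y + j.+1%:R * x by rewrite -natr1; ring.
rewrite psum1_XsubC psum2_XsubC !eq_sub !E -!andbA.
rewrite (asbool_equiv_eq (squarefree_mul_XsubC r (mon g))) asbool_and asboolb.
by rewrite [X in [&& _, _ & X]]andbC.
Qed.
End Squarefree.

(** Four more indices raise the exponent e = floor((k + 1)/4) by 1. A new block of four adds at most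
    4 p^e, and the earlier ones at most 8 p^(e - 1) <= 4 p^e, whence the constant 8. *)
Lemma sum_expn_quarter p K : (2 <= p)%N ->
  (\sum_(k < K.+1) p ^ (uphalf k)./2 <= 8 * p ^ (uphalf K)./2)%N.
Proof.
move=> p2; have [m] := ubnP K; elim: m K => // m IH K Km.
have [K4|K4] := ltnP K 4.
  by move: K4; case: K Km => [|[|[|[|]]]]// _ _; rewrite !big_ord_recr big_ord0 /= ?expn0 ?expn1; lia.
have -> : K = (K - 4).+4 by lia.
have /IH : (K - 4 < m)%N by lia.
move: (K - 4)%N => k Sk; rewrite 4!big_ord_recr/=; move: Sk; set S := (\sum_(_ < _) _)%N => Sk.
have leP e : (e <= (uphalf k)./2.+1)%N -> (p ^ e <= p * p ^ (uphalf k)./2)%N.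
  by move=> ?; rewrite -expnS leq_pexp2l//; lia.
have [e1 e2 e3] : [/\ uphalf k./2 <= (uphalf k)./2.+1, uphalf (uphalf k) <= (uphalf k)./2.+1
  & k./2./2.+1 <= (uphalf k)./2.+1]%N by split; lia.
rewrite (expnS p (uphalf k)./2); move: (leP _ e1) (leP _ e2) (leP _ e3) Sk.
have : (2 * p ^ (uphalf k)./2 <= p * p ^ (uphalf k)./2)%N by rewrite leq_mul2r p2 orbT.
by move: (p * p ^ (uphalf k)./2)%N => Q; lia.
Qed.

(** For p <= 5 the extra factor is at most 5, whence 40 = 5 * 8. For larger p, [delta k] forces k +
    4 <= K, and an extra factor p amounts to shifting the index by 4. *)
Lemma sum_expn_quarter_defect p K (delta : nat -> bool) : (2 <= p)%N ->
  (forall k, (k <= K)%N -> delta k -> (k + p <= K + 2)%N) ->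
  (\sum_(k < K.+1) p ^ ((uphalf k)./2 + delta k) <= 40 * p ^ (uphalf K)./2)%N.
Proof.
move=> p2 dK; have S := sum_expn_quarter K p2.
have [p5|p6] := leqP p 5.
  apply: (@leq_trans (\sum_(k < K.+1) 5 * p ^ (uphalf k)./2)); last first.
    by rewrite -big_distrr/= -[40%N]/((5 * 8)%N) -mulnA leq_mul2l S orbT.
  apply: leq_sum => k _; rewrite expnD mulnC leq_mul2r; case: (delta k) => /=.
    by rewrite expn1 p5 orbT.
  by rewrite expn0 orbT.
apply: (@leq_trans (\sum_(k < K.+1) p ^ (uphalf k)./2 +
    \sum_(k < K.+1) (if (k + 4 <= K)%N then p * p ^ (uphalf k)./2 else 0))).
  rewrite -big_split/=; apply: leq_sum => k _; case E: (delta k); last by rewrite addn0 leq_addr.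
  have kK : (k <= K)%N by rewrite -ltnS.
  have -> : (k + 4 <= K)%N by have := dK k kK E; lia.
  by rewrite addn1 expnS leq_addl.
have [K4|K4] := ltnP K 4.
  rewrite [X in (_ + X)%N]big1 ?addn0 => [|k _]; last by rewrite ifF//; lia.
  by apply: leq_trans S _; rewrite leq_mul2r orbT.
suff : (\sum_(k < K.+1) (if (k + 4 <= K)%N then p * p ^ (uphalf k)./2 else 0) <=
  8 * p ^ (uphalf K)./2)%N by move=> S'; apply: leq_trans (leq_add S S') _; rewrite -mulnDl leq_mul2r orbT.
rewrite -(big_mkord xpredT (fun k => if (k + 4 <= K)%N then (p * p ^ (uphalf k)./2)%N else 0%N)).
rewrite (big_cat_nat (n := (K - 4).+1))//=; last by lia.
rewrite [X in (_ + X)%N]big_nat_cond [X in (_ + X)%N]big1 ?addn0; last first.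
  by move=> k /andP[/andP[k1 k2] _]; rewrite ifF//; lia.
rewrite big_nat_cond (eq_bigr (fun k => (p * p ^ (uphalf k)./2)%N)); last first.
  by move=> k /andP[/andP[k1 k2] _]; rewrite ifT//; lia.
rewrite -big_nat_cond big_mkord -big_distrr/=.
have -> : (8 * p ^ (uphalf K)./2 = p * (8 * p ^ (uphalf (K - 4))./2))%N.
  rewrite mulnCA -expnS; congr (_ * p ^ _)%N; rewrite !uphalf_half; lia.
by rewrite leq_mul2l sum_expn_quarter ?orbT.
Qed.

(** * Bounds for the counts *)

Section Bounds.
Variables (R : realFieldType) (F : finFieldType).
Hypothesis F2 : (2%:R : F) != 0.
Local Notation q := (#|F|%:R : R).
Local Notation weights := (@weights F).

Lemma curve_count_weights_bound k s t : (0 < k)%N ->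
  `|curve_count R (weights k) s t - q ^+ uphalf k / q ^+ 2| <=
    q ^+ ((uphalf k).-1./2 + (k%:R == 0 :> F)).
Proof.
move=> k0; rewrite -weight_weights -(size_weights F); apply: curve_count_bound => //.
  by rewrite -size_eq0 size_weights; lia.
exact: all_weights.
Qed.

(** If j vanishes in F, the first variable is free and the count gains a factor q: this is the
    middle summand of the exponent. *)
Lemma curve_count_cons_bound (j k : nat) s t :
  `|curve_count R (j%:R :: weights k) s t - q ^+ (uphalf k).+1 / q ^+ 2| <=
    q ^+ ((uphalf k)./2 + (j%:R == 0 :> F) + ((j + k)%:R == 0 :> F)).
Proof.
have q1 : 1 < q := card_gt1 R F.
have [j0|j0] := eqVneq (j%:R : F) 0; last first.
  have W : weight (j%:R :: weights k) = (j + k)%:R.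
    by rewrite /weight big_cons -/(weight _) weight_weights natrD.
  have szE : size (j%:R :: weights k) = (uphalf k).+1 by rewrite -(size_weights F).
  have := @curve_count_bound R F F2 (j%:R :: weights k) s t isT.
  by rewrite addn0 W szE; apply; rewrite [all _ _]/= j0 all_weights.
rewrite natrD j0 add0r curve_count_cons0 exprS -mulrA -mulrBr normrM ger0_norm; last lra.
rewrite addn1 addSn [leRHS]exprS ler_pM2l; last lra.
have [->|k0] := posnP k; last first.
  apply: le_trans (curve_count_weights_bound _ _ k0) _.
  rewrite ler_eXn2l//; have : ((uphalf k).-1./2 <= (uphalf k)./2)%N by rewrite half_leq ?leq_pred.
  lia.
rewrite /= eqxx add0n expr1 expr0.
have qi : 0 <= 1 / q ^+ 2 <= 1.
  by rewrite divr_ge0 ?exprn_ge0 ?ler_pdivrMr ?exprn_gt0 ?mul1r ?exprn_ege1//; lra.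
by case: (_ && _) => /=; rewrite ?mulr1n ?mulr0n ler_norml; lra.
Qed.

Lemma psum_count1 (s t : F) : psum_count R false 1 s t = curve_count R (weights 1) s t.
Proof.
rewrite /psum_count red_count1; apply: eq_bigr => c _; rewrite psum1_XsubC psum2_XsubC.
by rewrite !mul1r !subr_eq0 eq_sym [t == _]eq_sym.
Qed.

(** The alternating sum of [root_count_rec]. The main term solves a_(k+1) + a_k = q^k (q - 1)/q; the
    index i stands for the stage with a cofactor of degree i and the linear factor to the power j +
    k - i. The summands 1 and [(k != 0)] absorb what the main term misses in degrees 0 and 1. *)
Lemma root_count_bound k (j : nat) (s t : F) :
  `|root_count R k j%:R s t - q ^+ k * (q - 1) / (q * (q + 1))| <=
    1 + (k != 0)%:R + \sum_(i < k.+1) q ^+ ((uphalf i)./2 +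
       ((j + k - i)%:R == 0 :> F) + ((j + k)%:R == 0 :> F)).
Proof.
have q1 : 1 < q := card_gt1 R F; have q0 : q != 0 := card_neq0 R F.
have q10 : q + 1 != 0 by lra.
elim: k j => [|k IH] j.
  rewrite root_count0 big_ord_recl big_ord0 !addn0 subn0.
  have := curve_count_cons_bound j 0 s t; rewrite !addn0 => B0.
  have -> : curve_count R [:: j%:R] s t - q ^+ 0 * (q - 1) / (q * (q + 1)) =
     (curve_count R (j%:R :: weights 0) s t - q ^+ (uphalf 0).+1 / q ^+ 2) + 2 / (q * (q + 1)).
    by rewrite /= expr0 expr1; field; rewrite q0 q10.
  rewrite (le_trans (ler_normD _ _))// addrC lerD//; last by rewrite addr0.
  rewrite addr0 ger0_norm ?divr_ge0 ?mulr_ge0//; try lra.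
  by rewrite ler_pdivrMr ?mulr_gt0//; [nra|lra..].
have -> : root_count R k.+1 j%:R s t - q ^+ k.+1 * (q - 1) / (q * (q + 1)) =
   (root_count R k.+1 j%:R s t + root_count R k j.+1%:R s t - (q ^+ k * (q - 1) / q))
   - (root_count R k j.+1%:R s t - q ^+ k * (q - 1) / (q * (q + 1))).
  by rewrite exprS; field; rewrite q0 q10.
have := IH j.+1; rewrite !addSnnS.
rewrite [X in _ -> _ <= _ + X]big_ord_recr addnK [nat_of_ord ord_max]/=.
set S := \sum_(_ < _) _ => IHS; have cons_bound := curve_count_cons_bound j k.+1 s t.
suff : `|root_count R k.+1 j%:R s t + root_count R k j.+1%:R s t - q ^+ k * (q - 1) / q| <=
    (1 - (k != 0)%:R) + `|curve_count R (j%:R :: weights k.+1) s t -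
      q ^+ (uphalf k.+1).+1 / q ^+ 2|.
  move=> H; apply: le_trans (ler_normB _ _) _; rewrite [leRHS](_ : _ = 1 + 1 + (S +
      q ^+ ((uphalf k.+1)./2 + (j%:R == 0 :> F) + ((j + k.+1)%:R == 0 :> F))))//.
  by lra.
rewrite root_count_rec {S IHS cons_bound IH}; case: k => [|k].
  (* Degree 1 is not covered by [psum_countE]: the count is the curve count itself, and the main
     term is off by 1/q. *)
  rewrite (eq_bigr (fun r => curve_count R (weights 1) (s - j%:R * r) (t - j%:R * r ^+ 2))).
    have -> a : a - q ^+ 0 * (q - 1) / q = q^-1 + (a - q ^+ (uphalf 1).+1 / q ^+ 2).
      by rewrite /= expr0; field.
    apply: le_trans (ler_normD _ _) _; rewrite lerD2r subr0 ger0_norm ?invr_ge0; last lra.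
    by rewrite invf_le1; lra.
  by move=> r _; rewrite psum_count1.
rewrite subrr add0r.
set C := curve_count _ _ _ _.
have -> : \sum_r psum_count R false k.+2 (s - j%:R * r) (t - j%:R * r ^+ 2) =
    q * ((q ^+ k.+2 - q ^+ k.+1) / q ^+ 2) +
    (-1) ^+ k.+2./2 * (C - q * (q ^+ uphalf k.+2 / q ^+ 2)).
  under eq_bigr do rewrite psum_countE// /hdim !mul0n !addn0.
  rewrite big_split; apply: (congr2 +%R); first exact: sum_const.
  by rewrite -mulr_sumr; congr (_ * _); rewrite sumrB sum_const.
have -> : q * ((q ^+ k.+2 - q ^+ k.+1) / q ^+ 2) = q ^+ k.+1 * (q - 1) / q.
  by rewrite !exprS; field.
by rewrite addrAC subrr add0r normrMsign exprS mulrA.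
Qed.
End Bounds.

(** * Reduction modulo p *)

Section Reduction.
Variables (p : nat) (p_pr : prime p).
Local Notation Zp := (padic_int p_pr).
Implicit Types x y : Zp.

Lemma zp_resD x y k : (x + y) k = ((x k + y k) %% p ^ k)%N. Proof. by []. Qed.
Lemma zp_resM x y k : (x * y) k = ((x k * y k) %% p ^ k)%N. Proof. by []. Qed.
Lemma zp_res0 k : (0 : Zp) k = 0%N. Proof. by rewrite /= mod0n. Qed.

Lemma zp_res_nat n k : (n%:R : Zp) k = (n %% p ^ k)%N.
Proof.
elim: n => [|n IH]; first by rewrite zp_res0 mod0n.
by rewrite -natr1 zp_resD IH /= modnDm addn1.
Qed.

Lemma zp_natr_neq0 n : (0 < n)%N -> (n%:R : Zp) != 0.
Proof.
move=> n0; apply/eqP => /(congr1 (fun x : Zp => x n)); rewrite zp_res_nat zp_res0.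
rewrite modn_small; last by rewrite ltn_expl// prime_gt1.
by move=> nE; rewrite nE in n0.
Qed.

Local Notation pZ := (p%:R : Zp).

Lemma pZ_neq0 : pZ != 0. Proof. by rewrite zp_natr_neq0 ?prime_gt0. Qed.

Definition red x : 'F_p := (x 1%N)%:R.

Fact red_zmod_morphism : zmod_morphism red.
Proof.
have redD x y : red (x + y) = red x + red y.
  by rewrite /red zp_resD expn1 Fp_nat_mod// natrD.
by move=> x y; apply/eqP; rewrite eq_sym subr_eq -redD subrK.
Qed.

Fact red_monoid_morphism : monoid_morphism red.
Proof.
split=> [|x y]; first by rewrite /red /= expn1 Fp_nat_mod.
by rewrite /red zp_resM expn1 Fp_nat_mod// natrM.
Qed.

HB.instance Definition _ := GRing.isZmodMorphism.Build Zp 'F_p red red_zmod_morphism.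
HB.instance Definition _ := GRing.isMonoidMorphism.Build Zp 'F_p red red_monoid_morphism.

Lemma Fp_natr_eq0 n : ((n%:R : 'F_p) == 0) = (p %| n)%N.
Proof. by rewrite (dvdn_pcharf (pchar_Fp p_pr)). Qed.

Lemma red_eq0P x : reflect (exists y, x = pZ * y) (red x == 0).
Proof.
apply: (iffP eqP) => [x0|[y ->]]; last first.
  by rewrite rmorphM/= rmorph_nat pchar_Fp_0 ?mul0r.
have dvdx k : (p %| x k.+1)%N.
  rewrite -Fp_natr_eq0 -Fp_nat_mod// -[X in (_ %% X)%N]expn1 zp_coherent_leq//.
  exact/eqP.
(* Dividing by p costs one digit: the quotient modulo p^k is read off from x modulo p^(k+1). *)
have coh k : ((x k.+2 %/ p) %% p ^ k)%N = (x k.+1 %/ p)%N.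
  by rewrite modn_divl -expnSr zp_coherent.
exists (PadicInt p_pr coh); apply: zp_inj => -[|k].
  by rewrite zp_resM !expn0 !modn1; have := zp_lt x 0; rewrite expn0; case: (x 0).
rewrite zp_resM zp_res_nat modnMml /= mulnC divnK//; first by rewrite zp_coherent.
Qed.

(** A section of [red] as a map of sets only: identities between lifts hold modulo p, with a
    correction supplied by [redp_congr]. *)
Definition zlift (a : 'F_p) : Zp := (a : nat)%:R.

Lemma zliftK : cancel zlift red.
Proof. by move=> a; rewrite /zlift rmorph_nat natr_Zp. Qed.

(** Euler's theorem inverts each residue by the power totient(p^k) - 1, and these inverses are
    coherent by uniqueness. *)
Lemma red_unit x : red x != 0 -> x \is a GRing.unit.
Proof.
move=> x0; have cop k : coprime (x k) (p ^ k).
  case: k => [|k]; first by rewrite expn0 coprimen1.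
  rewrite coprimeXr// coprime_sym prime_coprime// -Fp_natr_eq0.
  by rewrite -Fp_nat_mod// -[X in (_ %% X)%N]expn1 zp_coherent_leq.
pose f k := (x k ^ (totient (p ^ k)).-1)%N.
have xf k : (x k * f k = 1 %[mod p ^ k])%N.
  by rewrite -expnS prednK ?totient_gt0 ?expn_gt0 ?prime_gt0// cyclic.Euler_exp_totient.
have coh k : (f k.+1 = f k %[mod p ^ k])%N.
  have xf1 : (x k * f k.+1 = 1 %[mod p ^ k])%N.
    rewrite -(zp_coherent x k) modnMml.
    by rewrite -(modn_dvdm (x k.+1 * _) (dvdn_exp2l p (leqnSn k))) xf modn_dvdm// dvdn_exp2l.
  rewrite -[in LHS](mul1n (f k.+1)) -modnMml -(xf k) modnMml mulnAC -modnMml xf1 modnMml.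
  by rewrite mul1n.
apply/unitrP; exists (mk_zp p_pr coh).
suff E : mk_zp p_pr coh * x = 1 by rewrite [x * _]mulrC E.
by apply: zp_inj => k; rewrite zp_resM /= modnMml mulnC xf.
Qed.

(** An index with nonzero residue bounds the number of divisions by p before a unit is reached.
    Denominators in Qp can therefore be taken to be powers of p. *)
Lemma zp_dvd_pexp x : x != 0 -> exists N y, y * x = pZ ^+ N.
Proof.
move=> x0; have [k xk] : exists k, x k != 0%N.
  apply: contrapT => h; case/eqP: x0; apply: zp_inj => k; rewrite zp_res0.
  by apply/eqP/negPn/negP => zk; apply: h; exists k.
elim: k x {x0} xk => [|k IH] x xk.
  by have := zp_lt x 0; rewrite expn0; case: (x 0) xk.
have [/eqP/red_eq0P[y xE]|/red_unit xu] := eqVneq (red x) 0; last first.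
  by exists 0%N, x^-1; rewrite mulVr.
have [|N [z zy]] := IH y; last first.
  by exists N.+1, z; rewrite xE mulrCA zy exprS.
apply: contraNneq xk => yk; rewrite xE zp_resM zp_res_nat modnMml.
have : (p ^ k %| y k.+1)%N by rewrite /dvdn zp_coherent yk.
by move=> /dvdnP[c ->]; rewrite mulnCA -expnS modnMl.
Qed.

Definition redp : {poly Zp} -> {poly 'F_p} := map_poly red.
Definition liftp : {poly 'F_p} -> {poly Zp} := map_poly zlift.

HB.instance Definition _ := GRing.RMorphism.copy redp (map_poly red).

Lemma liftpK : cancel liftp redp.
Proof. by move=> g; rewrite /redp /liftp -map_poly_comp_id0 ?rmorph0// map_poly_id// => a _; exact: zliftK. Qed.

Local Notation pP := (p%:R : {poly Zp}).

Lemma coef_pP (g : {poly Zp}) i : (pP * g)`_i = pZ * g`_i.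
Proof. by rewrite mulr_natl coefMn mulr_natl. Qed.

Lemma redp_eq0P (g : {poly Zp}) : reflect (exists h, g = pP * h) (redp g == 0).
Proof.
apply: (iffP eqP) => [g0|[h ->]]; last first.
  apply/polyP => i; rewrite coef_map coef_pP coef0 /=; apply/eqP/red_eq0P.
  by exists h`_i.
have dv i : exists y, g`_i = pZ * y.
  by apply/red_eq0P; rewrite -[red _](coef_map red) -/(redp g) g0 coef0.
pose h i := sval (cid (dv i)).
exists (\poly_(i < size g) h i); apply/polyP => i; rewrite coef_pP coef_poly.
case: ltnP => ig; first by rewrite /h; case: cid.
by rewrite mulr0 nth_default.
Qed.

Lemma redp_congr (g h : {poly Zp}) : redp g = redp h -> exists k, g = h + pP * k.
Proof.
move=> gh; have /redp_eq0P[k kE] : redp (g - h) == 0 by rewrite rmorphB/= gh subrr.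
by exists k; rewrite -kE addrC subrK.
Qed.

Lemma pP_inj : injective (fun g : {poly Zp} => pP * g).
Proof. by apply: mulfI; rewrite -polyC_natr polyC_eq0 pZ_neq0. Qed.

Lemma redp_pM (g : {poly Zp}) : redp (pP * g) = 0.
Proof. by apply/eqP/redp_eq0P; exists g. Qed.

End Reduction.

(** * Maximality of Zp[x]/(f) *)

Local Notation "x %:F" := (@FracField.tofrac _ x) : ring_scope.

Section Fractions.
Import generic_quotient.
Local Open Scope quotient_scope.

Lemma frac_numden (A : idomainType) (x : {fraction A}) :
  exists a b, b != 0 /\ x * b%:F = a%:F.
Proof.
elim/quotW: x => r; exists (fraction.frac r).1, (fraction.frac r).2; split; first exact: denom_ratioP.
unlock FracField.tofrac; rewrite -[LHS]FracField.pi_mul; apply/eqmodP => /=.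
rewrite FracField.equivfE /FracField.mulf /=.
by rewrite !numden_Ratio ?mulf_neq0 ?oner_neq0 ?denom_ratioP// !mulr1 mulrC.
Qed.
End Fractions.

Section QuotientMap.
Variables (p : nat) (p_pr : prime p).
Local Notation Zp := (padic_int p_pr).
Local Notation Qp := {fraction Zp}.
Variable f : {poly Zp}.
Hypotheses (fm : f \is monic) (f1 : (1 < size f)%N).
Local Notation L := {poly %/ to_Qp f}.
Local Notation pZ := (p%:R : Zp).
Local Notation pP := (p%:R : {poly Zp}).

Definition quot (G : {poly Zp}) : L := in_qpoly (to_Qp f) (to_Qp G).

Lemma quotD : {morph quot : G H / G + H}.
Proof. by move=> G H; rewrite /quot /to_Qp rmorphD/= in_qpolyD. Qed.

Lemma quotM : {morph quot : G H / G * H}.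
Proof. by move=> G H; rewrite /quot /to_Qp rmorphM/= in_qpolyM. Qed.

Fact quot_zmod_morphism : zmod_morphism quot.
Proof. by move=> G H; apply/eqP; rewrite eq_sym subr_eq -quotD subrK. Qed.

Fact quot_monoid_morphism : monoid_morphism quot.
Proof. by split; [rewrite /quot /to_Qp rmorph1 in_qpoly1|exact: quotM]. Qed.

HB.instance Definition _ := GRing.isZmodMorphism.Build {poly Zp} L quot quot_zmod_morphism.
HB.instance Definition _ := GRing.isMonoidMorphism.Build {poly Zp} L quot quot_monoid_morphism.

Lemma quotZ c G : quot (c *: G) = c%:F *: quot G.
Proof. by rewrite /quot /to_Qp map_polyZ in_qpolyZ. Qed.

Lemma quot_p G : quot (pP * G) = pZ%:F *: quot G.
Proof. by rewrite -quotZ mulr_natl scaler_nat. Qed.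

Lemma to_Qp_monic : to_Qp f \is monic.
Proof. by rewrite monic_map. Qed.

Lemma size_to_Qp (G : {poly Zp}) : size (to_Qp G) = size G.
Proof. by apply: size_map_inj_poly; [move=> x y /eqP; rewrite tofrac_eq => /eqP|exact: tofrac0]. Qed.

Lemma mk_monic_f : mk_monic (to_Qp f) = to_Qp f.
Proof. by rewrite /mk_monic size_to_Qp f1 to_Qp_monic. Qed.

Lemma poly_div (G : {poly Zp}) : exists q r, G = q * f + r /\ (size r < size f)%N.
Proof.
exists (Pdiv.CommonRing.rdivp G f), (Pdiv.CommonRing.rmodp G f).
by rewrite -Pdiv.RingMonic.rdivp_eq// Pdiv.CommonRing.ltn_rmodpN0// monic_neq0.
Qed.

Lemma quot_f : quot f = 0.
Proof. by apply/val_inj; rewrite /= mk_monic_f Pdiv.RingMonic.rmodpp ?to_Qp_monic. Qed.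

Lemma quot_small (G : {poly Zp}) : (size G < size f)%N -> quot G = to_Qp G :> {poly Qp}.
Proof. by move=> Gf; apply: in_qpoly_small; rewrite mk_monic_f !size_to_Qp. Qed.

Lemma quot_eq0 G : quot G = 0 -> exists q, G = q * f.
Proof.
have [q [r [-> rf]]] := poly_div G.
rewrite rmorphD rmorphM/= quot_f mulr0 add0r => qr0.
have r0 : to_Qp r = 0 by rewrite -(quot_small rf) qr0.
by exists q; rewrite (_ : r = 0) ?addr0//; apply/eqP; rewrite -size_poly_eq0 -size_to_Qp r0 size_poly0.
Qed.

Lemma frac_pexp (x : Qp) : exists N y, (pZ ^+ N)%:F * x = y%:F.
Proof.
have [a [b [b0 xb]]] := frac_numden x; have [N [y yb]] := zp_dvd_pexp b0.
by exists N, (y * a); rewrite -yb !rmorphM/= -xb; ring.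
Qed.

Lemma poly_pexp (P : {poly Qp}) : exists N G, (pZ ^+ N)%:F *: P = to_Qp G.
Proof.
elim/poly_ind: P => [|P c [N [G PG]]].
  by exists 0%N, 0; rewrite scaler0 /to_Qp rmorph0.
have [M [y cy]] := frac_pexp c.
exists (N + M)%N, ((pZ ^+ M) *: (G * 'X) + (pZ ^+ N * y)%:P).
rewrite /to_Qp rmorphD/= map_polyZ rmorphM/= map_polyX map_polyC/= -/(to_Qp G) -PG.
rewrite scalerDr exprD !rmorphM/= -cy -scalerAl !scalerA [_%:F * (pZ ^+ N)%:F]mulrC; congr (_ + _).
by rewrite -mul_polyC -!polyCM mulrA.
Qed.

Lemma quot_pexp (x : L) : exists N G, (pZ ^+ N)%:F *: x = quot G.
Proof.
have [N [G xG]] := poly_pexp x; exists N, G; apply/val_inj.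
rewrite /quot -xG in_qpolyZ; congr val; congr (_ *: _); apply/val_inj.
by rewrite [RHS]in_qpoly_small// size_mk_monic.
Qed.

Lemma pZF_neq0 N : (pZ ^+ N)%:F != 0 :> Qp.
Proof. by rewrite tofrac_eq0 expf_neq0 ?pZ_neq0. Qed.

Lemma scale_pexp_inj N : injective (fun x : L => (pZ ^+ N)%:F *: x).
Proof.
move=> x y /eqP; rewrite -subr_eq0 -scalerBr scaler_eq0 (negPf (pZF_neq0 N))/=.
by rewrite subr_eq0 => /eqP.
Qed.

Lemma monogenic_orderP (x : L) : monogenic_order x <-> exists G, x = quot G.
Proof. by split=> [[G _ <-]|[G ->]]; exists G. Qed.

Lemma quot_coefs (G : {poly Zp}) : exists c : 'I_(size f).-1 -> Zp,
  quot G = \sum_i (c i)%:F *: quot 'X^i.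
Proof.
have [q [r [-> rf]]] := poly_div G; exists (fun i => r`_i).
rewrite rmorphD rmorphM/= quot_f mulr0 add0r.
rewrite [in LHS](_ : r = \sum_(i < (size f).-1) r`_i *: 'X^i).
  by rewrite rmorph_sum/=; apply: eq_bigr => i _; rewrite quotZ.
rewrite -(poly_def _ (fun i => r`_i)); apply/polyP => i; rewrite coef_poly.
by case: ltnP => // fi; rewrite nth_default// (leq_trans _ fi)// -ltnS prednK// ltnW.
Qed.

Lemma quot_span (x : L) : exists c : 'I_(size f).-1 -> Qp, x = \sum_i c i *: quot 'X^i.
Proof.
have [N [G xG]] := quot_pexp x; have [c cE] := quot_coefs G.
exists (fun i => (pZ ^+ N)%:F^-1 * (c i)%:F).
apply: (@scale_pexp_inj N); rewrite /= xG cE scaler_sumr; apply: eq_bigr => i _.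
by rewrite scalerA mulrA divff ?mul1r// pZF_neq0.
Qed.

Lemma sum_quot (c : 'I_(size f).-1 -> Zp) :
  \sum_i (c i)%:F *: quot 'X^i = quot (\sum_i c i *: 'X^i).
Proof. by rewrite rmorph_sum/=; apply: eq_bigr => i _; rewrite quotZ. Qed.

Lemma monogenic_is_order : is_order (@monogenic_order p p_pr f).
Proof.
split.
- by apply/monogenic_orderP; exists 1; rewrite rmorph1.
- move=> x y /monogenic_orderP[G ->] /monogenic_orderP[H ->].
  by apply/monogenic_orderP; exists (G - H); rewrite rmorphB.
- move=> x y /monogenic_orderP[G ->] /monogenic_orderP[H ->].
  by apply/monogenic_orderP; exists (G * H); rewrite rmorphM.
exists (size f).-1, (fun i => quot 'X^i); split; last exact: quot_span.
move=> x; split=> [/monogenic_orderP[G ->]|[c ->]]; first exact: quot_coefs.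
by apply/monogenic_orderP; rewrite sum_quot; eexists.
Qed.

(* With u = phi a + p b and f = phi u + p^2 c, the element u / p is a root of
   X^2 - b X + a c, hence integral over Zp[x]/(f). *)
Lemma nonmaximal_of_factor (phi a b c : {poly Zp}) :
  f = phi * (phi * a + pP * b) + pP ^+ 2 * c ->
  (1 < size (redp phi))%N -> ~ maximal_poly f.
Proof.
move=> fE phi1; set u := phi * a + pP * b in fE.
have pF0 : pZ%:F != 0 :> Qp by rewrite tofrac_eq0 pZ_neq0.
have [beta pbeta] : exists beta : L, pZ%:F *: beta = quot u.
  by exists (pZ%:F^-1 *: quot u); rewrite scalerA divff// scale1r.
have beta2 : beta * beta = quot (- (a * c)) + quot b * beta.
  have phiu : quot (phi * u) = - quot (pP ^+ 2 * c).
    by apply/eqP; rewrite -addr_eq0 -rmorphD/= -fE quot_f.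
  apply: (@scale_pexp_inj 2) => /=.
  have -> : (pZ ^+ 2)%:F *: (beta * beta) = quot u * quot u.
    by rewrite rmorphXn/= expr2 -scalerA scalerAl scalerAr pbeta.
  have -> : (pZ ^+ 2)%:F *: (quot (- (a * c)) + quot b * beta) =
      quot (- (a * (pP ^+ 2 * c))) + quot (pP * b * u).
    rewrite scalerDr rmorphXn/= [X in _ + X](_ : _ = quot (pP * b) * (pZ%:F *: beta)).
      rewrite pbeta -rmorphM; congr (_ + _); rewrite expr2 -scalerA -!quot_p; congr quot; ring.
    by rewrite quot_p -scalerAl -scalerAr scalerA -expr2.
  rewrite -rmorphM -rmorphD/= [u * u](_ : _ = a * (phi * u) + pP * b * u); last by rewrite {1}/u; ring.
  by rewrite !rmorphD/= [quot (a * (phi * u))]rmorphM/= phiu rmorphN !rmorphM/= mulrN.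
(* The ring obtained by adjoining beta; by its quadratic equation it is spanned by the x^i and the
   x^i beta. *)
pose O' := [set x : L | exists G H, x = quot G + quot H * beta]%classic.
have O'order : is_order O'.
  split.
  - by exists 1, 0; rewrite rmorph1 rmorph0 mul0r addr0.
  - move=> x y [G [H ->]] [G' [H' ->]]; exists (G - G'), (H - H').
    by rewrite !rmorphB/=; ring.
  - move=> x y [G [H ->]] [G' [H' ->]].
    exists (G * G' - H * H' * (a * c)), (G * H' + H * G' + H * H' * b).
    have -> : (quot G + quot H * beta) * (quot G' + quot H' * beta) =
      quot G * quot G' + (quot G * quot H' + quot H * quot G') * beta +
       quot H * quot H' * (beta * beta) by ring.
    rewrite beta2 !(rmorphB, rmorphD, rmorphN, rmorphM)/=; ring.
  pose m := (size f).-1.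
  pose join T (d1 d2 : 'I_m -> T) (i : 'I_(m + m)) :=
    match fintype.split i with inl j => d1 j | inr j => d2 j end.
  pose e1 (i : 'I_m) : L := quot 'X^i; pose e2 (i : 'I_m) : L := quot 'X^i * beta.
  exists (m + m)%N, (join L e1 e2).
  have joinE (d1 d2 : 'I_m -> Qp) :
    \sum_i join Qp d1 d2 i *: join L e1 e2 i =
    \sum_i d1 i *: quot 'X^i + (\sum_i d2 i *: quot 'X^i) * beta.
    rewrite big_split_ord/=; congr (_ + _).
      by apply: eq_bigr => i _; rewrite /join (unsplitK (inl _ i)).
    by rewrite mulr_suml; apply: eq_bigr => i _; rewrite /join (unsplitK (inr _ i)) -scalerAl.
  split=> [x|x].
    split=> [[G [H ->]]|[d ->]].
      have [cG ->] := quot_coefs G; have [cH ->] := quot_coefs H.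
      exists (join Zp cG cH); rewrite -joinE; apply: eq_bigr => i _; congr (_ *: _).
      by rewrite /join; case: (fintype.split i).
    exists (\sum_i d (lshift m i) *: 'X^i), (\sum_i d (rshift m i) *: 'X^i).
    rewrite -!sum_quot -joinE; apply: eq_bigr => i _; congr (_ *: _).
    by rewrite /join -[in LHS](splitK i); case: (fintype.split i).
  have [d dE] := quot_span x; exists (join Qp d (fun=> 0)).
  rewrite (joinE d (fun=> 0)) -dE [X in X * beta]big1 ?mul0r ?addr0// => i _.
  by rewrite scale0r.
move=> [_ /(_ O' O'order) E].
have {}E : O' = @monogenic_order p p_pr f.
  by apply: E => x [G _ <-]; exists G, 0; rewrite rmorph0 mul0r addr0.
have : O' beta by exists 0, 1; rewrite rmorph0 rmorph1 mul1r add0r.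
rewrite E => /monogenic_orderP[G betaG].
(* If beta were in Zp[x]/(f), then f would divide u modulo p; since f = phi u modulo p, phi would be
   constant. *)
have : quot (u - pP * G) = 0 by rewrite rmorphB/= quot_p -betaG pbeta subrr.
move=> /quot_eq0[q qE].
have f0 : redp f != 0.
  by rewrite monic_neq0// /redp monic_map.
have rf : redp f = redp phi * redp u.
  by rewrite fE rmorphD rmorphM/= expr2 -mulrA redp_pM addr0.
have := congr1 (@redp p p_pr) qE; rewrite rmorphB/= redp_pM subr0 rmorphM/=.
rewrite rf mulrCA mulrA => /(congr1 (fun g => g - redp u)).
rewrite subrr -{2}[redp u]mul1r -mulrBl => /esym/eqP; rewrite mulf_eq0 => /orP[|/eqP u0]; last first.
  by rewrite rf u0 mulr0 eqxx in f0.
rewrite subr_eq0 => /eqP phiq.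
have : redp phi %| 1 by rewrite -phiq dvdp_mulr.
by rewrite dvdp1 => /eqP phi1'; rewrite phi1' in phi1.
Qed.
End QuotientMap.

(** Multiplication by x acts on the spanning family through a matrix M over A. The determinant of x
    - M kills every generator, hence kills 1, so it is 0; it is the value at x of the characteristic
    polynomial. *)
Lemma order_integral (A : idomainType) (K : comAlgType {fraction A}) (O : set K) (x : K) :
  is_order O -> O x ->
  exists2 chi : {poly A}, chi \is monic & \sum_(i < size chi) (chi`_i)%:F *: x ^+ i = 0.
Proof.
move=> [one_in _ mul_in [m [e [eO _]]]] Ox.
have Oe i : O (e i).
  apply/eO; exists (fun j => (j == i)%:R).
  rewrite (bigD1 i)//= eqxx rmorph1 scale1r big1 ?addr0// => j /negPf ->.
  by rewrite rmorph0 scale0r.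
have /choice[c cE] : forall i, exists c : 'I_m -> A, x * e i = \sum_j (c j)%:F *: e j.
  by move=> i; apply/eO; apply: mul_in.
pose M : 'M[A]_m := \matrix_(i, j) c i j.
pose phi : {rmorphism A -> K} := in_alg K \o @FracField.tofrac A.
have phiE a : phi a = a%:F *: 1 by [].
pose N : 'M[K]_m := x%:M - map_mx phi M.
have Ne : N *m \col_i e i = 0.
  apply/colP => i; rewrite mulmxBl mul_scalar_mx !mxE cE.
  apply/eqP; rewrite subr_eq0; apply/eqP/eq_bigr => j _; rewrite !mxE phiE -scalerAl mul1r//.
have detN : \det N = 0.
  have De i : \det N * e i = 0.
    have : \adj N *m N *m \col_i e i = 0 by rewrite -mulmxA Ne mulmx0.
    by rewrite mul_adj_mx mul_scalar_mx => /colP/(_ i); rewrite !mxE.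
  have [d dE] := (eO 1).1 one_in; rewrite -[LHS]mulr1 dE mulr_sumr big1// => i _.
  by rewrite -scalerAr De scaler0.
exists (char_poly M); first exact: char_poly_monic.
rewrite -[RHS]detN.
have -> : N = map_mx (horner_eval x) (char_poly_mx (map_mx phi M)).
  apply/matrixP => i j; rewrite !mxE /horner_eval hornerD hornerN hornerC.
  by rewrite hornerMn hornerX.
rewrite det_map_mx -/(char_poly _) -map_char_poly.
rewrite [RHS](_ : _ = (map_poly phi (char_poly M)).[x])//.
rewrite (@horner_coef_wide _ (size (char_poly M))) ?size_poly//.
by apply: eq_bigr => i _; rewrite coef_map -[X in _ *: X]mul1r scalerAl.
Qed.

Lemma coprimep_dvd_exp (F : fieldType) (a b : {poly F}) r :
  coprimep a b -> a %| b ^+ r -> size a = 1%N.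
Proof.
move=> /(coprimep_expr r); rewrite /coprimep => /eqP ab /dvdp_gcd_idl/eqp_size <-.
exact: ab.
Qed.

(** * Dedekind's criterion *)

Section Dedekind.
Variables (p : nat) (p_pr : prime p).
Local Notation Zp := (padic_int p_pr).
Local Notation pZ := (p%:R : Zp).
Local Notation pP := (p%:R : {poly Zp}).
Local Notation redp := (@redp p p_pr).
Local Notation liftp := (@liftp p p_pr).

Lemma redp_dvd (P G : {poly Zp}) : redp P %| redp G -> exists a b, G = P * a + pP * b.
Proof.
move=> /dvdpP[q qE]; have [|b ->] := @redp_congr p p_pr G (P * liftp q); last by exists (liftp q), b.
by rewrite rmorphM/= liftpK qE mulrC.
Qed.

(* s^2 g, d phi and p h' lie in the ideal (P^2, p P, p^2). *)
Lemma redp_dvd_ideal (P s g h d phi h' : {poly Zp}) :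
  s ^+ 2 * g + pP * h = d * phi + pP * h' -> redp P != 0 ->
  redp P %| redp s -> redp P %| redp d -> redp P %| redp phi -> redp P %| redp h' ->
  redp P %| redp h.
Proof.
move=> E P0 /redp_dvd[s1 [s2 sE]] /redp_dvd[d1 [d2 dE]] /redp_dvd[f1 [f2 fE]] /redp_dvd[h1 [h2 hE]].
pose X := d1 * f1 - s1 ^+ 2 * g.
pose Y := d1 * f2 + d2 * f1 - 2 * s1 * s2 * g + h1.
pose Z := d2 * f2 - s2 ^+ 2 * g + h2.
have phE : pP * h = P ^+ 2 * X + pP * (P * Y + pP * Z).
  have -> : pP * h = d * phi + pP * h' - s ^+ 2 * g by rewrite -E; ring.
  by rewrite sE dE fE hE /X /Y /Z; ring.
have /redp_eq0P[X' XE] : redp X == 0.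
  have := congr1 redp phE; rewrite redp_pM rmorphD/= redp_pM addr0 rmorphM/= rmorphXn/=.
  by move=> /esym/eqP; rewrite mulf_eq0 expf_eq0 (negPf P0).
have -> : h = P * (P * X' + Y) + pP * Z.
  by apply: (@pP_inj p p_pr); rewrite /= phE XE; ring.
by rewrite rmorphD/= redp_pM addr0 rmorphM/= dvdp_mulIl.
Qed.

Variable f : {poly Zp}.
Hypotheses (fm : f \is monic) (f1 : (1 < size f)%N).
Local Notation L := {poly %/ to_Qp f}.
Local Notation quot := (@quot p p_pr f).
Local Notation Of := (@monogenic_order p p_pr f).

Lemma order_scale_p (O : set L) N x : is_order O -> (Of `<=` O)%classic ->
  O x -> O ((pZ ^+ N)%:F *: x).
Proof.
move=> [_ _ mul_in _] sO Ox; have -> : (pZ ^+ N)%:F *: x = quot (pZ ^+ N)%:P * x.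
  by rewrite -[(_ ^+ N)%:P]mulr1 mul_polyC quotZ rmorph1 -scalerAl mul1r.
by apply: mul_in => //; apply: sO; exists (pZ ^+ N)%:P.
Qed.

(** Multiply x by p up to the last stage outside Zp[x]/(f). *)
Lemma order_minimal_denominator (O : set L) x : is_order O -> (Of `<=` O)%classic ->
  O x -> ~ Of x ->
  exists y G, [/\ O y, ~ Of y & pZ%:F *: y = quot G].
Proof.
move=> Oo sO Ox nx; have [N [G xG]] := quot_pexp x.
elim: N G xG => [|N IH] G xG.
  by case: nx; apply/monogenic_orderP; exists G; rewrite -xG expr0 rmorph1 scale1r.
have [/monogenic_orderP[G' /IH//]|nNx] := pselect (Of ((pZ ^+ N)%:F *: x)).
exists ((pZ ^+ N)%:F *: x), G; split=> //; first exact: order_scale_p.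
by rewrite scalerA -rmorphM/= -exprS.
Qed.

(** A larger order contains beta with p beta = d, where d lifts a proper divisor of f modulo p. Then
    f = d phi + p h' and beta phi = - h', and integrality of beta makes d, phi and h' share a
    nonconstant factor pi modulo p. Now pi^2 divides f, so pi divides s because g is squarefree, and
    [redp_dvd_ideal] gives pi | h. *)
Lemma maximal_of_coprime (s g h : {poly Zp}) :
  f = s ^+ 2 * g + pP * h -> square_reduced (redp g) 0 ->
  coprimep (redp s) (redp h) -> maximal_poly f.
Proof.
move=> fE red cop; split; first exact: monogenic_is_order.
move=> O Oo sO; apply/seteqP; split=> // x Ox; apply: contrapT => nx.
have [y [G [Oy ny yG]]] := order_minimal_denominator Oo sO Ox nx.
have f0 : redp f != 0 by rewrite monic_neq0// /redp monic_map.
have [[u v] /= uv] := Bezoutp (redp G) (redp f).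
set dbar := u * _ + _ in uv.
have [dG df] : dbar %| redp G /\ dbar %| redp f.
  by rewrite !(eqp_dvdl _ uv) dvdp_gcdl dvdp_gcdr.
pose d := liftp dbar; have /dvdpP[phibar phiE] := df.
pose phi := liftp phibar.
have phi0 : phibar != 0 by apply: contraNneq f0 => phi0; rewrite phiE phi0 mul0r.
have phi1 : size phibar != 1%N.
  apply/eqP => phi1; apply: ny; have fG : redp f %| redp G.
    rewrite phiE (size1_polyC (eq_leq phi1)) mul_polyC dvdpZl//.
    by apply: contraNneq phi0 => c0; rewrite (size1_polyC (eq_leq phi1)) c0.
  have [a [b GE]] := redp_dvd fG.
  apply/monogenic_orderP; exists b; apply: (@scale_pexp_inj p p_pr f 1); rewrite /= expr1 yG GE.
  by rewrite rmorphD rmorphM/= quot_f// mul0r add0r quot_p.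
have [|k dE] := @redp_congr p p_pr d (liftp u * G + liftp v * f).
  by rewrite rmorphD !rmorphM/= !liftpK.
pose beta : L := quot (liftp u) * y + quot k.
have Obeta : O beta.
  have [_ sub_in mul_in _] := Oo; have Oq H : O (quot H) by apply: sO; exists H.
  rewrite /beta -[quot k]opprK -rmorphN/=; apply: sub_in => //; exact: mul_in.
have pbeta : pZ%:F *: beta = quot d.
  rewrite scalerDr scalerAr yG -quot_p dE !rmorphD/= !rmorphM/= quot_f// mulr0 addr0.
  by rewrite -rmorphM.
clearbody beta.
have [|h' fE'] := @redp_congr p p_pr f (d * phi).
  by rewrite rmorphM/= !liftpK mulrC.
have betaphi : beta * quot phi = - quot h'.
  apply: (@scale_pexp_inj p p_pr f 1); rewrite /= expr1 scalerAl pbeta -rmorphM/=.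
  have -> : d * phi = f - pP * h' by rewrite {1}fE' addrK.
  by rewrite rmorphB/= quot_f// sub0r quot_p scalerN.
have [chi chim chi0] := order_integral Oo Obeta.
have chis : size chi = (size chi).-1.+1 by rewrite prednK// size_poly_gt0 monic_neq0.
set r := (size chi).-1 in chis.
have chir : chi`_r = 1 by rewrite -(monicP chim).
rewrite chis big_ord_recr/= chir rmorph1 scale1r in chi0.
(* The equation chi(beta) = 0 multiplied by a^r, with beta a = b, becomes a relation between
   polynomials modulo f. It is used for the pairs (p, d) and (phi, - h'). *)
have hom a b : beta * quot a = quot b -> exists q,
    b ^+ r + a * (\sum_(i < r) chi`_i *: (a ^+ (r - i.+1) * b ^+ i)) = q * f.
  move=> ab; apply: (quot_eq0 fm f1).
  rewrite rmorphD rmorphM rmorphXn rmorph_sum/= -ab exprMn mulr_sumr.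
  rewrite -[RHS](mul0r (quot a ^+ r)) -[X in _ = X * _]chi0 mulrDl addrC; congr (_ + _).
  rewrite mulr_suml; apply: eq_bigr => i _.
  rewrite quotZ rmorphM !rmorphXn/= -ab exprMn -scalerAr -scalerAl; congr (_ *: _).
  rewrite [X in _ = _ * _ ^+ X](_ : r = (1 + (r - i.+1) + i)%N); last by have := ltn_ord i; lia.
  by rewrite !exprD expr1; ring.
have dvd_d : redp f %| dbar ^+ r.
  have [|q /(congr1 redp)] := hom pP d; first by rewrite rmorph_nat mulr_natr -scaler_nat -pbeta rmorph_nat.
  rewrite rmorphD/= redp_pM addr0 rmorphXn rmorphM/= liftpK => ->.
  exact: dvdp_mulIr.
have dvd_h : phibar %| redp h' ^+ r.
  have [|q /(congr1 redp)] := hom phi (- h'); first by rewrite betaphi rmorphN.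
  rewrite rmorphD rmorphM rmorphXn rmorphN/= liftpK rmorphM/= phiE => E.
  have -> : redp h' ^+ r = (-1) ^+ r * (- redp h') ^+ r by rewrite -exprMn mulN1r opprK.
  rewrite dvdp_mull// (canRL (addrK _) E) dvdp_sub//; last exact: dvdp_mulIl.
  by rewrite dvdp_mull// dvdp_mulIl.
(* Modulo p, phi divides f and hence d^r, and it also divides h'^r; so neither gcd can be
   constant. *)
set pi1 := gcdp phibar dbar; set pi := gcdp pi1 (redp h').
have pi_phi : pi %| phibar by rewrite (dvdp_trans (dvdp_gcdl _ _))// dvdp_gcdl.
have pi_d : pi %| dbar by rewrite (dvdp_trans (dvdp_gcdl _ _))// dvdp_gcdr.
have pi_h' : pi %| redp h' by rewrite dvdp_gcdr.
have pi0 : pi != 0 by apply: contraNneq phi0 => pi0; rewrite -dvd0p -pi0.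
have pi1_neq1 : size pi1 != 1%N.
  apply/eqP => pi1E; case/eqP: phi1; apply: (@coprimep_dvd_exp _ _ dbar r).
    by rewrite /coprimep -/pi1 pi1E.
  by rewrite (dvdp_trans _ dvd_d)// phiE dvdp_mulIl.
have pi_neq1 : size pi != 1%N.
  apply/eqP => piE; case/eqP: pi1_neq1; apply: (@coprimep_dvd_exp _ _ (redp h') r).
    by rewrite /coprimep -/pi piE.
  by rewrite (dvdp_trans (dvdp_gcdl _ _)).
have pi_s : pi %| redp s.
  apply: (@square_decomposition_dvd _ (redp f) 0 (redp s) (redp g) 0) => //; last first.
  - by rewrite phiE expr2 dvdp_mul.
  - by rewrite mulr0.
  by rewrite fE rmorphD/= redp_pM addr0 rmorphM rmorphXn.
have pi_h : pi %| redp h.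
  rewrite -(liftpK p_pr pi); apply: (@redp_dvd_ideal (liftp pi) s g h d phi h'); rewrite ?liftpK//.
  by rewrite -fE fE'.
by move: pi_neq1; have /coprimepP/(_ pi pi_s pi_h) := cop; rewrite -size_poly_eq1 => ->.
Qed.

(** Conversely, a common factor phi of s and h modulo p puts f in the shape phi (phi a + p b) + p^2
    c required by [nonmaximal_of_factor]. *)
Lemma maximal_polyP (s g h : {poly Zp}) :
  f = s ^+ 2 * g + pP * h -> square_reduced (redp g) 0 ->
  maximal_poly f <-> coprimep (redp s) (redp h).
Proof.
move=> fE red; split; last exact: maximal_of_coprime fE red.
apply: contraPT => ncop.
have f0 : redp f != 0 by rewrite monic_neq0// /redp monic_map.
have s0 : redp s != 0.
  apply: contraNneq f0 => s0.
  by rewrite fE rmorphD/= redp_pM addr0 rmorphM rmorphXn/= s0 expr0n mul0r.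
pose phi := liftp (gcdp (redp s) (redp h)).
have phiE : redp phi = gcdp (redp s) (redp h) by rewrite liftpK.
have [s1 [s2 sE]] : exists a b, s = phi * a + pP * b.
  by apply: redp_dvd; rewrite phiE dvdp_gcdl.
have [h1 [h2 hE]] : exists a b, h = phi * a + pP * b.
  by apply: redp_dvd; rewrite phiE dvdp_gcdr.
apply: (nonmaximal_of_factor fm f1 (phi := phi) (a := s1 ^+ 2 * g)
   (b := 2 * s1 * s2 * g + h1) (c := s2 ^+ 2 * g + h2)).
  by rewrite fE {}sE {}hE; ring.
rewrite phiE ltn_neqAle eq_sym -/(coprimep _ _) ncop size_poly_gt0.
by rewrite gcdp_eq0 (negPf s0).
Qed.
End Dedekind.

(** * Discriminants modulo p^2 *)

Section ReplaceRow.
Variables (A : comNzRingType) (n : nat).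

Definition replace_row (S : 'M[A]_n) (w : 'rV_n) (i0 : 'I_n) : 'M[A]_n :=
  \matrix_i (if i == i0 then w else row i S).

Lemma row_replace_row S w i0 i :
  row i (replace_row S w i0) = if i == i0 then w else row i S.
Proof. exact: rowK. Qed.

Lemma det_replace_row1 (u : 'rV[A]_n) i0 : \det (replace_row 1%:M u i0) = u 0 i0.
Proof.
rewrite (expand_det_col _ i0) (bigD1 i0)//= big1 ?addr0 => [|i ii0]; last first.
  by rewrite !mxE (negPf ii0) !mxE (negPf ii0) mul0r.
rewrite mxE eqxx -[RHS]mulr1; congr (_ * _).
rewrite /cofactor exprD -expr2 sqrr_sign mul1r -[RHS](det1 A n.-1); congr (\det _).
apply/matrixP => i j.
by rewrite !mxE eq_sym (negPf (neq_lift _ _)) !mxE (inj_eq lift_inj).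
Qed.

(** The identity matrix with row i0 replaced by u has determinant u_i0, and its product with S is S
    with row i0 replaced by u S. *)
Lemma det_replace_row_comb (S : 'M[A]_n) (u w : 'rV_n) a i0 :
  u *m S = a *: w -> u 0 i0 * \det S = a * \det (replace_row S w i0).
Proof.
move=> uS; rewrite -(det_replace_row1 u i0) -det_mulmx.
have -> : replace_row 1%:M u i0 *m S = replace_row S (a *: w) i0.
  apply/row_matrixP => i; rewrite row_mul !row_replace_row; case: eqP => // _.
  by rewrite -row_mul mul1mx.
rewrite (@determinant_multilinear _ _ _ (replace_row S w i0) (replace_row S w i0) i0 a 0).
- by rewrite mul0r addr0.
- by rewrite !row_replace_row eqxx scale0r addr0.
- by apply/matrixP => i j; rewrite !mxE eq_sym (negPf (neq_lift _ _)) !mxE.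
- by apply/matrixP => i j; rewrite !mxE eq_sym (negPf (neq_lift _ _)) !mxE.
Qed.

End ReplaceRow.

Section SquarefreeSeparable.
Variables (p : nat) (p_pr : prime p).

(** Only exponents divisible by p survive, and Frobenius fixes the coefficients in F_p. *)
Lemma deriv_eq0_exp (u : {poly 'F_p}) : u^`() = 0 -> exists v, u = v ^+ p.
Proof.
move=> u'0; have ui i : ~~ (p %| i)%N -> u`_i = 0.
  case: i => [|i]; first by rewrite dvdn0.
  move=> pi; have := congr1 (fun q : {poly 'F_p} => q`_i) u'0.
  rewrite coef_deriv coef0 -mulr_natr => /eqP; rewrite mulf_eq0 Fp_natr_eq0//.
  by rewrite (negPf pi) orbF => /eqP.
have chP : p \in [pchar {poly 'F_p}] by rewrite pchar_poly pchar_Fp.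
exists (\poly_(i < size u) u`_(i * p)); rewrite poly_def.
rewrite -(pFrobenius_autE chP) rmorph_sum/=.
under eq_bigr => i _.
  rewrite pFrobenius_autE exprZn -exprM.
  have -> : u`_(i * p) ^+ p = u`_(i * p) by rewrite -[RHS]finfield.expf_card card_Fp.
  over.
apply/polyP => j; rewrite coef_sum.
under eq_bigr do rewrite coefZ coefXn.
have [/dvdnP[k jE]|pj] := boolP (p %| j)%N; last first.
  rewrite (ui _ pj) big1 // => i _; case: eqP => [jE|_]; last by rewrite mulr0.
  by rewrite jE mulnC dvdn_mulr in pj.
have [ku|uk] := ltnP k (size u); last first.
  rewrite nth_default; last by rewrite jE (leq_trans uk)// leq_pmulr// prime_gt0.
  rewrite big1 // => i _; case: eqP => [jE'|_]; last by rewrite mulr0.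
  have /eqP := jE; rewrite jE' mulnC [(k * p)%N]mulnC eqn_pmul2l ?prime_gt0// => /eqP ik.
  by have := ltn_ord i; rewrite ik ltnNge uk.
rewrite (bigD1 (Ordinal ku))//= big1 => [|i ik]; last first.
  case: eqP => [jE'|_]; last by rewrite mulr0.
  case/negP: ik; apply/eqP/val_inj => /=; move/eqP: jE'.
  by rewrite jE mulnC [(i * p)%N]mulnC eqn_pmul2l ?prime_gt0// => /eqP.
by rewrite addr0 -jE eqxx mulr1.
Qed.

Lemma squarefree_separable (f : {poly 'F_p}) : f != 0 -> square_reduced f 0 ->
  coprimep f f^`().
Proof.
move=> f0 red; suff : separable_poly f by rewrite separable_poly.unlock.
apply/separable_polyP; split=> [u v uvf|u uf u1].
  rewrite /coprimep eqn_leq red ?dvdp0//; last first.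
    by rewrite (dvdp_trans _ uvf)// expr2 dvdp_mul// ?dvdp_gcdl ?dvdp_gcdr.
  rewrite size_poly_gt0 gcdp_eq0 negb_and; apply/orP; left.
  by apply: contraNneq f0 => u0; rewrite -dvd0p (dvdp_trans _ uvf)// u0 mul0r.
apply/eqP => /deriv_eq0_exp[v uE].
have v1 : (size v <= 1)%N.
  apply: red; rewrite ?dvdp0//; apply: dvdp_trans uf.
  by rewrite uE dvdp_exp2l// prime_gt1.
move: u1; rewrite ltnNge => /negP; apply.
by rewrite uE (size1_polyC v1) -polyC_exp size_polyC_leq1.
Qed.
End SquarefreeSeparable.

Section Sylvester.
Variables (p : nat) (p_pr : prime p).
Local Notation Zp := (padic_int p_pr).
Local Notation pZ := (p%:R : Zp).
Local Notation redp := (@redp p p_pr).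
Local Notation red := (@red p p_pr).
Local Notation liftp := (@liftp p p_pr).

Lemma mul_Sylvester (R : comNzRingType) (f g : {poly R}) (x : 'rV_(_ + _)) :
  x *m Sylvester_mx f g =
  poly_rV (rVpoly (lsubmx x) * f + rVpoly (rsubmx x) * g).
Proof.
by rewrite -[in LHS](hsubmxK x) mul_row_col !mul_rV_lin1/= -linearD.
Qed.

Lemma horner_mulmx (R : comNzRingType) n (v : 'rV[R]_n) (a : R) :
  (v *m (\col_i a ^+ i)) 0 0 = (rVpoly v).[a].
Proof.
rewrite mxE (@horner_coef_wide _ n) ?size_poly//.
by apply: eq_bigr => i _; rewrite coef_rVpoly_ord mxE.
Qed.

Lemma size_Sylvester_comb (R : comNzRingType) (f g : {poly R})
    (a : 'rV_(size g).-1) (b : 'rV_(size f).-1) : f != 0 -> g != 0 ->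
  (size (rVpoly a * f + rVpoly b * g)%R <= (size g).-1 + (size f).-1)%N.
Proof.
move=> f0 g0; have sf := size_poly_gt0 f; have sg := size_poly_gt0 g.
rewrite f0 in sf; rewrite g0 in sg.
have sa : (size (rVpoly a) <= (size g).-1)%N by exact: size_poly.
have sb : (size (rVpoly b) <= (size f).-1)%N by exact: size_poly.
have E (x y z : nat) : (x <= y.-1 -> 0 < z -> 0 < y -> (x + z).-1 <= y.-1 + z.-1)%N by lia.
rewrite (leq_trans (size_polyD _ _))// geq_max; apply/andP; split.
  by apply: leq_trans (size_polyMleq _ _) _; apply: E.
by rewrite addnC; apply: leq_trans (size_polyMleq _ _) _; apply: E.
Qed.

(** Up to a unit, det S is p times the new determinant, so divisibility by p^2 becomes singularity
    of a matrix over F_p. *)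
Lemma det_p2_replace_row n (S : 'M[Zp]_n) (u w : 'rV_n) i0 :
  u *m S = pZ *: w -> red (u 0 i0) != 0 ->
  (exists c, \det S = pZ ^+ 2 * c) <-> \det (map_mx red (replace_row S w i0)) = 0.
Proof.
move=> uS u0; have := det_replace_row_comb i0 uS => detE; rewrite det_map_mx.
have uu := red_unit u0; split=> [[c cE]|/eqP/red_eq0P[c cE]].
  apply/eqP/red_eq0P; exists (u 0 i0 * c); apply: (mulfI (pZ_neq0 p_pr)).
  by rewrite -detE cE; ring.
exists ((u 0 i0)^-1 * c); apply: (mulrI uu); rewrite detE cE.
by rewrite [RHS]mulrCA mulVKr// expr2 mulrA.
Qed.

Variable f : {poly Zp}.
Hypotheses (fm : f \is monic) (f1 : (1 < size f)%N).
Local Notation f' := f^`().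
Local Notation S := (Sylvester_mx f f').

(** Characteristic zero. The Sylvester matrix keeps its size even when the degree of f' drops modulo
    p. *)
Lemma size_deriv_zp : size f' = (size f).-1.
Proof.
have [n fn] : exists n, size f = n.+2.
  by exists (size f).-2; case: (size f) f1 => [|[|]].
have := lt_size_deriv (monic_neq0 fm); rewrite fn ltnS => le.
apply/eqP; rewrite eqn_leq le/= ltnNge; apply/negP => /(nth_default 0)/eqP.
rewrite coef_deriv (_ : f`_n.+1 = 1); last by rewrite -(monicP fm) lead_coefE fn.
by apply/negP; apply: zp_natr_neq0.
Qed.

Lemma discriminant_p2 : (exists c, discriminant f = pZ ^+ 2 * c) <->
  exists c, \det S = pZ ^+ 2 * c.
Proof.
rewrite /discriminant /resultant; split=> [] [c cE]; exists ((-1) ^+ 'C((size f).-1, 2) * c).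
  by rewrite mulrCA -cE signrMK.
by rewrite cE mulrCA.
Qed.

Lemma mulmx_red_Sylvester (x : 'rV['F_p]_((size f').-1 + (size f).-1)) :
  x *m map_mx red S =
  poly_rV (rVpoly (lsubmx x) * redp f + rVpoly (rsubmx x) * redp f').
Proof.
pose X := map_mx (zlift p_pr) x.
have xE : x = map_mx red X by apply/matrixP => i j; rewrite !mxE zliftK.
rewrite {1}xE -map_mxM mul_Sylvester map_poly_rV rmorphD !rmorphM/= !map_rVpoly.
by rewrite map_lsubmx map_rsubmx -xE.
Qed.

Lemma deriv_neq0_zp : f' != 0.
Proof. by rewrite -size_poly_gt0 size_deriv_zp; move: f1; case: (size f) => [|[|]]. Qed.

Lemma mulmx_red_Sylvester_eq0 (x : 'rV['F_p]_((size f').-1 + (size f).-1)) :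
  x *m map_mx red S = 0 <->
  rVpoly (lsubmx x) * redp f + rVpoly (rsubmx x) * redp f' = 0.
Proof.
rewrite mulmx_red_Sylvester; split=> [E|->]; last by rewrite linear0.
pose X := map_mx (zlift p_pr) x.
have xE : x = map_mx red X by apply/matrixP => i j; rewrite !mxE zliftK.
have := size_Sylvester_comb (lsubmx X) (rsubmx X) (monic_neq0 fm) deriv_neq0_zp.
set P := (_ + _)%R => sP.
have PE : rVpoly (lsubmx x) * redp f + rVpoly (rsubmx x) * redp f' = redp P.
  by rewrite rmorphD !rmorphM/= /redp !map_rVpoly map_lsubmx map_rsubmx -xE.
rewrite PE in E *; rewrite -[LHS](@poly_rV_K _ ((size f').-1 + (size f).-1)%N) ?E ?linear0//.
by rewrite (leq_trans (size_poly _ _)).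
Qed.

(* (a, b) is a left null vector of S modulo p, and i0 a coordinate where it is a
   unit, so that det S is up to a unit p times the determinant of S with row i0
   replaced by w. *)
Lemma sylvester_reduction (a b : {poly Zp}) :
  b \is monic -> (size b <= (size f).-1)%N -> (size a <= (size f').-1)%N ->
  redp a * redp f + redp b * redp f' = 0 ->
  exists w i0, [/\ row_mx (poly_rV a) (poly_rV b) *m S = pZ *: w,
    red ((row_mx (poly_rV a) (poly_rV b) : 'rV_((size f').-1 + (size f).-1)) 0 i0) != 0 &
    forall y : 'rV['F_p]_((size f').-1 + (size f).-1),
      y 0 i0 = (rVpoly (rsubmx y))`_(size b).-1].
Proof.
move=> bm sb sa ab0.
have /redp_eq0P[W WE] : redp (a * f + b * f') == 0 by rewrite rmorphD !rmorphM/= ab0.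
have kb : ((size b).-1 < (size f).-1)%N.
  by have := size_poly_gt0 b; rewrite monic_neq0//; case: (size b) sb.
exists (poly_rV W), (rshift _ (Ordinal kb)); split.
- rewrite mul_Sylvester row_mxKl row_mxKr !poly_rV_K// WE.
  by apply/rowP => j; rewrite !mxE coef_pP.
- by rewrite row_mxEr mxE/= -lead_coefE (monicP bm) rmorph1 oner_neq0.
- move=> y; transitivity (rsubmx y 0 (Ordinal kb)); last by rewrite -coef_rVpoly_ord.
  by rewrite -[in LHS](hsubmxK y) row_mxEr.
Qed.

Lemma mulmx_replace_row (A : comNzRingType) n (T : 'M[A]_n) w i0 (x : 'rV_n) :
  x 0 i0 = 0 -> x *m replace_row T w i0 = x *m T.
Proof.
move=> x0; rewrite !mulmx_sum_row; apply: eq_bigr => i _.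
by rewrite row_replace_row; case: eqP => // ->; rewrite x0 !scale0r.
Qed.

Lemma map_replace_row n (T : 'M[Zp]_n) w i0 :
  map_mx red (replace_row T w i0) = replace_row (map_mx red T) (map_mx red w) i0.
Proof.
apply/row_matrixP => i; rewrite -map_row !row_replace_row.
by case: eqP => // _; rewrite map_row.
Qed.

Lemma size_liftp (a : {poly 'F_p}) : size (liftp a) = size a.
Proof.
have [->|a0] := eqVneq a 0; first by rewrite /liftp map_poly0 !size_poly0.
apply: size_map_poly_id0; rewrite -lead_coef_eq0 in a0.
by apply: contraNneq a0 => z0; rewrite -(zliftK p_pr (lead_coef a)) z0 rmorph0.
Qed.

Lemma liftp_monic (a : {poly 'F_p}) : a \is monic -> liftp a \is monic.
Proof.
by move=> am; rewrite monicE lead_coefE size_liftp coef_map_id0// -lead_coefE (monicP am).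
Qed.

Lemma size_redp_f : size (redp f) = size f.
Proof. by rewrite size_map_poly_id0// (monicP fm) rmorph1 oner_neq0. Qed.

Lemma redp_f_monic : redp f \is monic.
Proof. by rewrite /redp monic_map. Qed.

Lemma redp_deriv (a : {poly Zp}) : redp a^`() = (redp a)^`().
Proof. by rewrite /redp deriv_map. Qed.

(** With f = e phi and f' = k phi modulo p, both (- k, e) and (- x k, x e) are left null vectors of
    S modulo p; the second one fits because deg phi >= 2. The second is fed to
    [sylvester_reduction], and the first remains null because its coordinate at the leading term of
    x e is 0. *)
Lemma p2_dvd_disc_of_common_factor (phi : {poly 'F_p}) : phi \is monic -> (2 < size phi)%N ->
  phi %| redp f -> phi %| (redp f)^`() -> exists c, discriminant f = pZ ^+ 2 * c.
Proof.
move=> phim phi2 /dvdpP[e eE] /dvdpP[k kE]; apply/discriminant_p2.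
have em : e \is monic by rewrite -(monicMr _ phim) -eE redp_f_monic.
have sf : size f = (size e + size phi).-1.
  by rewrite -size_redp_f eE size_Mmonic ?monic_neq0.
have e0 : (0 < size e)%N by rewrite size_poly_gt0 monic_neq0.
have sXe : size ('X * e) = (size e).+1 by rewrite mulrC size_mulX ?monic_neq0.
have sk : (size k < size e)%N.
  have [->|k0] := eqVneq k 0; first by rewrite size_poly0.
  have := lt_size_deriv (monic_neq0 redp_f_monic).
  rewrite kE eE !size_Mmonic ?(monic_neq0 em)//.
  by rewrite -!subn1; move: (size k) (size e) (size phi) phi2 {sf sXe} => x y z; lia.
have [||||w [i0 [uS u0 yi0]]] := @sylvester_reduction (liftp (- ('X * k))) (liftp ('X * e)).
- by rewrite liftp_monic// monicMl ?monicX.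
- by rewrite size_liftp sXe sf; move: (size e) (size phi) phi2 e0 => x y; lia.
- rewrite size_liftp size_deriv_zp sf size_polyN; apply: leq_trans (size_polyMleq _ _) _.
  rewrite size_polyX (_ : 2%R = 2%N)//; move: (size k) (size e) (size phi) phi2 e0 sk => x y z; lia.
- by rewrite !liftpK redp_deriv kE eE; ring.
apply/(det_p2_replace_row uS u0)/eqP/det0P.
exists (row_mx (poly_rV (- k)) (poly_rV e)).
  apply: contraTneq e0 => /(congr1 rsubmx); rewrite row_mxKr linear0.
  move=> /(congr1 rVpoly); rewrite linear0 poly_rV_K => [->|]; first by rewrite size_poly0.
  by rewrite sf; move: (size e) (size phi) phi2 => x y; lia.
rewrite map_replace_row mulmx_replace_row.
  apply/mulmx_red_Sylvester_eq0; rewrite row_mxKl row_mxKr !poly_rV_K.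
  - by rewrite redp_deriv kE eE; ring.
  - by rewrite sf; move: (size e) (size phi) phi2 => x y; lia.
  - rewrite size_polyN size_deriv_zp sf; move: (size k) (size e) (size phi) phi2 sk => x y z; lia.
rewrite yi0 row_mxKr poly_rV_K; first by rewrite size_liftp sXe nth_default.
by rewrite sf; move: (size e) (size phi) phi2 => x y; lia.
Qed.

(** A left null vector (A, B) of S modulo p satisfies A f + B f' = 0. As f is coprime to f', it
    divides B, whose degree is smaller; so B = 0 and A = 0. *)
Lemma squarefree_sqf_disc : square_reduced (redp f) 0 -> sqf_disc_poly f.
Proof.
move=> /(squarefree_separable p_pr (monic_neq0 redp_f_monic)) cop.
move=> /discriminant_p2[c cE]; have : \det (map_mx red S) == 0.
  by rewrite det_map_mx cE; apply/red_eq0P; exists (pZ * c); rewrite expr2 mulrA.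
move=> /det0P[y y0 /mulmx_red_Sylvester_eq0]; rewrite redp_deriv => E.
have fB : redp f %| rVpoly (rsubmx y).
  rewrite -(Gauss_dvdpl _ cop) -(dvdp_addr _ (dvdp_mulIr (rVpoly (lsubmx y)) _)) E.
  exact: dvdp0.
have B0 : rVpoly (rsubmx y) = 0.
  apply/eqP; apply: contraTT fB => B0; apply/negP => /(dvdp_leq B0).
  rewrite size_redp_f leqNgt => /negP; apply; apply: leq_ltn_trans (size_poly _ _) _.
  by move: f1; case: (size f).
move: E; rewrite B0 mul0r addr0 => /eqP; rewrite mulf_eq0 (negPf (monic_neq0 redp_f_monic)) orbF.
move=> /eqP A0; case/eqP: y0; rewrite -(hsubmxK y) -[lsubmx y]rVpolyK -[rsubmx y]rVpolyK.
by rewrite A0 B0 !linear0 row_mx0.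
Qed.

(** These are the cofactors of x - r in (x - r)^2 g and in its derivative; at r the second one is 2
    g(r). *)
Lemma coprimep_double_root (r : 'F_p) (g : {poly 'F_p}) : (2%:R : 'F_p) != 0 ->
  g != 0 -> square_reduced g 0 -> ~~ root g r ->
  coprimep (('X - r%:P) * g) (2%:R * g + ('X - r%:P) * g^`()).
Proof.
move=> two0 g0 red gr; have gX : coprimep g ('X - r%:P) by rewrite coprimep_XsubC.
rewrite coprimepMl; apply/andP; split.
  rewrite coprimep_sym coprimep_XsubC /root hornerD !hornerM hornerXsubC subrr mul0r addr0.
  by rewrite -polyC_natr hornerC mulf_neq0.
by rewrite coprimep_addl_mul coprimepMr gX squarefree_separable.
Qed.

(* f has a single double root r modulo p, and the left null vector of the
   Sylvester matrix modulo p pairs with the right null vector (r^i) to a unit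
   times f(r). *)
Lemma p2_dvd_disc_double_root (r : 'F_p) (g : {poly 'F_p}) :
  redp f = ('X - r%:P) ^+ 2 * g ->
  ((exists c, f.[zlift p_pr r] = pZ ^+ 2 * c) -> exists c, discriminant f = pZ ^+ 2 * c) /\
  ((2%:R : 'F_p) != 0 -> square_reduced g 0 -> ~~ root g r ->
   (exists c, discriminant f = pZ ^+ 2 * c) -> exists c, f.[zlift p_pr r] = pZ ^+ 2 * c).
Proof.
move=> fE; set rho := zlift p_pr r; have rrho : red rho = r by rewrite zliftK.
have gm : g \is monic by rewrite -(monicMl _ (monic_exp 2 (monicXsubC r))) -fE redp_f_monic.
have g0 := monic_neq0 gm.
have sf : size f = (size g).+2.
  by rewrite -size_redp_f fE size_monicM ?monic_exp ?monicXsubC// size_exp_XsubC.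
have f'E : (redp f)^`() = ('X - r%:P) * (2%:R * g + ('X - r%:P) * g^`()).
  by rewrite fE derivM deriv_exp derivXsubC/= expr1 mul1r -mulr_natl; ring.
pose A := - (2%:R * g + ('X - r%:P) * g^`()).
(* [b] is a product of lifts rather than a lift of the product, so that b(rho) = 0 holds exactly. *)
pose a := liftp A; pose b := ('X - rho%:P) * liftp g.
have rb : redp b = ('X - r%:P) * g.
  by rewrite rmorphM/= liftpK /redp rmorphB/= map_polyX map_polyC/= rrho.
have bm : b \is monic by rewrite monicMl ?monicXsubC ?liftp_monic.
have sb : size b = (size g).+1.
  by rewrite size_monicM ?monicXsubC ?monic_neq0 ?liftp_monic// size_XsubC size_liftp.
have sa : (size a <= size g)%N.
  rewrite size_liftp size_polyN (leq_trans (size_polyD _ _))// geq_max; apply/andP; split.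
    by rewrite -polyC_natr mul_polyC size_scale_leq.
  have [->|g'0] := eqVneq g^`() 0; first by rewrite mulr0 size_poly0.
  rewrite size_monicM ?monicXsubC// size_XsubC.
  exact: lt_size_deriv.
have [|||w [i0 [uS u0 yi0]]] := @sylvester_reduction a b bm.
- by rewrite sb sf.
- by rewrite size_deriv_zp sf.
- by rewrite rb redp_deriv f'E liftpK /A fE; ring.
pose C : 'cV[Zp]_((size f').-1 + (size f).-1) := \col_i rho ^+ i.
have evS (y : 'rV[Zp]_((size f').-1 + (size f).-1)) : (y *m S *m C) 0 0 =
    (rVpoly (lsubmx y)).[rho] * f.[rho] + (rVpoly (rsubmx y)).[rho] * f'.[rho].
  rewrite horner_mulmx mul_Sylvester poly_rV_K ?hornerD ?hornerM//.
  exact: size_Sylvester_comb (monic_neq0 fm) deriv_neq0_zp.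
have red_ev (P : {poly Zp}) : red P.[rho] = (redp P).[r] by rewrite /redp -rrho horner_map.
have fr0 : (redp f).[r] = 0 by rewrite fE hornerM horner_exp hornerXsubC subrr expr0n mul0r.
have f'r0 : (redp f').[r] = 0 by rewrite redp_deriv f'E hornerM hornerXsubC subrr mul0r.
have evS0 i : red ((row i S *m C) 0 0) = 0.
  rewrite rowE evS rmorphD !rmorphM/= (red_ev f) (red_ev f') fr0 f'r0.
  by rewrite !mulr0 addr0.
have wC : pZ * (w *m C) 0 0 = a.[rho] * f.[rho].
  have -> : pZ * (w *m C) 0 0 = ((pZ *: w) *m C) 0 0 by rewrite -scalemxAl [RHS]mxE.
  rewrite -uS evS row_mxKl row_mxKr !poly_rV_K ?sb ?sf ?size_deriv_zp ?sf//.
  by rewrite [b.[_]]hornerM hornerXsubC subrr !mul0r addr0.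
(* Every row of S kills the column (rho^i) modulo p, so only row i0, now w, contributes. *)
have S'C (y : 'rV['F_p]_((size f').-1 + (size f).-1)) :
    (y *m map_mx red (replace_row S w i0) *m map_mx red C) 0 0 = y 0 i0 * red ((w *m C) 0 0).
  have rowC i : (replace_row S w i0 *m C) i 0 = (row i (replace_row S w i0) *m C) 0 0.
    by rewrite -row_mul [RHS]mxE.
  rewrite -mulmxA -map_mxM mxE (bigD1 i0)//= big1 ?addr0 => [|i ii0].
    by rewrite [map_mx red _ _ _]mxE rowC row_replace_row eqxx.
  by rewrite [map_mx red _ _ _]mxE rowC row_replace_row (negPf ii0) evS0 mulr0.
split=> [[c fc]|two0 gred gr /discriminant_p2/(det_p2_replace_row uS u0)/eqP/det0P[y y0 yS]].
  apply/discriminant_p2/(det_p2_replace_row uS u0).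
  have wC0 : red ((w *m C) 0 0) = 0.
    apply/eqP/red_eq0P; exists (a.[rho] * c); apply: (mulfI (pZ_neq0 p_pr)).
    by rewrite wC fc; ring.
  apply/eqP; rewrite -det_tr; apply/det0P; exists (map_mx red C)^T.
    have N0 : (0 < (size f').-1 + (size f).-1)%N by rewrite sf addnS.
    apply/eqP => /matrixP/(_ 0 (Ordinal N0)); rewrite !mxE expr0 rmorph1 => /eqP.
    by rewrite oner_eq0.
  rewrite -trmx_mul; apply/trmx_inj; rewrite trmxK trmx0; apply/colP => i.
  have := S'C (delta_mx 0 i); rewrite wC0 mulr0 -mulmxA -rowE mxE => ->.
  by rewrite mxE.
(* Either w pairs to 0 with (rho^i) modulo p, and p^2 divides f(rho) since a(rho) is a unit; or y
   vanishes at i0, is a null vector of S modulo p, and is 0 for degree reasons. *)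
have := S'C y; rewrite yS mul0mx mxE => /esym/eqP; rewrite mulf_eq0 => /orP[/eqP yi|]; last first.
  move=> /red_eq0P[t tE]; have ra : a.[rho] \is a GRing.unit.
    apply: red_unit; rewrite red_ev liftpK /A hornerN oppr_eq0 hornerD !hornerM hornerXsubC.
    by rewrite subrr mul0r addr0 -polyC_natr hornerC mulf_neq0.
  exists (a.[rho]^-1 * t); apply: (mulrI ra); rewrite -wC tE [RHS]mulrCA mulVKr//.
  by rewrite expr2 mulrA.
case/eqP: y0; move: yS; rewrite map_replace_row mulmx_replace_row//.
move=> /mulmx_red_Sylvester_eq0; set Y1 := rVpoly (lsubmx y); set Y2 := rVpoly (rsubmx y).
rewrite redp_deriv f'E fE => E.
have X0 : 'X - r%:P != 0 by rewrite polyXsubC_eq0.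
have E' : Y1 * (('X - r%:P) * g) + Y2 * (2%:R * g + ('X - r%:P) * g^`()) = 0.
  by apply: (mulfI X0); rewrite mulr0 -E; ring.
have cop := coprimep_double_root two0 g0 gred gr.
have dvdY2 : ('X - r%:P) * g %| Y2.
  rewrite -(Gauss_dvdpl _ cop) -(dvdp_addr _ (dvdp_mulIr Y1 _)) E'.
  exact: dvdp0.
have Y20 : Y2 = 0.
  have sY2 : (size Y2 <= size g)%N.
    apply/leq_sizeP => j; rewrite leq_eqVlt => /predU1P[<-|gj].
      by rewrite -[RHS]yi yi0 sb.
    by rewrite nth_default// (leq_trans (size_poly _ _))// sf.
  apply/eqP; apply: contraTT dvdY2 => Y20; apply/negP => /(dvdp_leq Y20).
  by rewrite size_monicM ?monicXsubC// size_XsubC /= ltnNge sY2.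
have Y10 : Y1 = 0.
  move: E'; rewrite Y20 mul0r addr0 => /eqP; rewrite mulf_eq0 mulf_eq0 (negPf X0) (negPf g0) !orbF.
  by move=> /eqP.
rewrite -(hsubmxK y) -[lsubmx y]rVpolyK -[rsubmx y]rVpolyK -/Y1 -/Y2.
by rewrite Y10 Y20 !linear0 row_mx0.
Qed.

(** Let d be the square part of f modulo p. It divides f and f', so [p2_dvd_disc_of_common_factor]
    bounds its degree by 1. If d = x - r, the same lemma applied to (x - r)^2 excludes g(r) = 0, and
    also p = 2, where f' = (x - r)^2 g'. *)
Lemma sqf_discP : sqf_disc_poly f <->
  square_reduced (redp f) 0 \/
  [/\ odd p & exists r g, [/\ redp f = ('X - r%:P) ^+ 2 * g, square_reduced g 0, ~~ root g r
     & ~ exists c, f.[zlift p_pr r] = pZ ^+ 2 * c]].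
Proof.
have podd2 : odd p -> (2%:R : 'F_p) != 0.
  by move=> po; rewrite Fp_natr_eq0// dvdn_prime2//; apply: contraTneq po => ->.
split=> [sq|[|[po [r [g [fE gred gr fr]]]]]]; last 2 first.
- exact: squarefree_sqf_disc.
- move=> p2; apply: fr; have [_] := p2_dvd_disc_double_root fE.
  by apply=> //; exact: podd2.
have [|nred] := pselect (square_reduced (redp f) 0); [by left|right].
have nodvd phi : phi \is monic -> phi %| redp f -> phi %| (redp f)^`() -> (size phi <= 2)%N.
  move=> phim f1' f2'; rewrite leqNgt; apply/negP => phi2; apply: sq.
  exact: p2_dvd_disc_of_common_factor phi2 f1' f2'.
have sqdvd (d h : {poly 'F_p}) : d ^+ 2 * h = redp f -> d %| (redp f)^`() /\ d %| redp f.
  move=> <-; split; last by rewrite expr2 -mulrA dvdp_mulIl.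
  have -> : (d ^+ 2 * h)^`() = d * (2%:R * d^`() * h + d * h^`()).
    by rewrite derivM expr2 derivM; ring.
  exact: dvdp_mulIl.
have [d [g [k [dm fE kE gred]]]] := @square_decomposition _ _ 0 (monic_neq0 redp_f_monic).
have [d1 d2] := sqdvd d g (esym fE).
have sd : size d = 2%N.
  apply/eqP; rewrite eqn_leq nodvd//= ltnNge; apply/negP => d1'.
  apply: nred; have d_1 : d = 1.
    by apply/eqP; rewrite -eqp_monic ?monic1// -size_poly_eq1 eqn_leq d1' size_poly_gt0 monic_neq0.
  move=> e ef _; apply: gred; last first.
    by move: kE => /esym/eqP; rewrite d_1 mul1r => /eqP ->; rewrite dvdp0.
  by rewrite -[g]mul1r -[1](expr1n _ 2) -d_1 -fE.
have [r rd] := poly2_root sd.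
have dE : d = 'X - r%:P.
  apply/esym/eqP; rewrite -eqp_monic ?monicXsubC// -dvdp_size_eqp ?dvdp_XsubCl//.
  by rewrite sd size_XsubC.
rewrite dE in fE.
have gr : ~~ root g r.
  apply/negP => /factor_theorem[g' gE].
  have f'3 : (redp f)^`() = ('X - r%:P) ^+ 2 * (3%:R * g' + ('X - r%:P) * g'^`()).
    by rewrite fE gE derivM deriv_exp derivM derivXsubC/= expr1 mul1r -mulr_natl; ring.
  have := nodvd (('X - r%:P) ^+ 2); rewrite size_exp_XsubC monic_exp ?monicXsubC//.
  by rewrite f'3 fE !dvdp_mulIl => /(_ isT isT isT).
have k0 : k = 0.
  by move: kE => /esym/eqP; rewrite mulf_eq0 (negPf (monic_neq0 dm)) => /eqP.
rewrite k0 in gred; split.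
  have [p2|//] := even_prime p_pr.
  have two0 : 2%:R = 0 :> {poly 'F_p}.
    by rewrite -polyC_natr; congr _%:P; apply/eqP; rewrite Fp_natr_eq0// p2.
  have f'2 : (redp f)^`() = ('X - r%:P) ^+ 2 * g^`().
    rewrite fE derivM deriv_exp derivXsubC/= expr1 mul1r -mulr_natl two0.
    by rewrite mul0r mul0r add0r.
  have := nodvd (('X - r%:P) ^+ 2); rewrite size_exp_XsubC monic_exp ?monicXsubC//.
  by rewrite f'2 fE !dvdp_mulIl => /(_ isT isT isT).
exists r, g; split=> //.
by move=> fr; apply: sq; apply: (p2_dvd_disc_double_root fE).1.
Qed.
End Sylvester.

(** * The Haar measure in terms of digits *)

Section Digits.
Variables (p : nat) (p_pr : prime p) (m : nat).
Local Notation Zp := (padic_int p_pr).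
Local Notation pZ := (p%:R : Zp).
Local Notation pP := (p%:R : {poly Zp}).
Local Notation redp := (@redp p p_pr).
Local Notation liftp := (@liftp p p_pr).
Local Notation F := ('F_p).

(* x^(m-1-i) has coefficient a_i *)
Definition lowpoly (A : nzRingType) (a : 'rV[A]_m) : {poly A} :=
  rVpoly (\row_(j < m) a 0 (rev_ord j)).

Definition lowrow (A : nzRingType) (P : {poly A}) : 'rV[A]_m :=
  \row_(j < m) P`_(rev_ord j).

Lemma lowrowK (A : nzRingType) (P : {poly A}) : (size P <= m)%N -> lowpoly (lowrow P) = P.
Proof.
move=> sP; rewrite -[RHS](poly_rV_K sP); congr rVpoly; apply/rowP => j.
by rewrite !mxE rev_ordK.
Qed.

Lemma lowpolyK (A : nzRingType) (a : 'rV[A]_m) : lowrow (lowpoly a) = a.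
Proof. by apply/rowP => j; rewrite mxE coef_rVpoly_ord mxE rev_ordK. Qed.

Lemma lowpolyD (A : nzRingType) (a b : 'rV[A]_m) : lowpoly (a + b) = lowpoly a + lowpoly b.
Proof.
by rewrite /lowpoly -linearD; congr rVpoly; apply/rowP => j; rewrite !mxE.
Qed.

Lemma size_lowpoly (A : nzRingType) (a : 'rV[A]_m) : (size (lowpoly a) <= m)%N.
Proof. exact: size_poly. Qed.

Definition digit_poly (z : {poly_m F} * {poly_m F}) : {poly Zp} :=
  liftp z.1 + pP * liftp z.2.

Lemma size_digit_poly z : (size (digit_poly z) <= m)%N.
Proof.
rewrite /digit_poly (leq_trans (size_polyD _ _))// geq_max size_liftp size_npoly/=.
by rewrite -polyC_natr mul_polyC (leq_trans (size_scale_leq _ _))// size_liftp size_npoly.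
Qed.

Lemma size_redp (P : {poly Zp}) : (size (redp P) <= size P)%N.
Proof. exact: size_poly. Qed.

Lemma size_pP (P : {poly Zp}) : size (pP * P) = size P.
Proof. by rewrite -polyC_natr mul_polyC size_scale// pZ_neq0. Qed.

Lemma digits_exist (P : {poly Zp}) : (size P <= m)%N ->
  exists z K, P = digit_poly z + pP ^+ 2 * K.
Proof.
move=> sP; pose A : {poly_m F} := npolyp m (redp P).
have AE : A = redp P :> {poly F} by rewrite npolypK// (leq_trans (size_redp P)).
have [|Q QE] := @redp_congr p p_pr P (liftp A); first by rewrite liftpK AE.
have sQ : (size Q <= m)%N.
  rewrite -size_pP (_ : pP * Q = P - liftp A); last by rewrite {1}QE addrAC subrr add0r.
  by rewrite (leq_trans (size_polyD _ _))// geq_max sP size_polyN size_liftp size_npoly.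
pose H : {poly_m F} := npolyp m (redp Q).
have HE : H = redp Q :> {poly F} by rewrite npolypK// (leq_trans (size_redp Q)).
have [|K KE] := @redp_congr p p_pr Q (liftp H); first by rewrite liftpK HE.
by exists (A, H), K; rewrite {1}QE {1}KE /digit_poly/=; ring.
Qed.

Lemma digits_unique z z' K K' :
  digit_poly z + pP ^+ 2 * K = digit_poly z' + pP ^+ 2 * K' -> z = z'.
Proof.
case: z z' => A H [A' H']; rewrite /digit_poly/= => E.
have AA : A = A'.
  apply/val_inj => /=; have := congr1 redp E.
  by rewrite !rmorphD/= expr2 -!mulrA !redp_pM !addr0 !liftpK.
rewrite AA in E *; congr pair.
have E' : liftp H + pP * K = liftp H' + pP * K'.
  have e (u v w : {poly Zp}) : u + pP * (v + pP * w) = u + pP * v + pP ^+ 2 * w by ring.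
  by apply: (@pP_inj p p_pr); apply: (@addrI _ (liftp A')); rewrite /= !e E.
have := congr1 redp E'.
by rewrite !rmorphD/= !redp_pM !addr0 !liftpK => /val_inj.
Qed.

Lemma ex_digits (a : 'rV[Zp]_m) : exists z, exists K, lowpoly a = digit_poly z + pP ^+ 2 * K.
Proof. exact: digits_exist (size_lowpoly a). Qed.

Definition digits (a : 'rV[Zp]_m) : {poly_m F} * {poly_m F} := sval (cid (ex_digits a)).

Lemma digitsP a : exists K, lowpoly a = digit_poly (digits a) + pP ^+ 2 * K.
Proof. by rewrite /digits; case: cid. Qed.

Lemma digits_eq a z K : lowpoly a = digit_poly z + pP ^+ 2 * K -> digits a = z.
Proof. by have [K' ->] := digitsP a; exact: digits_unique. Qed.

Lemma zp_p2 (x y : Zp) : x 2%N = y 2%N -> exists c, x = y + pZ ^+ 2 * c.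
Proof.
move=> xy; suff [c cE] : exists c, x - y = pZ ^+ 2 * c by exists c; rewrite -cE addrC subrK.
have {xy} : (x - y) 2%N = 0%N.
  have : (y + (x - y)) 2%N = x 2%N by rewrite addrC subrK.
  rewrite zp_resD xy => /eqP; rewrite -[X in _ == X](zp_mod y 2) -[X in _ == (X %% _)%N]addn0.
  by rewrite eqn_modDl mod0n zp_mod => /eqP.
move: (x - y) => {x y} x x2.
have x1 : x 1%N = 0%N by rewrite -(zp_coherent x 1) x2 mod0n.
have /red_eq0P[y yE] : red x == 0 by rewrite /red x1.
have : red y == 0.
  move: x2; rewrite yE zp_resM zp_res_nat modnMml => /eqP; rewrite -/(dvdn _ _) expnS expn1.
  rewrite dvdn_pmul2l ?prime_gt0// -[X in (X %| _)%N]expn1 /dvdn zp_coherent_leq// => y1.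
  by rewrite /red (eqP y1).
by move=> /red_eq0P[c cE]; exists c; rewrite yE cE expr2 mulrA.
Qed.

Lemma digits_local (a b : 'rV[Zp]_m) : (forall i, b 0 i 2%N = a 0 i 2%N) -> digits b = digits a.
Proof.
move=> ab; have /choice[c cE] i : exists c, b 0 i = a 0 i + pZ ^+ 2 * c by exact: zp_p2.
have bE : b = a + \row_i (pZ ^+ 2 * c i) by apply/rowP => i; rewrite !mxE.
have [K KE] := digitsP a.
apply: (@digits_eq _ _ (K + lowpoly (\row_i c i))).
rewrite bE lowpolyD KE mulrDr addrA; congr (_ + _).
have -> : pP ^+ 2 = (pZ ^+ 2)%:P by rewrite polyC_exp polyC_natr.
rewrite mul_polyC /lowpoly -linearZ; congr rVpoly.
by apply/rowP => i; rewrite !mxE.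
Qed.

Variables (R : realType) (mu : probability (borel_Zp p_pr m) R).
Hypothesis mu_inv : translation_invariant mu.

Definition cell (z : {poly_m F} * {poly_m F}) : set 'rV[Zp]_m :=
  [set a | digits a = z]%classic.

(** A condition on the digits only depends on the coordinates modulo p^2, hence defines an open
    set. *)
Lemma measurable_digits (T : {poly_m F} * {poly_m F} -> Prop) :
  measurable ([set a | T (digits a)]%classic : set (borel_Zp p_pr m)).
Proof.
apply: sub_sigma_algebra; rewrite /= openE => a /= Ta.
exists (fun i j => zp_ball (a i j) 2); first by move=> i j; exists 2%N.
move=> b ab /=; rewrite (@digits_local a b)// => i.
exact: ab.
Qed.

(** Digits are not additive because of carries, but adding to a vector with zero digits produces
    none. *)
Lemma digits_translate z a :
  digits (a + lowrow (digit_poly z)) = z <-> digits a = (0, 0).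
Proof.
have z0 : digit_poly (0, 0) = 0 by rewrite /digit_poly /liftp !map_poly0 mulr0 addr0.
have lz : lowpoly (a + lowrow (digit_poly z)) = lowpoly a + digit_poly z.
  by rewrite lowpolyD lowrowK// size_digit_poly.
split=> [az|a0]; last first.
  have [K] := digitsP a; rewrite a0 z0 add0r => KE.
  by apply: (@digits_eq _ _ K); rewrite lz KE addrC.
have [K] := digitsP (a + lowrow (digit_poly z)).
rewrite az lz [X in X = _]addrC => /addrI KE.
by apply: (@digits_eq _ _ K); rewrite KE z0 add0r.
Qed.

Lemma mu_cell z : mu (cell z) = mu (cell (0, 0)).
Proof.
rewrite -(mu_inv (lowrow (digit_poly z)) (measurable_digits (eq^~ (0, 0)))).
congr (mu _); apply/seteqP; split=> a /=; last by move=> [b b0 <-]; apply/digits_translate.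
move=> az; exists (a - lowrow (digit_poly z)); last by rewrite subrK.
by apply/(digits_translate z); rewrite subrK.
Qed.

Lemma mu_digits_seq (s : seq ({poly_m F} * {poly_m F})) : uniq s ->
  mu [set a | digits a \in s]%classic = ((size s)%:R * fine (mu (cell (0, 0))))%:E.
Proof.
have mcell z : measurable (cell z : set (borel_Zp p_pr m)) by exact: (measurable_digits (eq^~ z)).
elim: s => [_|z s IH /= /andP[zs us]].
  rewrite mul0r [X in mu X](_ : _ = set0) ?measure0//.
  by apply/seteqP; split.
have -> : [set a | digits a \in z :: s]%classic = (cell z `|` [set a | digits a \in s])%classic.
  apply/seteqP; split=> a /=; rewrite in_cons.
    by case/predU1P; [left|right].
  by case=> [->|->]; rewrite ?eqxx ?orbT.
rewrite measureU//; last 2 first.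
- exact: (measurable_digits (fun z => z \in s)).
- by apply/seteqP; split=> // a /= [az as_]; rewrite -az as_ in zs.
rewrite [X in (_ + X)%E](IH us) [X in (X + _)%E]mu_cell.
rewrite -[X in (X + _)%E]fineK; last exact: fin_num_measure.
by rewrite -EFinD -natr1 mulrDl mul1r addrC.
Qed.

(** The p^(2 m) cells are translates of one another and partition a space of mass 1. *)
Lemma mu_digits (T : {set {poly_m F} * {poly_m F}}) :
  fine (mu [set a | digits a \in T]%classic) = #|T|%:R / p%:R ^+ (m + m).
Proof.
have e1 := mu_digits_seq (enum_uniq (@predT ({poly_m F} * {poly_m F}))).
have all1 : [set a | digits a \in enum (@predT ({poly_m F} * {poly_m F}))]%classic = [set: 'rV[Zp]_m]%classic.
  by apply/seteqP; split=> // a _ /=; rewrite mem_enum.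
rewrite all1 probability_setT -cardE card_prod !card_npoly card_Fp// -expnD natrX in e1.
have -> : [set a | digits a \in T]%classic = [set a | digits a \in enum T]%classic.
  by apply/seteqP; split=> a /=; rewrite mem_enum.
rewrite mu_digits_seq ?enum_uniq// -cardE /=; congr (_ * _).
have [] := e1 => e1'; apply: (mulfI (x := p%:R ^+ (m + m))).
  by rewrite expf_neq0// pnatr_eq0 -lt0n prime_gt0.
by rewrite -e1' divff// expf_neq0// pnatr_eq0 -lt0n prime_gt0.
Qed.

Lemma mu_setT : fine (mu [set: 'rV[Zp]_m]%classic) = 1.
Proof. by rewrite probability_setT. Qed.
End Digits.

(** * Densities *)

Section TopCoefs.
Variable A : nzRingType.

Definition topf n (c1 c2 : A) : {poly A} := 'X^n + c1 *: 'X^(n - 1) + c2 *: 'X^(n - 2).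

Lemma coef_topf_add n c1 c2 (P : {poly A}) j : (2 <= n)%N -> (size P <= n - 2)%N ->
  (topf n c1 c2 + P)`_j =
  if j == n then 1 else if j == (n - 1)%N then c1 else if j == (n - 2)%N then c2 else P`_j.
Proof.
move=> n2 sP; rewrite !coefD !coefZ !coefXn.
have An (i : nat) : (n - 2 <= i)%N -> P`_i = 0 by move=> ni; rewrite nth_default// (leq_trans sP).
have [->|jn] := eqVneq j n.
  rewrite An ?leq_subr// [_ == (n - 1)%N]gtn_eqF ?[_ == (n - 2)%N]gtn_eqF; try lia.
  by rewrite !mulr0 !addr0.
have [->|jn1] := eqVneq j (n - 1)%N.
  rewrite An; last lia.
  by rewrite [_ == (n - 2)%N]gtn_eqF ?mulr0 ?addr0 ?add0r ?mulr1//; lia.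
have [->|jn2] := eqVneq j (n - 2)%N; last by rewrite !mulr0 !add0r.
by rewrite An// mulr0 !add0r mulr1 addr0.
Qed.

Lemma size_topf_add n c1 c2 (P : {poly A}) : (2 <= n)%N -> (size P <= n - 2)%N ->
  size (topf n c1 c2 + P)%R = n.+1.
Proof.
move=> n2 sP; apply/eqP; rewrite eqn_leq; apply/andP; split.
  apply/leq_sizeP => j nj; rewrite coef_topf_add//.
  rewrite !gtn_eqF ?nth_default ?(leq_trans sP)//; lia.
rewrite ltnNge; apply/negP => /leq_sizeP/(_ n (leqnn n))/eqP.
by rewrite coef_topf_add// eqxx oner_eq0.
Qed.

Lemma topf_add_monic n c1 c2 (P : {poly A}) : (2 <= n)%N -> (size P <= n - 2)%N ->
  topf n c1 c2 + P \is monic.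
Proof.
by move=> n2 sP; rewrite monicE lead_coefE size_topf_add//= coef_topf_add// eqxx.
Qed.
End TopCoefs.

Section ResidueCounts.
Variables (R : realFieldType) (F : finFieldType).
Local Notation q := (#|F|%:R : R).

(** Division with remainder: k + H is equidistributed modulo s, with q^(N - e) polynomials H in each
    class. *)
Lemma sum_mod_poly (s k : {poly F}) e N (P : {poly F} -> bool) :
  s \is monic -> size s = e.+1 -> (e <= N)%N ->
  (forall u v, s %| u - v -> P u = P v) ->
  \sum_(H : {poly_N F}) (P (k + H))%:R = q ^+ (N - e) * \sum_(h : {poly_e F}) (P h)%:R :> R.
Proof.
move=> sm se eN Ps; have s0 := monic_neq0 sm.
have sk : (size (k %% s)%R <= e)%N by have := ltn_modp k s; rewrite s0 se ltnS.
pose phi (z : {poly_e F} * {poly_(N - e) F}) : {poly_N F} :=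
  npolyp N ((z.1 : {poly F}) + s * (z.2 : {poly F}) - k %% s).
have phiE z : phi z = (z.1 : {poly F}) + s * (z.2 : {poly F}) - k %% s :> {poly F}.
  rewrite npolypK// (leq_trans (size_polyD _ _))// geq_max size_polyN (leq_trans sk eN) andbT.
  rewrite (leq_trans (size_polyD _ _))// geq_max (leq_trans (size_npoly _) eN)/=.
  have [->|z20] := eqVneq (z.2 : {poly F}) 0; first by rewrite mulr0 size_poly0.
  by rewrite size_monicM// se addSn/= -leq_subRL// size_npoly.
have phi_inj : injective phi.
  move=> [x y] [x' y'] /(congr1 val); rewrite /= !phiE/= => /addIr E.
  have xx : (x : {poly F}) - x' = s * ((y' : {poly F}) - y).
    by rewrite mulrBr; apply/eqP; rewrite subr_eq addrAC [_ + (x' : {poly F})]addrC -E addrK.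
  have x0 : (x : {poly F}) - x' = 0.
    apply/eqP; apply: contraTT (dvdp_mulIl s ((y' : {poly F}) - y)) => x0.
    rewrite -xx gtNdvdp// se ltnS (leq_trans (size_polyD _ _))// geq_max size_polyN.
    by rewrite !size_npoly.
  have -> : x = x' by apply/val_inj/eqP; rewrite /= -subr_eq0 x0.
  congr pair; apply/val_inj/esym/eqP; rewrite /= -subr_eq0.
  by have /eqP := xx; rewrite x0 eq_sym mulf_eq0 (negPf s0).
have phi_bij : bijective phi.
  apply: inj_card_bij phi_inj _.
  by rewrite card_prod !card_npoly -expnD subnKC.
rewrite (reindex phi) /=; last exact: onW_bij.
rewrite (eq_bigr (fun z : {poly_e F} * {poly_(N - e) F} => (P z.1)%:R * 1 : R)); last first.
  move=> z _; rewrite mulr1; congr (nat_of_bool _)%:R; apply: Ps.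
  have -> : k + (phi z : {poly F}) - (z.1 : {poly F}) = s * (k %/ s + (z.2 : {poly F})).
    by rewrite phiE {1}(divp_eq k s); ring.
  exact: dvdp_mulIl.
rewrite -(pair_bigA _ (fun (x : {poly_e F}) (y : {poly_(N - e) F}) => (P x)%:R * 1 : R))/=.
rewrite mulr_sumr; apply: eq_bigr => x _.
by rewrite sum_npoly mulr1 -[LHS]/(_ * _).
Qed.

(** As g is squarefree, d^2 | f forces d | s. This identifies Dedekind's condition with the pairs
    counted by [red_count]. *)
Lemma square_reduced_coprimep (f s g h : {poly F}) : f != 0 -> f = s ^+ 2 * g ->
  square_reduced g 0 -> square_reduced f h <-> coprimep s h.
Proof.
move=> f0 fE red; have s0 : s != 0 by apply: contraNneq f0 => s0; rewrite fE s0 expr0n mul0r.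
split=> [redf|/coprimepP cop d df dh].
  rewrite /coprimep eqn_leq size_poly_gt0 gcdp_eq0 (negPf s0)/= andbT.
  apply: redf; last exact: dvdp_gcdr.
  by rewrite fE (dvdp_trans (dvdp_exp2r 2 (dvdp_gcdl s h)))// dvdp_mulIl.
have ds : d %| s.
  by apply: (square_decomposition_dvd (h := 0) (k := 0) f0 fE) => //; rewrite ?mulr0.
by have := cop d ds dh; rewrite -size_poly_eq1 => /eqP ->.
Qed.

Lemma coprimep_congr (s u v : {poly F}) : s %| u - v -> coprimep s u = coprimep s v.
Proof.
move=> /dvdpP[w uv]; have -> : u = w * s + v by rewrite -uv subrK.
exact: coprimep_addl_mul.
Qed.

Lemma topf_add n c1 c2 (A : {poly_(n - 2) F}) : (2 <= n)%N ->
  exists a : {poly_n F}, topf n c1 c2 + A = mon a.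
Proof.
by move=> n2; apply: monP; rewrite ?topf_add_monic ?size_topf_add ?size_npoly.
Qed.

Lemma sum_topf n c1 c2 (f : {poly F} -> R) : (2 <= n)%N ->
  \sum_(A : {poly_(n - 2) F}) f (topf n c1 c2 + A) =
  \sum_(a : {poly_n F}) ((coef1 (mon a) == c1) && (coef2 (mon a) == c2))%:R * f (mon a).
Proof.
move=> n2; have /choice[phi phiE] A := @topf_add n c1 c2 A n2.
have phi_inj : injective phi.
  by move=> A B /(congr1 (@mon F n)); rewrite -!phiE => /addrI/val_inj.
rewrite [RHS](bigID (fun a => a \in [set phi A | A : {poly_(n - 2) F}]))/=.
rewrite big_imset/=; last by move=> ? ? _ _; apply: phi_inj.
rewrite [X in _ + X]big1 ?addr0 => [|a]; last first.
  case: andP => [[/eqP a1 /eqP a2]|_ _]; last by rewrite mul0r.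
  case/negP; apply/imsetP; exists (npolyp (n - 2) (mon a)) => //.
  apply: mon_inj; rewrite -phiE; apply/polyP => j; rewrite coef_topf_add ?size_npoly// coef_npolyp.
  have [->|jn] := eqVneq j n.
    by have := monicP (mon_monic a); rewrite lead_coefE size_mon.
  rewrite (coef1E (size_mon a)) in a1; last by lia.
  rewrite (coef2E (size_mon a)) in a2; last by lia.
  have [->//|jn1] := eqVneq j (n - 1)%N.
  have [->//|jn2] := eqVneq j (n - 2)%N.
  case: ltnP => // nj; rewrite nth_default// size_mon.
  by move: jn jn1 jn2; rewrite -!(rwP negP) => *; lia.
apply: eq_bigr => A _; rewrite -phiE.
have sA : size (topf n c1 c2 + A)%R = n.+1 by rewrite phiE size_mon.
rewrite (coef1E sA) ?(coef2E sA) ?coef_topf_add ?size_npoly//; try lia.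
by rewrite !eqxx ![_ == n]ltn_eqF ?[(n - 2)%N == (n - 1)%N]ltn_eqF ?eqxx ?mul1r//; lia.
Qed.
End ResidueCounts.

Section DensityCount.
Variables (R : realType) (p : nat) (p_pr : prime p) (n : nat).
Hypothesis n3 : (3 <= n)%N.
Variable mu : probability (borel_Zp p_pr (n - 2)) R.
Hypothesis mu_inv : translation_invariant mu.
Local Notation Zp := (padic_int p_pr).
Local Notation pZ := (p%:R : Zp).
Local Notation pP := (p%:R : {poly Zp}).
Local Notation red := (@red p p_pr).
Local Notation redp := (@redp p p_pr).
Local Notation liftp := (@liftp p p_pr).
Local Notation F := ('F_p).
Local Notation q := (p%:R : R).
Local Notation m := (n - 2)%N.
Variables b1 b2 : Zp.
Local Notation V := (Vn_fixed n b1 b2).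

Lemma density_digits (Q : set {poly Zp}) (T : {set {poly_m F} * {poly_m F}}) :
  (forall a : 'rV[Zp]_m, Q (topf n b1 b2 + lowpoly a) <-> digits a \in T) ->
  density mu V Q = #|T|%:R / q ^+ (m + m).
Proof.
move=> QT; have n2 : (2 <= n)%N by lia.
have fcE (f : {poly Zp}) : free_coefs n f = lowrow m f.
  by apply/rowP => i; rewrite !mxE /=; congr (f`_ _); lia.
have fc_topf (a : 'rV[Zp]_m) : free_coefs n (topf n b1 b2 + lowpoly a) = a.
  rewrite fcE -[RHS]lowpolyK; apply/rowP => i; rewrite !mxE coef_topf_add ?size_lowpoly//.
  have := ltn_ord (rev_ord i); move: (rev_ord i : nat) => j jm.
  by rewrite !ltn_eqF//; lia.
have topfV (a : 'rV[Zp]_m) : V (topf n b1 b2 + lowpoly a).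
  split; rewrite ?topf_add_monic ?size_topf_add ?size_lowpoly ?coef_topf_add ?size_lowpoly//.
    by rewrite eqxx ltn_eqF//; lia.
  by rewrite eqxx !ltn_eqF//; lia.
have V_topf f : V f -> topf n b1 b2 + lowpoly (lowrow m f) = f.
  case=> fm fn f1 f2; apply/polyP => j; rewrite coef_topf_add ?size_lowpoly//.
  have [->|jn] := eqVneq j n; first by have := monicP fm; rewrite lead_coefE fn.
  have [->//|jn1] := eqVneq j (n - 1)%N.
  have [->//|jn2] := eqVneq j (n - 2)%N.
  have [nj|jm] := leqP m j.
    by rewrite !nth_default ?(leq_trans (size_lowpoly _))// fn; move: jn jn1 jn2; lia.
  by rewrite -[j]/(val (Ordinal jm)) coef_rVpoly_ord !mxE rev_ordK.
have imE (S : set {poly Zp}) : (free_coefs n @` (V `&` S) = [set a | S (topf n b1 b2 + lowpoly a)])%classic.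
  apply/seteqP; split=> a /=.
    by case=> f [Vf Sf] <-; rewrite fcE V_topf.
  by move=> Sa; exists (topf n b1 b2 + lowpoly a).
have VT : (V = V `&` setT)%classic by rewrite setIT.
rewrite /density imE [X in fine (mu (_ @` X)%classic)]VT imE.
rewrite [X in _ / fine (mu X)](_ : _ = setT)%classic; last by apply/seteqP.
rewrite mu_setT divr1 -(mu_digits mu_inv); congr (fine (mu _)).
by apply/seteqP; split=> a /= /QT.
Qed.

Lemma density_sum (Q : set {poly Zp}) :
  (forall (z : {poly_m F} * {poly_m F}) K, (size (digit_poly p_pr z + pP ^+ 2 * K)%R <= m)%N ->
    Q (topf n b1 b2 + (digit_poly p_pr z + pP ^+ 2 * K)) <-> Q (topf n b1 b2 + digit_poly p_pr z)) ->
  density mu V Q = (\sum_(A : {poly_m F}) \sum_(H : {poly_m F})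
    (`[< Q (topf n b1 b2 + liftp A + pP * liftp H) >])%:R) / q ^+ (m + m).
Proof.
move=> Qp2; pose T := [set z : {poly_m F} * {poly_m F} | `[< Q (topf n b1 b2 + digit_poly p_pr z) >]].
rewrite (density_digits (T := T)) => [|a]; last first.
  have [K KE] := digitsP a; rewrite inE KE Qp2 -?KE ?size_lowpoly//.
  by split=> [/asboolP//|/asboolP].
congr (_ / _); rewrite pair_bigA /= -sum1_card natr_sum big_mkcond/=.
apply: eq_bigr => z _; rewrite inE /digit_poly addrA.
by case: asboolP.
Qed.

Local Notation c1 := (red b1).
Local Notation c2 := (red b2).
Local Notation topF := (topf n c1 c2).

Lemma redp_topf : redp (topf n b1 b2) = topF.
Proof. by rewrite /topf !rmorphD/= /redp !map_polyZ/= !map_polyXn. Qed.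

Lemma hdim_le : (hdim true n <= m)%N. Proof. by rewrite /hdim mul1n; lia. Qed.

Lemma topf_square_decomposition (A : {poly_m F}) : exists d g k,
  [/\ d \is monic, topF + A = d ^+ 2 * g, square_reduced g 0
    & topf n b1 b2 + liftp A = liftp d ^+ 2 * liftp g + pP * k].
Proof.
have n2 : (2 <= n)%N by lia.
have f0 : topF + A != 0 by rewrite monic_neq0// topf_add_monic// size_npoly.
have [d [g [k [dm fE kE red]]]] := @square_decomposition _ _ 0 f0.
have k0 : k = 0.
  by move: kE => /esym/eqP; rewrite mulf_eq0 (negPf (monic_neq0 dm)) => /eqP.
have [|k' k'E] := @redp_congr p p_pr (topf n b1 b2 + liftp A) (liftp d ^+ 2 * liftp g).
  by rewrite rmorphD rmorphM rmorphXn/= redp_topf !liftpK.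
by exists d, g, k'; split=> //; rewrite -k0.
Qed.

Lemma maximal_topfP (A : {poly_m F}) d g k h : d \is monic ->
  topf n b1 b2 + liftp A = liftp d ^+ 2 * liftp g + pP * k ->
  square_reduced g 0 -> (size (liftp A + pP * h)%R <= m)%N ->
  maximal_poly (topf n b1 b2 + liftp A + pP * h) <-> coprimep d (redp (k + h)).
Proof.
have n2 : (2 <= n)%N by lia.
move=> dm fE red sz; rewrite -[X in coprimep X _](liftpK p_pr d).
have fm : topf n b1 b2 + liftp A + pP * h \is monic by rewrite -addrA topf_add_monic.
have f1 : (1 < size (topf n b1 b2 + liftp A + pP * h)%R)%N by rewrite -addrA size_topf_add//; lia.
apply: (maximal_polyP fm f1 (g := liftp g)); last by rewrite liftpK.
by rewrite fE; ring.
Qed.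

Lemma Pmax_red_count : Pmax mu V =
  red_count R true n (fun f : {poly F} => (coef1 f == c1) && (coef2 f == c2)) / q ^+ (m + n./2).
Proof.
have n2 : (2 <= n)%N by lia.
have q0 : q != 0 by rewrite pnatr_eq0 -lt0n prime_gt0.
have szd (z : {poly_m F} * {poly_m F}) : (size (liftp z.1 + pP * liftp z.2)%R <= m)%N.
  exact: size_digit_poly.
have hm := hdim_le.
rewrite /Pmax density_sum => [|[A H] K]; last first.
  rewrite /digit_poly/= => sz.
  have [d [g [k [dm fE red kE]]]] := topf_square_decomposition A.
  rewrite !addrA (maximal_topfP dm kE) ?(szd (A, H))//.
  rewrite -addrA expr2 -[pP * pP * K]mulrA -mulrDr (maximal_topfP dm kE)//; last first.
    by move: sz; rewrite -addrA expr2 -[pP * pP * K]mulrA -mulrDr.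
  by rewrite !rmorphD/= redp_pM addr0.
rewrite (eq_bigr (fun A : {poly_m F} => q ^+ (m - hdim true n) *
    \sum_(h : {poly_(hdim true n) F}) (`[< square_reduced (topF + A) h >])%:R)) => [|A _]; last first.
  have [d [g [k [dm fE red kE]]]] := topf_square_decomposition A.
  have f0 : topF + A != 0 by rewrite monic_neq0// topf_add_monic// size_npoly.
  have [e se] : exists e, size d = e.+1.
    by exists (size d).-1; rewrite prednK// size_poly_gt0 monic_neq0.
  have eh : (e <= hdim true n)%N.
    have : (size (d ^+ 2) <= size (topF + A)%R)%N by rewrite dvdp_leq// fE dvdp_mulIl.
    rewrite size_topf_add ?size_npoly// size_monicM ?monic_neq0// se /hdim.
    by clear; lia.
  rewrite (eq_bigr (fun H : {poly_m F} => (coprimep d (redp k + H))%:R)) => [|H _]; last first.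
    congr (nat_of_bool _)%:R; apply/asboolP/idP.
      by move=> /(maximal_topfP dm kE red (szd (A, H))); rewrite rmorphD/= liftpK.
    by move=> cop; apply/(maximal_topfP dm kE red (szd (A, H))); rewrite rmorphD/= liftpK.
  rewrite (sum_mod_poly R _ dm se) ?(leq_trans eh)//; last exact: coprimep_congr.
  rewrite (eq_bigr (fun h : {poly_(hdim true n) F} => (coprimep d (0 + h))%:R)) => [|h _]; last first.
    congr (nat_of_bool _)%:R; rewrite add0r; apply/asboolP/idP.
      by move/(square_reduced_coprimep h f0 fE red).
    by move=> cop; apply/(square_reduced_coprimep h f0 fE red).
  rewrite (sum_mod_poly R _ dm se eh); last exact: coprimep_congr.
  rewrite card_Fp// mulrA -exprD; congr (_ ^+ _ * _).
  by move: (hdim _ _) eh hm => h eh hm; lia.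
rewrite -mulr_sumr (sum_topf c1 c2 (fun f : {poly F} => \sum_(h : {poly_(hdim true n) F})
   (`[< square_reduced f h >])%:R))//.
rewrite /red_count -(pair_bigA _ (fun (a : {poly_n F}) (b : {poly_(hdim true n) F}) =>
  ((coef1 (mon a) == c1) && (coef2 (mon a) == c2) && `[< square_reduced (mon a) b >])%:R))/=.
under [X in _ = X / _]eq_bigr do under eq_bigr do rewrite -mulnb natrM.
under [X in _ = X / _]eq_bigr do rewrite -mulr_sumr.
rewrite mulrAC [RHS]mulrC; congr (_ * _); apply/eqP.
rewrite -[eqbRHS]mul1r eqr_div ?expf_neq0// mul1r -exprD /hdim mul1n; apply/eqP; congr (_ ^+ _).
by move: n3; clear; lia.
Qed.

Local Notation squarefree f := (square_reduced f 0).

(** Equal to 0 or 1 by uniqueness of the square part; as a sum it can be exchanged with the sum over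
    f. *)
Definition double_root (f : {poly F}) : R :=
  \sum_r \sum_(g : {poly_m F})
    [&& f == ('X - r%:P) ^+ 2 * mon g, ~~ root (mon g) r & `[< squarefree (mon g) >]]%:R.

(** Evaluation at r is reduction modulo x - r, so the values are equidistributed. *)
Lemma sum_hornerE (r c : F) :
  \sum_(H : {poly_m F}) ((H : {poly F}).[r] + c != 0)%:R = q ^+ (m - 1) * (q - 1) :> R.
Proof.
have Q (u v : {poly F}) : 'X - r%:P %| u - v -> (u.[r] != 0) = (v.[r] != 0).
  by rewrite dvdp_XsubCl => /eqP; rewrite hornerD hornerN => /eqP; rewrite subr_eq0 => /eqP->.
have m1 : (1 <= m)%N by lia.
rewrite (eq_bigr (fun H : {poly_m F} => ((c%:P + H).[r] != 0)%:R)) => [|H _]; last first.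
  by rewrite hornerD hornerC addrC.
rewrite (sum_mod_poly R _ (monicXsubC r) (size_XsubC r) m1 Q) card_Fp//; congr (_ * _).
rewrite (eq_bigr (fun h : {poly_1 F} => ((mon h).[r] - r != 0)%:R)) => [|h _]; last first.
  by rewrite /mon hornerD expr1 hornerX addrAC subrr add0r.
rewrite (sum_mon1 (fun f : {poly F} => (f.[r] - r != 0)%:R))/=.
rewrite (eq_bigr (fun c : F => 1 - (c == 0)%:R)) => [|x _]; last first.
  rewrite hornerXsubC addrAC subrr add0r oppr_eq0.
  by case: eqP => _; rewrite /= ?subrr ?subr0.
rewrite big_split/= sumr_const sumrN; congr (_ - _).
  by rewrite card_Fp.
rewrite -[RHS](sum_pred1 (R := R) (fun=> 1) (0 : F)).
by apply: eq_bigr => i _; rewrite mulr1.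
Qed.

(** If f has the single double root r modulo p and rho lifts r, then f(rho) = p (k0 + H(rho)), and
    the criterion reads H(r) + k0 <> 0: a proportion 1 - 1/p of the H. *)
Lemma sqf_digit_count (A : {poly_m F}) :
  \sum_(H : {poly_m F}) (`[< sqf_disc_poly (topf n b1 b2 + liftp A + pP * liftp H) >])%:R =
  q ^+ m * (`[< squarefree (topF + A) >])%:R
  + (odd p)%:R * (q ^+ (m - 1) * (q - 1)) * double_root (topF + A).
Proof.
have n2 : (2 <= n)%N by lia.
pose f (H : {poly_m F}) := topf n b1 b2 + liftp A + pP * liftp H.
have szd (H : {poly_m F}) : (size (liftp A + pP * liftp H)%R <= m)%N by exact: (size_digit_poly p_pr (A, H)).
have fm H : f H \is monic by rewrite /f -addrA topf_add_monic.
have f1 H : (1 < size (f H))%N by rewrite /f -addrA size_topf_add//; lia.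
have redf H : redp (f H) = topF + A.
  by rewrite /f rmorphD/= redp_pM addr0 rmorphD/= redp_topf liftpK.
have f0 : topF + A != 0 by rewrite monic_neq0// topf_add_monic// size_npoly.
have [sqf|nsqf] := pselect (squarefree (topF + A)).
  rewrite [X in _ + _ * X]big1 ?mulr0 ?addr0 => [|r _]; last first.
    rewrite big1// => g _; case: eqP => //= fE.
    have := sqf ('X - r%:P); rewrite fE dvdp_mulIl dvdp0 size_XsubC.
    by move=> /(_ isT isT).
  rewrite (eq_bigr (fun=> 1)) => [|H _]; last first.
    by rewrite asboolT//; apply/(sqf_discP (fm H) (f1 H)); left; rewrite redf.
  by rewrite sum_npoly card_Fp// asboolT.
rewrite [X in (X : bool)%:R]asboolF// mulr0 add0r.
have [[r [g [fE gr gsq]]]|nex] := pselect (exists r (g : {poly_m F}),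
    [/\ topF + A = ('X - r%:P) ^+ 2 * mon g, ~~ root (mon g) r & squarefree (mon g)]); last first.
  rewrite [X in _ = _ * X]big1 ?mulr0 => [|r _]; last first.
    rewrite big1// => g _; case: eqP => //= fE; case: (boolP (root _ _)) => //= gr.
    by case: asboolP => // gsq; case: nex; exists r, g.
  rewrite big1// => H _; rewrite asboolF//.
  case/(sqf_discP (fm H) (f1 H)); rewrite redf// => -[po [r [g [fE gsq gr _]]]].
  have gm : g \is monic.
    have := topf_add_monic c1 c2 n2 (size_npoly A).
    by rewrite fE monicMl// monic_exp// monicXsubC.
  have [|a aE] := @monP _ m g gm.
    have := size_topf_add c1 c2 n2 (size_npoly A).
    rewrite fE size_monicM ?monic_exp ?monicXsubC ?monic_neq0// size_exp_XsubC/=.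
    by move: (size g) => sg; lia.
  by apply: nex; exists r, a; rewrite -aE.
have drE : double_root (topF + A) = 1.
  have uniq r' (g' : {poly_m F}) : topF + A = ('X - r'%:P) ^+ 2 * mon g' -> squarefree (mon g') ->
      r' = r /\ g' = g.
    move=> fE' gsq'; have E : 'X - r'%:P = 'X - r%:P :> {poly F}.
      apply: (square_decomposition_unique (h := 0) (k := 0) (k' := 0) f0 _ fE' _ gsq' _ fE _ gsq);
        by rewrite ?monicXsubC ?mulr0.
    split; first by move: E => /addrI/oppr_inj/polyC_inj.
    have /mulfI/(_ _ _) : ('X - r%:P) ^+ 2 != 0 :> {poly F} by rewrite expf_neq0 ?polyXsubC_eq0.
    by move=> h; apply: mon_inj; apply: h; rewrite -{1}E -fE' fE.
  rewrite /double_root (bigD1 r)//= (bigD1 g)//= fE eqxx gr asboolT//= !big1 ?addr0//.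
    move=> r' r'r; rewrite big1// => g' _; rewrite -fE; case: eqP => //= fE'.
    rewrite (_ : _ && _ = false)//; apply/negP => /andP[_ /asboolP gsq'].
    by have [rr' _] := uniq _ _ fE' gsq'; rewrite rr' eqxx in r'r.
  move=> g' g'g; rewrite -fE; case: eqP => //= fE'.
  rewrite (_ : _ && _ = false)//; apply/negP => /andP[_ /asboolP gsq'].
  by have [_ gg'] := uniq _ _ fE' gsq'; rewrite gg' eqxx in g'g.
rewrite drE mulr1.
case: (boolP (odd p)) => [po|pe]; last first.
  rewrite mul0r big1// => H _; rewrite asboolF// => /(sqf_discP (fm H) (f1 H)).
  by rewrite redf => -[//|[]]; rewrite (negPf pe).
pose rho := zlift p_pr r.
have [k0 k0E] : exists c, (topf n b1 b2 + liftp A).[rho] = pZ * c.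
  have [|K ->] := @redp_congr p p_pr (topf n b1 b2 + liftp A) (liftp (('X - r%:P) ^+ 2 * mon g)).
    by rewrite rmorphD/= redp_topf !liftpK.
  have [c cE] : exists c, (liftp (('X - r%:P) ^+ 2 * mon g)).[rho] = pZ * c.
    apply/red_eq0P; rewrite -horner_map/= zliftK -[map_poly _ _]/(redp _) liftpK.
    by rewrite hornerM horner_exp hornerXsubC subrr expr0n mul0r.
  by exists (c + K.[rho]); rewrite hornerD cE hornerM -polyC_natr hornerC mulrDr.
rewrite mul1r -(sum_hornerE r (red k0)); apply: eq_bigr => H _; congr (nat_of_bool _)%:R.
have fH : (f H).[rho] = pZ * (k0 + (liftp H).[rho]).
  by rewrite /f hornerD k0E hornerM -polyC_natr hornerC mulrDr.
have HE : (H : {poly F}).[r] + red k0 = red (k0 + (liftp H).[rho]).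
  by rewrite rmorphD/= -horner_map/= zliftK -[map_poly _ _]/(redp _) liftpK addrC.
apply/asboolP/idP => [|Hr].
  case/(sqf_discP (fm H) (f1 H)); rewrite redf// => -[_ [r' [g' [fE' gsq' gr' nd]]]].
  have rr : r' = r.
    have E : 'X - r'%:P = 'X - r%:P :> {poly F}.
      apply: (square_decomposition_unique (h := 0) (k := 0) (k' := 0) f0 _ fE' _ gsq' _ fE _ gsq);
        by rewrite ?monicXsubC ?mulr0.
    by move: E => /addrI/oppr_inj/polyC_inj.
  apply/negP => Hr; apply: nd; rewrite rr -/rho fH.
  have /red_eq0P[c ->] : red (k0 + (liftp H).[rho]) == 0 by rewrite -HE.
  by exists c; rewrite expr2 mulrA.
apply/(sqf_discP (fm H) (f1 H)); right; split=> //; exists r, (mon g).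
rewrite redf; split=> // -[c]; rewrite -/rho fH expr2 -mulrA => /(mulfI (pZ_neq0 p_pr)) E.
by case/negP: Hr; rewrite HE; apply/red_eq0P; exists c.
Qed.

Lemma sqf_disc_add_p2 (f K : {poly Zp}) : f \is monic -> f + pP ^+ 2 * K \is monic ->
  (1 < size f)%N -> (1 < size (f + pP ^+ 2 * K)%R)%N ->
  sqf_disc_poly f -> sqf_disc_poly (f + pP ^+ 2 * K).
Proof.
move=> fm fm' f1 f1' /(sqf_discP fm f1) sqf; apply/(sqf_discP fm' f1').
have -> : redp (f + pP ^+ 2 * K) = redp f.
  by rewrite rmorphD/= expr2 -mulrA redp_pM addr0.
case: sqf => [sqf|[po [r [g [fE gsq gr nd]]]]]; [by left|right].
split=> //; exists r, g; split=> // -[c].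
have -> : (pP ^+ 2) = (pZ ^+ 2)%:P by rewrite polyC_exp polyC_natr.
rewrite hornerD hornerM hornerC => E; apply: nd; exists (c - K.[zlift p_pr r]).
by rewrite mulrBr -E addrK.
Qed.

Lemma Psqf_red_count : Psqf mu V =
  (red_count R false n (fun f : {poly F} => (coef1 f == c1) && (coef2 f == c2))
   + (odd p)%:R * (1 - q^-1) *
     \sum_r \sum_(g : {poly_m F}) [&& coef1 (('X - r%:P) ^+ 2 * mon g) == c1,
       coef2 (('X - r%:P) ^+ 2 * mon g) == c2, ~~ root (mon g) r
       & `[< squarefree (mon g) >]]%:R) / q ^+ m.
Proof.
have n2 : (2 <= n)%N by lia.
have q0 : q != 0 by rewrite pnatr_eq0 -lt0n prime_gt0.
rewrite /Psqf density_sum => [|z K sz]; last first.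
  have fm (P : {poly Zp}) : (size P <= m)%N -> topf n b1 b2 + P \is monic by exact: topf_add_monic.
  have f1 (P : {poly Zp}) : (size P <= m)%N -> (1 < size (topf n b1 b2 + P)%R)%N.
    by move=> sP; rewrite size_topf_add//; lia.
  move: (size_digit_poly p_pr z) sz; move: (digit_poly p_pr z) => D sD.
  rewrite addrA => sz.
  have fm' : topf n b1 b2 + D + pP ^+ 2 * K \is monic by rewrite -addrA fm.
  have f1' : (1 < size (topf n b1 b2 + D + pP ^+ 2 * K)%R)%N by rewrite -addrA f1.
  split; last exact: sqf_disc_add_p2 (fm _ sD) fm' (f1 _ sD) f1'.
  have DE : topf n b1 b2 + D + pP ^+ 2 * K + pP ^+ 2 * (- K) = topf n b1 b2 + D.
    by rewrite mulrN addrK.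
  have := @sqf_disc_add_p2 (topf n b1 b2 + D + pP ^+ 2 * K) (- K).
  by rewrite DE; apply => //; [exact: fm|exact: f1].
rewrite (eq_bigr _ (fun A _ => sqf_digit_count A)) big_split/= -!mulr_sumr.
have tot := sum_topf c1 c2 (fun f : {poly F} => (`[< squarefree f >])%:R : R) n2.
rewrite tot (sum_topf c1 c2 double_root n2).
rewrite red_count_squarefree.
set S := \sum_(i : {poly_n F}) _; rewrite (_ : \sum_(a : {poly_n F}) _ * double_root _ =
  \sum_r \sum_(g : {poly_m F}) [&& coef1 (('X - r%:P) ^+ 2 * mon g) == c1,
       coef2 (('X - r%:P) ^+ 2 * mon g) == c2, ~~ root (mon g) r
       & `[< squarefree (mon g) >]]%:R); last first.
  rewrite /double_root; under eq_bigr do rewrite mulr_sumr.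
  rewrite exchange_big/=; apply: eq_bigr => r _.
  under eq_bigr do rewrite mulr_sumr.
  rewrite exchange_big/=; apply: eq_bigr => g _.
  have [||a aE] := @monP _ n (('X - r%:P) ^+ 2 * mon g).
  - by rewrite monicMl ?mon_monic// monic_exp// monicXsubC.
  - by rewrite size_monicM ?monic_exp ?monicXsubC ?mon_neq0// size_exp_XsubC size_mon/=; lia.
  rewrite (bigD1 a)//= big1 ?addr0 => [|a' a'a]; last first.
    rewrite aE; case: (mon a' =P mon a) => [/mon_inj a'E|]; last by rewrite mulr0.
    by rewrite a'E eqxx in a'a.
  by rewrite aE eqxx -natrM mulnb andTb -!andbA.
set D := \sum_r _; set S' := \sum_(g : {poly_n F}) _.
have -> : S' = S by apply: eq_bigr => a _; rewrite -mulnb natrM.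
rewrite -mulrA.
have -> : q ^+ (m - 1) * (q - 1) = q ^+ m * (1 - q^-1).
  by rewrite [in RHS](_ : m = (m - 1).+1) ?exprS; [field|lia].
rewrite exprD; field.
by rewrite q0 expf_neq0.
Qed.
End DensityCount.

(** * Explicit densities and error terms *)

Section PowerSums.
Variables (R : realFieldType) (F : finFieldType).
Hypothesis F2 : (2%:R : F) != 0.

Lemma psum_coefE (f : {poly F}) c1 c2 :
  (psum1 f == - c1) && (psum2 f == c1 ^+ 2 - 2 * c2) = (coef1 f == c1) && (coef2 f == c2).
Proof.
rewrite /psum1 /psum2 (inj_eq oppr_inj); case: eqP => //= ->.
by rewrite (inj_eq (addrI _)) (inj_eq oppr_inj) (inj_eq (mulfI F2)).
Qed.

Lemma red_count_psum tau n c1 c2 :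
  red_count R tau n (fun f : {poly F} => (coef1 f == c1) && (coef2 f == c2)) =
  psum_count R tau n (- c1) (c1 ^+ 2 - 2 * c2).
Proof. by apply: eq_bigr => z _; rewrite psum_coefE. Qed.

(** (x - r)^2 has power sums 2 r and 2 r^2, whence the exponent 2. *)
Lemma double_root_count k c1 c2 :
  \sum_r \sum_(g : {poly_k F}) [&& coef1 (('X - r%:P) ^+ 2 * mon g) == c1,
    coef2 (('X - r%:P) ^+ 2 * mon g) == c2, ~~ root (mon g) r
    & `[< square_reduced (mon g) 0 >]]%:R = root_count R k 2%:R (- c1) (c1 ^+ 2 - 2 * c2).
Proof.
apply: eq_bigr => r _; apply: eq_bigr => g _; congr (nat_of_bool _)%:R.
rewrite andbA -psum_coefE expr2.
have Xr := monicXsubC r; have gm := mon_monic g.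
rewrite !psum1M ?psum2M ?monicMl// psum1_XsubC psum2_XsubC -andbA.
by rewrite [in RHS]addrC [psum2 _ + _ in RHS]addrC !mulr_natl !mulr2n.
Qed.
End PowerSums.

Section OddPrime.
Variables (R : realType) (p : nat) (p_pr : prime p) (n : nat).
Hypothesis n3 : (3 <= n)%N.
Variable mu : probability (borel_Zp p_pr (n - 2)) R.
Hypothesis mu_inv : translation_invariant mu.
Local Notation Zp := (padic_int p_pr).
Local Notation red := (@red p p_pr).
Local Notation F := ('F_p).
Local Notation q := (p%:R : R).
Local Notation m := (n - 2)%N.
Variables b1 b2 : Zp.
Local Notation V := (Vn_fixed n b1 b2).
Local Notation c1 := (red b1).
Local Notation c2 := (red b2).
Local Notation s := (- c1).
Local Notation t := (c1 ^+ 2 - 2 * c2).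

Lemma natr_prime_ge2 : 2 <= q. Proof. by rewrite ler_nat prime_gt1. Qed.

Lemma density_char2 : p = 2%N -> Psqf mu V = 1 / 2 /\ Pmax mu V = 3 / 4.
Proof.
move=> p2; have F2 : (2%:R : F) = 0 by apply/eqP; rewrite Fp_natr_eq0// p2.
have q0 : q != 0 by have := natr_prime_ge2; lra.
rewrite (Psqf_red_count n3 mu_inv) (Pmax_red_count n3 mu_inv).
have -> : odd p = false by rewrite p2.
have nE : n = (n - 3).+3 by lia.
have mE : m = (n - 3).+1 by lia.
have rc tau := red_count_char2 R tau F2 (n - 3) c1 c2.
rewrite -nE in rc; rewrite !rc card_Fp// !mul0r addr0 mE /hdim !mul1n !mul0n !addn0.
split; first by rewrite exprS mulrBl divff ?mulf_neq0 ?expf_neq0// invfM mulrCA divff ?expf_neq0// mulr1 p2; lra.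
have -> : ((n - 3).+1 + n./2 = (n - 3 + ((n - 3).+1)./2).+2)%N by lia.
move: (n - 3 + _)%N => e; rewrite !exprS p2.
have : (2 : R) ^+ e != 0 by rewrite expf_neq0.
by move: (2 ^+ e : R) => x x0; field.
Qed.

Hypothesis p_odd : odd p.

Lemma Fp2_neq0 : (2%:R : F) != 0.
Proof. by rewrite Fp_natr_eq0// dvdn_prime2//; apply: contraTneq p_odd => ->. Qed.

Definition curve_defect : R := curve_count R (weights F n) s t - q ^+ uphalf n / q ^+ 2.

Lemma natr_prime_ge3 : 3 <= q.
Proof. by rewrite ler_nat; case: p p_pr p_odd => [|[|[]]]. Qed.

Lemma Pmax_oddE : Pmax mu V = 1 - 1 / q ^+ 2 + (- 1) ^+ n./2 * curve_defect / q ^+ (m + n./2).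
Proof.
have q0 : q != 0 by have := natr_prime_ge2; lra.
rewrite (Pmax_red_count n3 mu_inv) (red_count_psum R Fp2_neq0).
have nE : n = m.+2 by lia.
rewrite [in psum_count _ _ _ _ _]nE (psum_countE R true Fp2_neq0) -nE card_Fp// -/curve_defect.
have -> : (n + hdim true n = (m + n./2).+2)%N by rewrite /hdim mul1n; lia.
have -> : (m.+1 + hdim true m = m + n./2)%N by rewrite /hdim mul1n; lia.
have : q ^+ (m + n./2) != 0 by rewrite expf_neq0.
rewrite !exprS; move: (q ^+ _) => x x0; field.
by rewrite x0 q0.
Qed.

Lemma red_count_false : red_count R false n (fun f : {poly F} => (coef1 f == c1) && (coef2 f == c2)) =
  q ^+ m - q ^+ m / q + (- 1) ^+ n./2 * curve_defect.
Proof.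
have q0 : q != 0 by have := natr_prime_ge2; lra.
have nE : n = m.+2 by lia.
rewrite (red_count_psum R Fp2_neq0) [in psum_count _ _ _ _ _]nE (psum_countE R false Fp2_neq0) -nE card_Fp//.
rewrite -/curve_defect /hdim !mul0n !addn0 [in q ^+ n]nE; congr (_ + _).
by rewrite !exprS; field.
Qed.

Lemma Psqf_oddE : Psqf mu V = 1 - 1 / q +
  ((- 1) ^+ n./2 * curve_defect + (1 - 1 / q) * root_count R m 2%:R s t) / q ^+ m.
Proof.
have q0 : q != 0 by have := natr_prime_ge2; lra.
rewrite (Psqf_red_count n3 mu_inv) p_odd double_root_count; last exact: Fp2_neq0.
rewrite red_count_false.
have : q ^+ m != 0 by rewrite expf_neq0.
rewrite [true%:R](_ : _ = 1)// mul1r.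
by move: (q ^+ m) (root_count _ _ _ _ _) => x y x0; field; rewrite x0 q0.
Qed.

Local Notation err := (q ^+ ((n - 1) %/ 4 + (p %| n)%N)).

Lemma curve_defect_bound : `|curve_defect| <= err.
Proof.
have n0 : (0 < n)%N by lia.
have := curve_count_weights_bound R Fp2_neq0 s t n0; rewrite card_Fp// Fp_natr_eq0//.
by rewrite (_ : (uphalf n).-1./2 = (n - 1) %/ 4)%N//; lia.
Qed.

Lemma root_count_odd_bound :
  `|root_count R m 2%:R s t - q ^+ m * (q - 1) / (q * (q + 1))| <= 42 * err.
Proof.
have q3 := natr_prime_ge3; have e1 : 1 <= err by apply: exprn_ege1; lra.
have := root_count_bound R Fp2_neq0 m 2 s t; rewrite card_Fp// => /le_trans; apply.
have -> : (2 + m = n)%N by lia.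
(* 42 = 1 + 1 + 40: the two boundary terms of [root_count_bound] and the constant of
   [sum_expn_quarter_defect]. *)
rewrite (_ : 42 * err = err + err + 40 * err); last ring.
apply: lerD; first by apply: lerD => //; case: (_ != _) => //=; rewrite (le_trans ler01).
have b : (\sum_(i < m.+1) p ^ ((uphalf i)./2 + (p %| n - i)) <= 40 * p ^ (uphalf m)./2)%N.
  apply: (sum_expn_quarter_defect (delta := fun i => (p %| n - i)%N)); first exact: prime_gt1.
  by move=> k km /dvdn_leq; lia.
rewrite (_ : \sum_(i < _) _ = ((\sum_(i < m.+1) p ^ ((uphalf i)./2 + (p %| n - i)))%N)%:R * q ^+ (p %| n)).
  apply: (@le_trans _ _ ((40 * p ^ (uphalf m)./2)%N%:R * q ^+ (p %| n))).
    by rewrite ler_wpM2r ?ler_nat// exprn_ge0; lra.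
  rewrite natrM natrX -mulrA -exprD (_ : (uphalf m)./2 = (n - 1) %/ 4)%N//.
  by lia.
rewrite natr_sum mulr_suml; apply: eq_bigr => i _.
by rewrite !Fp_natr_eq0// exprD natrX.
Qed.

Lemma err_div e : ((n - 1) %/ 4 <= e)%N ->
  err / q ^+ e = (gcdn n p)%:R / q ^+ (e - (n - 1) %/ 4).
Proof.
move=> le_e; have q0 : q != 0 by have := natr_prime_ge2; lra.
have -> : (gcdn n p)%:R = q ^+ (p %| n).
  case: (boolP (p %| n)%N) => [pn|pn]; first by rewrite (gcdn_idPr pn).
  by have := prime_coprime n p_pr; rewrite pn /coprime gcdnC => /eqP->.
rewrite -{1}(subnK le_e) !exprD.
have : q ^+ (e - (n - 1) %/ 4) != 0 by rewrite expf_neq0.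
have : q ^+ ((n - 1) %/ 4) != 0 by rewrite expf_neq0.
by move: (q ^+ (e - _)) (q ^+ ((n - 1) %/ 4)) (q ^+ (p %| n)) => x y z y0 x0; field; rewrite x0 y0.
Qed.
End OddPrime.

Section OddPrimeDensities.
Variables (R : realType) (p : nat) (p_pr : prime p) (n : nat).
Hypothesis n3 : (3 <= n)%N.
Variable mu : probability (borel_Zp p_pr (n - 2)) R.
Hypothesis mu_inv : translation_invariant mu.
Hypothesis p_odd : odd p.
Local Notation Zp := (padic_int p_pr).
Local Notation q := (p%:R : R).
Local Notation m := (n - 2)%N.
Variables b1 b2 : Zp.
Local Notation V := (Vn_fixed n b1 b2).
Local Notation err := (q ^+ ((n - 1) %/ 4 + (p %| n)%N)).
Local Notation defect := (curve_defect R n b1 b2).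

Lemma abs_sign_defect : `|(- 1) ^+ n./2 * defect| <= err.
Proof. by rewrite normrM normr_sign mul1r curve_defect_bound. Qed.

Lemma Psqf_odd_bound :
  `|Psqf mu V - (1 - (3 * q - 1) / (q ^+ 2 * (q + 1)))| <=
    43 * ((gcdn n p)%:R / q ^+ ((3 * n) %/ 4 - 1)).
Proof.
have q3 := natr_prime_ge3 R p_pr p_odd; have x0 : 0 < q ^+ m by rewrite exprn_gt0; lra.
have -> : (3 * n %/ 4 - 1 = m - (n - 1) %/ 4)%N by lia.
rewrite -(err_div R p_pr)//; last by lia.
rewrite (Psqf_oddE n3 mu_inv _ _ p_odd).
have dB := abs_sign_defect; have rB := root_count_odd_bound R n3 b1 b2 p_odd.
move: dB rB x0; set d := _ * defect; set rc := root_count _ _ _ _ _.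
move: (q ^+ m) err q3 => x e; move: q => y y3 dB rB x0.
(* The main terms agree: (y - 1)^2 / (y^2 (y + 1)) - 1/y = - (3 y - 1) / (y^2 (y + 1)). *)
rewrite (_ : _ - _ = (d + (1 - 1 / y) * (rc - x * (y - 1) / (y * (y + 1)))) / x); last first.
  by field; lra.
rewrite normrM normfV (gtr0_norm x0) mulrA ler_wpM2r ?invr_ge0 ?(ltW x0)//.
apply: le_trans (ler_normD _ _) _; rewrite [X in _ + X <= _]normrM.
have yi : 0 <= 1 - 1 / y <= 1.
  by rewrite subr_ge0 gerBl mul1r invr_ge0 invf_le1 ; lra.
rewrite (_ : 43 * e = e + 42 * e); last ring.
apply: lerD => //; apply: le_trans rB.
by rewrite ler_piMl// ger0_norm; lra.
Qed.

Lemma Pmax_odd_bound :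
  `|Pmax mu V - (1 - 1 / q ^+ 2)| <=
    1 * ((gcdn n p)%:R / q ^+ ((3 * n) %/ 4 + n %/ 2 - 1)).
Proof.
have q3 := natr_prime_ge3 R p_pr p_odd; have x0 : 0 < q ^+ (m + n./2) by rewrite exprn_gt0; lra.
have -> : (3 * n %/ 4 + n %/ 2 - 1 = m + n./2 - (n - 1) %/ 4)%N by lia.
rewrite -(err_div R p_pr)//; last by lia.
rewrite (Pmax_oddE n3 mu_inv _ _ p_odd) addrAC subrr add0r mul1r.
by rewrite normrM normfV (gtr0_norm x0) ler_wpM2r ?invr_ge0 ?(ltW x0)// abs_sign_defect.
Qed.

Hypothesis n4 : (4 <= n)%N.

(** A deviation of at most 1/q of the total q^(n-2) is what positivity needs; for n = 3 and p = 3,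
    [abs_sign_defect] only gives the bound q. *)
Lemma defect_lt : `|(- 1) ^+ n./2 * defect| <= q ^+ m / q.
Proof.
apply: le_trans abs_sign_defect _; have q3 := natr_prime_ge3 R p_pr p_odd.
have -> : q ^+ m / q = q ^+ (m - 1).
  by rewrite {1}(_ : m = (m - 1).+1) ?exprSr ?mulfK//; [lra|lia].
apply: ler_weXn2l; first lra.
have [n5|n5] := leqP 5 n; first by case: (_ %| _)%N => /=; lia.
have -> : n = 4%N by lia.
suff -> : (p %| 4)%N = false by [].
apply/negP; rewrite -[4%N]/(2 ^ 2)%N Euclid_dvdX// dvdn_prime2// andbT => /eqP p2.
by move: (p_odd); rewrite p2.
Qed.

(** The squarefree density is at least 1 - 2/q because [root_count] is nonnegative, and the other
    one at least 1 - 1/q^2 - 1/q^(1 + floor(n/2)); both are positive as q >= 3. *)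
Lemma density_odd_gt0 : 0 < Psqf mu V /\ 0 < Pmax mu V.
Proof.
have q3 := natr_prime_ge3 R p_pr p_odd; have := defect_lt.
rewrite ler_norml => /andP[dl _]; split.
  rewrite (Psqf_oddE n3 mu_inv _ _ p_odd).
  have rc0 : 0 <= root_count R m 2%:R (- red b1) (red b1 ^+ 2 - 2 * red b2).
    by apply: sumr_ge0 => r _; apply: sumr_ge0 => g _.
  have x0 : 0 < q ^+ m by rewrite exprn_gt0; lra.
  move: rc0 dl x0; set d := _ * defect; move: (root_count _ _ _ _ _) => rc.
  move: (q ^+ m) q3 => x; move: q => y y3 rc0 dl x0.
  have yi : 0 < y^-1 <= 1/3 by rewrite invr_gt0 mul1r lef_pV2 ?posrE; lra.
  have dx : - y^-1 <= d / x by rewrite ler_pdivlMr// mulNr mulrC.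
  have : 0 <= (1 - 1 / y) * rc / x.
    by rewrite !mulr_ge0 ?invr_ge0 ?(ltW x0)//; lra.
  by rewrite mulrDl mul1r; lra.
rewrite (Pmax_oddE n3 mu_inv _ _ p_odd) exprD.
have x0 : 0 < q ^+ m by rewrite exprn_gt0; lra.
have z1 : q <= q ^+ n./2 by rewrite -[X in X <= _]expr1; apply: ler_weXn2l; [lra|lia].
move: dl x0 z1; set d := _ * defect; move: (q ^+ m) (q ^+ n./2) q3 => x z; move: q => y y3 dl x0 yz.
have yi : 0 < y^-1 <= 1/3 by rewrite invr_gt0 mul1r lef_pV2 ?posrE; lra.
have zi : 0 < z^-1 <= 1/3 by rewrite invr_gt0 mul1r lef_pV2 ?posrE; lra.
have dx : - y^-1 <= d / x by rewrite ler_pdivlMr// mulNr mulrC.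
rewrite expr2 !invfM !mulrA mul1r.
by move: (y^-1) (z^-1) (d / x) yi zi dx => u v w ? ? ?; nra.
Qed.
End OddPrimeDensities.

(** * Vanishing of the deviation for integers b1 and b2 *)

Section CurveDefectZero.
Variables (R : realType) (p : nat) (p_pr : prime p) (n : nat) (b1 b2 : int).
Hypotheses (p_odd : odd p) (n3 : (3 <= n)%N).
Local Notation F := ('F_p).
Local Notation N := (n%:Z * (b1 ^+ 2 - 2 * b2) - b1 ^+ 2).
Local Notation defect := (curve_defect R n (b1%:~R : padic_int p_pr) b2%:~R).

Lemma Fp_intr_eq0 (x : int) : (x%:~R == 0 :> F) = (p %| `|x|)%N.
Proof.
by case: (intP x) => [|k|k]; rewrite ?mulrNz ?oppr_eq0 ?abszN Fp_natr_eq0 ?dvdn0//.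
Qed.

(** Completing the square adds the weight - n and so reverses the parity of the number of weights;
    the level t - s^2/n is [N] / n modulo p. *)
Lemma curve_defect_nondeg : ~~ (p %| n)%N ->
  (defect == 0) = if odd (uphalf n) then false else (p %| `|N|)%N.
Proof.
move=> pn; have F2 := Fp2_neq0 p_pr p_odd; have nF : (n%:R : F) != 0 by rewrite Fp_natr_eq0.
have nE : n = (n - 2).+2 by lia.
have wE : weights F n = 2 :: weights F (n - 2) by rewrite {1}nE weightsS2.
have wW := weight_weights F n.
have cF : p%:R = #|F|%:R :> R by rewrite card_Fp.
have q0 := card_neq0 R F.
have nall : all (fun w => w != 0) (- n%:R :: weights F n).
  by rewrite /= oppr_eq0 nF all_weights.
rewrite /curve_defect cF -(size_weights F); move: wW nall; rewrite wE => wW nall.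
rewrite (curve_count_nondeg R F2) ?wW// mulf_eq0 invr_eq0 (negPf q0) orbF -wE.
rewrite -wE in nall.
case: (boolP (odd (size (weights F n)))) => un.
  by apply: negbTE; apply: (diag_error_even R F2); rewrite /= ?un.
rewrite (diag_error_odd R F2)//; 
rewrite !rmorph_int -Fp_intr_eq0 -(inj_eq (mulfI nF)) mulr0; congr (_ == 0).
rewrite !(rmorphB, rmorphM, rmorphXn)/= -pmulrn.
by field; rewrite nF.
Qed.

(** Total weight and s both vanish modulo p, so the deviation is that of the whole quadric in an
    even number of variables. *)
Lemma curve_defect_deg : (p %| n)%N -> (p %| `|b1|)%N -> ~~ odd (uphalf n) -> defect != 0.
Proof.
move=> pn pb un; have F2 := Fp2_neq0 p_pr p_odd.
have nE : n = (n - 2).+2 by lia.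
have wE : weights F n = 2 :: weights F (n - 2) by rewrite {1}nE weightsS2.
have cF : p%:R = #|F|%:R :> R by rewrite card_Fp.
have wW : weight (weights F n) = 0 by rewrite weight_weights; apply/eqP; rewrite Fp_natr_eq0.
have b0 : red (b1%:~R : padic_int p_pr) = 0 by rewrite rmorph_int; apply/eqP; rewrite Fp_intr_eq0.
rewrite /curve_defect cF -(size_weights F) b0 oppr0.
rewrite wE in wW *; rewrite (curve_count_deg0 R F2)// -wE.
by apply: (diag_error_even R F2); rewrite ?all_weights// size_weights.
Qed.
End CurveDefectZero.

Section Integers.
Variables (R : realType) (n : nat) (b1 b2 : int).
Hypothesis n3 : (3 <= n)%N.
Local Notation N := (n%:Z * (b1 ^+ 2 - 2 * b2) - b1 ^+ 2).
Local Notation defect p_pr := (curve_defect R n (b1%:~R : padic_int p_pr) b2%:~R).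

Lemma curve_defect_all0 :
  (forall p (p_pr : prime p), odd p -> defect p_pr = 0) <->
  (exists k, n = (2 ^ k)%N) /\ N = 0.
Proof.
have odd_above a : (2 < a)%N -> exists2 p, (a < p)%N & prime p /\ odd p.
  move=> a2; have [p ap p_pr] := prime_above a; exists p => //; split=> //.
  by have [p2|//] := even_prime p_pr; move: ap; rewrite p2; lia.
split=> [all0|[[k nk] N0] p p_pr po]; last first.
  (* n >= 3 gives k >= 2, so that the number 2^(k - 1) of weights is even. *)
  have k2 : (2 <= k)%N by case: k nk => [|[|]]// nk; move: n3; rewrite nk.
  apply/eqP; rewrite (curve_defect_nondeg R) ?N0 ?dvdn0//.
    rewrite ifF//; apply: negbTE; have -> : uphalf n = (2 ^ k.-1)%N.
      by rewrite nk uphalf_half -(subnK k2) !addnS addn0 /= !expnS mul2n doubleK odd_double.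
    by rewrite oddX; case: k k2 {nk} => [|[]].
  rewrite nk Euclid_dvdX// dvdn_prime2//; case: eqP => //= p2.
  by move: po; rewrite p2.
have un : ~~ odd (uphalf n).
  (* A prime above n does not divide n, and there an odd number of weights would exclude
     vanishing. *)
  have [p np [p_pr po]] := odd_above n n3.
  have pn : ~~ (p %| n)%N by rewrite gtnNdvd//; lia.
  have /eqP := all0 p p_pr po; rewrite (curve_defect_nondeg R p_pr b1 b2 po n3 pn).
  by case: odd.
have N0 : N = 0.
  (* A prime above n + |[N]| divides [N] only if [N] = 0. *)
  have [|p np [p_pr po]] := odd_above (n + `|N|)%N; first by lia.
  have pn : ~~ (p %| n)%N by rewrite gtnNdvd//; lia.
  have /eqP := all0 p p_pr po; rewrite (curve_defect_nondeg R p_pr b1 b2 po n3 pn) (negPf un) => pN.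
  apply/eqP; rewrite -absz_eq0; apply: contraTT pN => N0.
  by rewrite gtnNdvd ?lt0n//; apply: leq_ltn_trans np; rewrite leq_addl.
split=> //; have n_2 : (2%N).-nat n.
  apply/andP; split; first by lia.
  apply/allP => p; rewrite mem_primes => /and3P[p_pr _ pn].
  rewrite inE /=; have [->//|po] := even_prime p_pr.
  (* [N] = 0 makes b1^2 a multiple of n, so the degenerate case with s = 0 applies. *)
  have pb : (p %| `|b1|)%N.
    have : (p %| `|b1 ^+ 2|)%N.
      have -> : b1 ^+ 2 = n%:Z * (b1 ^+ 2 - 2 * b2) by move/eqP: N0; rewrite subr_eq0 => /eqP.
      by rewrite abszM dvdn_mulr.
    by rewrite abszX Euclid_dvdX// => /andP[].
  by have := curve_defect_deg R p_pr b2 po n3 pn pb un; rewrite all0// eqxx.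
by have [k nk] := p_natP n_2; exists k.
Qed.
End Integers.

Theorem theorem1p2 (R : realType) :
  exists C1 C2 : R, forall n : nat, (3 <= n)%N ->
  forall mu : (forall p (p_pr : prime p), probability (borel_Zp p_pr (n - 2)) R),
  (forall p (p_pr : prime p), translation_invariant (mu p p_pr)) ->
  (forall p (p_pr : prime p) (b1 b2 : padic_int p_pr),
    let V := Vn_fixed n b1 b2 in
    [/\ odd p ->
          `|Psqf (mu p p_pr) V
              - (1 - (3 * p%:R - 1) / (p%:R ^+ 2 * (p%:R + 1)))|
            <= C1 * ((gcdn n p)%:R / p%:R ^+ ((3 * n) %/ 4 - 1)%N) /\
          `|Pmax (mu p p_pr) V - (1 - 1 / p%:R ^+ 2)|
            <= C2 * ((gcdn n p)%:R / p%:R ^+ ((3 * n) %/ 4 + n %/ 2 - 1)%N),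
        p = 2%N ->
          Psqf (mu p p_pr) V = 1 / 2 /\ Pmax (mu p p_pr) V = 3 / 4 &
        (4 <= n)%N -> 0 < Psqf (mu p p_pr) V /\ 0 < Pmax (mu p p_pr) V]) /\
  (forall b1 b2 : int,
    (forall p (p_pr : prime p),
       Pmax (mu p p_pr) (Vn_fixed n (b1%:~R : padic_int p_pr) (b2%:~R : padic_int p_pr))
         = 1 - 1 / p%:R ^+ 2) <->
    (exists k : nat, n = (2 ^ k)%N) /\
    2 * b2%:~R - (1 - 1 / n%:R) * b1%:~R ^+ 2 = 0 :> rat).
Proof.
exists 43, 1 => n n3 mu mu_inv; split=> [p p_pr b1 b2 V|b1 b2].
  split=> [po|p2|n4]; first split.
  - exact: Psqf_odd_bound.
  - exact: Pmax_odd_bound.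
  - exact: density_char2.
  have [p2|po] := even_prime p_pr; last exact: density_odd_gt0.
  by have [-> ->] := density_char2 n3 (mu_inv p p_pr) b1 b2 p2; lra.
(* The integer is - n times the rational expression. *)
have ratE : (2 * b2%:~R - (1 - 1 / n%:R) * b1%:~R ^+ 2 = 0 :> rat) <->
    n%:Z * (b1 ^+ 2 - 2 * b2) - b1 ^+ 2 = 0.
  have n0 : (n%:R : rat) != 0 by rewrite pnatr_eq0; lia.
  have E : (n%:Z * (b1 ^+ 2 - 2 * b2) - b1 ^+ 2)%:~R =
      - n%:R * (2 * b2%:~R - (1 - 1 / n%:R) * b1%:~R ^+ 2) :> rat.
    by rewrite !(rmorphB, rmorphM, rmorphXn)/= -pmulrn; field.
  split=> H; last by move: E; rewrite H => /esym/eqP; rewrite mulf_eq0 oppr_eq0 (negPf n0) => /eqP.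
  by move: E; rewrite H mulr0 => /eqP; rewrite intr_eq0 => /eqP.
(* 3/4 = 1 - 1/2^2, so the prime 2 imposes no condition. *)
have two p (p_pr : prime p) (c1 c2 : padic_int p_pr) : p = 2%N ->
    Pmax (mu p p_pr) (Vn_fixed n c1 c2) = 1 - 1 / p%:R ^+ 2.
  by move=> p2; rewrite (density_char2 n3 (mu_inv p p_pr) c1 c2 p2).2 p2; lra.
have odd_iff p (p_pr : prime p) : odd p ->
    Pmax (mu p p_pr) (Vn_fixed n (b1%:~R : padic_int p_pr) b2%:~R) = 1 - 1 / p%:R ^+ 2 <->
    curve_defect R n (b1%:~R : padic_int p_pr) b2%:~R = 0.
  move=> po; rewrite (Pmax_oddE n3 (mu_inv p p_pr) _ _ po); split=> [|->]; last first.
    by rewrite mulr0 mul0r addr0.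
  have q0 : (p%:R : R) ^+ (n - 2 + n./2) != 0.
    by rewrite expf_neq0// pnatr_eq0 -lt0n prime_gt0.
  move=> /eqP; rewrite -subr_eq0 addrAC subrr add0r.
  by rewrite mulf_eq0 invr_eq0 (negPf q0) orbF mulf_eq0 signr_eq0 => /eqP.
split=> [Hall|[kn /ratE N0] p p_pr].
  have [kn N0] : (exists k, n = (2 ^ k)%N) /\ n%:Z * (b1 ^+ 2 - 2 * b2) - b1 ^+ 2 = 0.
    by apply/(curve_defect_all0 R b1 b2 n3) => p p_pr po; apply/odd_iff.
  by split=> //; apply/ratE.
have [p2|po] := even_prime p_pr; first exact: two.
by apply/odd_iff => //; apply: (curve_defect_all0 R b1 b2 n3).2 po.
Qed.
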